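(* Let $d\in\{2,3\}$, let $k\ge 2$, $k_A\ge 0$, $k_S\ge 0$ be fixed integers, and let $(\mathcal{T}_\ell)_{\ell\ge 0}$, $A_\ell$, $B_\ell$, $\mathbf{K}_\ell$, $X_\ell$, $\hat A_\ell$, $\hat S_\ell$, $\hat{\mathbf{K}}_\ell$ and $\mathbf{S}_\ell=\mathbf{I}_\ell-\hat{\mathbf{K}}_\ell^{-1}\mathbf{K}_\ell$ be as defined in the context (in particular, the discrete pressures have mean value zero). Here $\hat S_\ell$ is built from any one of the three diagonal matrices $\tilde D=\tilde D_{\tilde S_d}$, $\tilde D=\tilde D_{\tilde S_p}$, $\tilde D=\tilde D_{\tilde S_{loc}}$, with the same choice on all levels. Then, for each of these three choices, the smoothing property holds: there is a constant $c>0$, independent of the level $\ell$ and of $m$, such that for all levels $\ell$ and all integers $m\ge 1$ $$\|\mathbf{K}_\ell\,\mathbf{S}_\ell^m\|_{L(X_\ell,X_\ell^* )}\le c\,\eta_0(m-1),\qquad \eta_0(j)=\frac{1}{2^{j}}\binom{j}{\lfloor (j+1)/2\rfloor}.$$ In particular $\|\mathbf{K}_\ell\mathbf{S}_\ell^m\|_{L(X_\ell,X_\ell^* )}\le \eta(m)$ with a function $\eta$ independent of $\ell$ satisfying $\eta(m)=O(1/\sqrt m)$ as $m\to\infty$.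
   Context: **Problem.** $\Omega\subset\mathbb{R}^d$ is a bounded Lipschitz domain, and $\mu>0$, $\varrho>0$, $\gamma\ge 0$ are fixed constants. Let $V=H^1_0(\Omega)^d$ and $Q=L^2_0(\Omega)=\{q\in L^2(\Omega):\int_\Omega q\,dx=0\}$. For $u,v\in V$ and $q\in Q$ let $$a(u,v)=\int_\Omega(\mu\nabla u:\nabla v+\gamma\varrho\,u\cdot v)\,dx,\qquad b(v,q)=\int_\Omega q\,\operatorname{div}v\,dx.$$ ($\gamma=0$ is the Stokes problem, $\gamma>0$ the generalized Stokes problem.) **Meshes.** $\mathcal{T}_\ell$, $\ell=0,1,2,\dots$, are subdivisions of $\Omega$, each obtained from the previous one by uniform refinement. They satisfy the standard compatibility (conforming mesh) and shape regularity conditions, uniformly in $\ell$, and $\mathcal{T}_\ell$ has mesh size $h_\ell$, with all elements of $\mathcal{T}_\ell$ of size comparable to $h_\ell$ uniformly in $\ell$. Each element is $\tau=T_\tau((0,1)^d)$, where: - for $d=2$, $T_\tau$ is bilinear, $\tau$ is a convex quadrilateral, and $\overline\tau$ has at most two edges on $\partial\Omega$, among them no pair of opposite edges; - for $d=3$, $T_\tau$ is affine linear, $\tau$ is a parallelepiped, and $\overline\tau$ has at most three faces on $\partial\Omega$, among them no pair of opposite faces. **Finite element spaces (Taylor–Hood $\mathcal{Q}_k$-$\mathcal{Q}_{k-1}$).** $V_\ell$ consists of all $v\in V$ such that each component of $v|_\tau\circ T_\tau$ is a polynomial of degree at most $k$ in each coordinate, for all $\tau\in\mathcal{T}_\ell$.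 $Q_\ell$ consists of all continuous functions $q\in Q$ (so $\int_\Omega q\,dx=0$) such that $q|_\tau\circ T_\tau$ is a polynomial of degree at most $k-1$ in each coordinate, for all $\tau\in\mathcal{T}_\ell$. The usual nodal basis (with tensor-product nodes) is chosen in $V_\ell$ and in $Q_\ell$, and vectors and matrices refer to these bases. **Matrices.** The level index $\ell$ is dropped below. $A$ is the matrix of $a(\cdot,\cdot)$ on $V_\ell$, $B$ is the matrix of $b(\cdot,\cdot)$ (with $\mathbf{q}^TB\mathbf{v}=b(v,q)$ for the coefficient vectors $\mathbf{v},\mathbf{q}$ of $v\in V_\ell$, $q\in Q_\ell$), $M_p$ is the mass matrix of $Q_\ell$, and $$\mathbf{K}=\begin{pmatrix} A & B^T \\ B & 0 \end{pmatrix}.$$ For $\tau\in\mathcal{T}_\ell$, $A_\tau$ and $B_\tau$ are the element matrices, i.e. the matrices of $a$ and $b$ with the integrals taken over $\tau$ only, on the restrictions to $\tau$ of functions in $V_\ell$ and $Q_\ell$ with the local nodal bases. $P_\tau$ is the Boolean matrix that extracts from a global pressure coefficient vector the coefficients belonging to $\tau$. $\operatorname{diag}(N)$ is the diagonal matrix with the diagonal of $N$. **Chebyshev–Jacobi preconditioner.** For symmetric positive definite matrices $M$ and $D$, an integer $j\ge 0$ and $0<\alpha<\beta$, let $$T_{j+1}(t)=\frac{C_{j+1}\left(\frac{\beta+\alpha-2t}{\beta-\alpha}\right)}{C_{j+1}\left(\frac{\beta+\alpha}{\beta-\alpha}\right)},\quad s_j(t)=\frac{1-T_{j+1}(t)}{t},\quad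 \operatorname{Cheb}(M,D,j)=s_j(D^{-1}M)D^{-1},$$ where $C_{j+1}$ is the Chebyshev polynomial of the first kind of degree $j+1$ ($s_j$ is a polynomial). Always $\beta=\lambda_{\max}(D^{-1}M)$ and $\alpha=\beta/2$, so that $(\beta+\alpha)/(\beta-\alpha)=3$. **Smoother.** Set $$\hat A^{-1}=\frac{C_{k_A+1}(3)}{1+C_{k_A+1}(3)}\operatorname{Cheb}(A,\operatorname{diag}(A),k_A),\qquad \tilde S=B\hat A^{-1}B^T,$$ $$\hat S^{-1}=\frac{C_{k_S+1}(3)}{1+C_{k_S+1}(3)}\operatorname{Cheb}(\tilde S,\tilde D,k_S),$$ with $\tilde D$ one of $$\tilde D_{\tilde S_d}=\operatorname{diag}(B(\operatorname{diag}A)^{-1}B^T),\qquad \tilde D_{\tilde S_p}=\operatorname{diag}(M_p),$$ $$\tilde D_{\tilde S_{loc}}=\sum_{\tau\in\mathcal{T}_\ell}P_\tau^T\operatorname{diag}(B_\tau(\operatorname{diag}A_\tau)^{-1}B_\tau^T)P_\tau.$$ The scalings guarantee $\hat A\ge A$ and $\hat S\ge\tilde S$. The inexact symmetric Uzawa smoother for $\mathbf{K}\mathbf{x}=\mathbf{b}$, with $\mathbf{x}=(\mathbf{u},\mathbf{p})$ and $\mathbf{b}=(\mathbf{f},\mathbf{g})$, is $$\hat{\mathbf{u}}^{j+1}=\mathbf{u}^j+\hat A^{-1}(\mathbf{f}-A\mathbf{u}^j-B^T\mathbf{p}^j),\quad \mathbf{p}^{j+1}=\mathbf{p}^j+\hat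 S^{-1}(B\hat{\mathbf{u}}^{j+1}-\mathbf{g}),\quad \mathbf{u}^{j+1}=\mathbf{u}^j+\hat A^{-1}(\mathbf{f}-A\mathbf{u}^j-B^T\mathbf{p}^{j+1}),$$ equivalently $\mathbf{x}^{j+1}=\mathbf{x}^j+\hat{\mathbf{K}}^{-1}(\mathbf{b}-\mathbf{K}\mathbf{x}^j)$ with $$\hat{\mathbf{K}}=\begin{pmatrix} \hat A & B^T \\ B & B\hat A^{-1}B^T-\hat S \end{pmatrix}.$$ Its iteration matrix is $\mathbf{S}=\mathbf{I}-\hat{\mathbf{K}}^{-1}\mathbf{K}$. **Norms.** $X_\ell=\mathbb{R}^{\dim V_\ell+\dim Q_\ell}$ carries the norm $\|(\mathbf{v},\mathbf{q})\|_{X_\ell}=(h_\ell^{d-2}\|\mathbf{v}\|^2+h_\ell^{d}\|\mathbf{q}\|^2)^{1/2}$ ($\|\cdot\|$ the Euclidean norm). $X_\ell^*$ is its dual, identified with the same coordinate space via the Euclidean pairing, so that $\|(\mathbf{f},\mathbf{g})\|_{X_\ell^*}=(h_\ell^{-(d-2)}\|\mathbf{f}\|^2+h_\ell^{-d}\|\mathbf{g}\|^2)^{1/2}$. $\|\cdot\|_{L(X_\ell,X_\ell^* )}$ is the operator norm. *)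

(* Defs.v *)
From HB Require Import structures.
From mathcomp Require Import all_boot all_order all_algebra.
From mathcomp Require Import all_classical all_reals all_analysis.
Set Implicit Arguments.
Unset Strict Implicit.
Unset Printing Implicit Defensive.
Import Order.TTheory GRing.Theory Num.Theory.
Import numFieldNormedType.Exports.
Local Open Scope classical_set_scope.
Local Open Scope ring_scope.

(* Lebesgue measure on R^n, points being row vectors: the sigma-algebra is the
   Borel one, generated by the coordinates, and [leb R n.+1] is the image of
   the product of [lebesgue_measure] and [leb R n] under (t, x) |-> t :: x. *)

Definition rV_display : measure_display. Proof. exact: default_measure_display. Qed.

Definition rV_coord (R : realType) (n : nat) (i : 'I_n) (x : 'rV[R]_n) : measurableTypeR R := x 0 i.

Lemma rV_measurable0 (R : realType) (n : nat) : g_sigma_preimage (@rV_coord R n) set0.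
Proof. exact: sigma_algebra0. Qed.
Lemma rV_measurableC (R : realType) (n : nat) (A : set 'rV[R]_n) :
  g_sigma_preimage (@rV_coord R n) A -> g_sigma_preimage (@rV_coord R n) (~` A).
Proof. exact: sigma_algebraC. Qed.
Lemma rV_measurable_bigcup (R : realType) (n : nat) (F : (set 'rV[R]_n)^nat) :
  (forall i, g_sigma_preimage (@rV_coord R n) (F i)) ->
  g_sigma_preimage (@rV_coord R n) (\bigcup_i F i).
Proof. exact: sigma_algebra_bigcup. Qed.

HB.instance Definition _ (R : realType) (n : nat) :=
  @isMeasurable.Build rV_display 'rV[R]_n (g_sigma_preimage (@rV_coord R n))
   (@rV_measurable0 R n) (@rV_measurableC R n) (@rV_measurable_bigcup R n).

Definition rV_cons (R : realType) (n : nat) (p : measurableTypeR R * 'rV[R]_n) : 'rV[R]_n.+1 :=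
  \row_i (if unlift ord0 i is Some j then p.2 0 j else p.1).

Lemma measurable_coord (R : realType) (n : nat) (i : 'I_n) :
  measurable_fun [set: 'rV[R]_n] (@rV_coord R n i).
Proof.
move=> _ Y mY; rewrite setTI; apply: sub_sigma_algebra => /=.
rewrite -bigcup_seq/=; exists i => /=; first by rewrite mem_index_enum.
by exists Y => //; rewrite setTI.
Qed.

Lemma measurable_rV (d : measure_display) (S : measurableType d) (R : realType) (n : nat) (f : S -> 'rV[R]_n) :
  (forall i, measurable_fun [set: S] (fun s => rV_coord i (f s))) -> measurable_fun [set: S] f.
Proof.
move=> mf.
suff : g_sigma_preimage (fun i => @rV_coord R n i \o f) `<=` measurable.
  rewrite g_sigma_preimage_comp => H _ A mA; apply: H; by exists A.
apply: smallest_sub; first exact: sigma_algebra_measurable.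
case: n => [|n] in f mf *; first by rewrite big_ord0.
rewrite -bigcup_mkord_ord; apply: bigcup_sub => i Ii.
by move=> A [B mB <-]; exact: mf.
Qed.

Lemma measurable_rV_cons (R : realType) (n : nat) :
  measurable_fun [set: measurableTypeR R * 'rV[R]_n] (@rV_cons R n).
Proof.
apply: measurable_rV => i; rewrite /rV_coord /rV_cons.
case: (unliftP ord0 i) => [j|] ->.
  rewrite (_ : (fun s => _) = @rV_coord R n j \o snd).
    by apply: measurableT_comp => //; exact: measurable_coord.
  by apply/funext => s; rewrite mxE liftK.
rewrite (_ : (fun s => _) = fst); first exact: measurable_fst.
by apply/funext => s; rewrite mxE unlift_none.
Qed.

Definition rV_split (R : realType) (n : nat) (x : 'rV[R]_n.+1) :
    measurableTypeR R * 'rV[R]_n :=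
  (x 0 ord0, \row_j x 0 (lift ord0 j)).

Lemma measurable_rV_split (R : realType) (n : nat) :
  measurable_fun [set: 'rV[R]_n.+1] (@rV_split R n).
Proof.
apply: measurable_fun_pair; first exact: (@measurable_coord R n.+1 ord0).
apply: measurable_rV => i.
rewrite (_ : (fun s => _) = @rV_coord R n.+1 (lift ord0 i)).
  exact: measurable_coord.
by apply/funext => s; rewrite /rV_coord mxE.
Qed.

Lemma rV_consK (R : realType) (n : nat) : cancel (@rV_cons R n) (@rV_split R n).
Proof.
move=> [a y]; rewrite /rV_split /rV_cons mxE unlift_none; congr pair.
by apply/rowP => j; rewrite !mxE liftK.
Qed.

Lemma rV_splitK (R : realType) (n : nat) : cancel (@rV_split R n) (@rV_cons R n).
Proof.
move=> x; apply/rowP => i; rewrite mxE.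
by case: (unliftP ord0 i) => [j|] -> //=; rewrite mxE.
Qed.

Definition leb_succ (R : realType) (n : nat)
    (m : {sigma_finite_measure set 'rV[R]_n -> \bar R}) : set 'rV[R]_n.+1 -> \bar R :=
  pushforward (@lebesgue_measure R \x m)%E (@rV_cons R n).

Lemma measurable_rV_cons_preimage (R : realType) (n : nat) (A : set 'rV[R]_n.+1) :
  measurable A -> measurable (@rV_cons R n @^-1` A).
Proof. by move=> mA; rewrite -[X in measurable X]setTI; exact: measurable_rV_cons. Qed.

Lemma leb_succ0 (R : realType) (n : nat)
    (m : {sigma_finite_measure set 'rV[R]_n -> \bar R}) : leb_succ m set0 = 0%E.
Proof. by rewrite /leb_succ /pushforward preimage_set0 measure0. Qed.

Lemma leb_succ_ge0 (R : realType) (n : nat)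
    (m : {sigma_finite_measure set 'rV[R]_n -> \bar R}) A : (0 <= leb_succ m A)%E.
Proof. by rewrite /leb_succ /pushforward; exact: measure_ge0. Qed.

Lemma leb_succ_sigma_additive (R : realType) (n : nat)
    (m : {sigma_finite_measure set 'rV[R]_n -> \bar R}) :
  semi_sigma_additive (leb_succ m).
Proof.
move=> F mF tF mUF; rewrite /leb_succ /pushforward preimage_bigcup.
apply: measure_semi_sigma_additive.
- by move=> k; exact: measurable_rV_cons_preimage.
- apply/trivIsetP => /= i j _ _ ij; rewrite -preimage_setI.
  by move/trivIsetP : tF => /(_ _ _ _ _ ij) ->//; rewrite preimage_set0.
- by rewrite -preimage_bigcup; exact: measurable_rV_cons_preimage.
Qed.

HB.instance Definition _ (R : realType) (n : nat)
    (m : {sigma_finite_measure set 'rV[R]_n -> \bar R}) :=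
  isMeasure.Build _ _ _ (leb_succ m)
    (leb_succ0 m) (leb_succ_ge0 m) (@leb_succ_sigma_additive R n m).

Lemma leb_succ_sigma_finite (R : realType) (n : nat)
    (m : {sigma_finite_measure set 'rV[R]_n -> \bar R}) :
  sigma_finite setT (leb_succ m).
Proof.
have [F FT Foo] : sigma_finite setT (@lebesgue_measure R \x m)%E.
  have /sigma_finiteP[F [TF ndF Foo]] := sigma_finiteT (@lebesgue_measure R).
  have /sigma_finiteP[G [TG ndG Goo]] := sigma_finiteT m.
  exists (fun k => F k `*` G k).
    rewrite -setXTT TF TG predeqE => -[x y]; split.
      move=> [/= [k _ Fkx] [l _ Gly]]; exists (maxn k l) => //; split.
      - by move: x Fkx; exact/subsetPset/ndF/leq_maxl.
      - by move: y Gly; exact/subsetPset/ndG/leq_maxr.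
    by move=> [k _ []/= ? ?]; split; exists k.
  move=> k; have [? ?] := Foo k; have [? ?] := Goo k.
  split; first exact: measurableX.
  by rewrite product_measure1E// lte_mul_pinfty// ge0_fin_numE.
exists (fun k => @rV_split R n @^-1` F k).
  by rewrite -preimage_bigcup -FT preimage_setT.
move=> k; have [mF Flty] := Foo k; split.
  by rewrite -[X in measurable X]setTI; exact: measurable_rV_split.
rewrite /leb_succ /pushforward -comp_preimage (_ : _ \o _ = id) ?preimage_id//.
by apply/funext => p /=; rewrite rV_consK.
Qed.

HB.instance Definition _ (R : realType) (n : nat)
    (m : {sigma_finite_measure set 'rV[R]_n -> \bar R}) :=
  Measure_isSigmaFinite.Build _ _ _ (leb_succ m) (leb_succ_sigma_finite m).

Fixpoint leb (R : realType) (n : nat) : {sigma_finite_measure set 'rV[R]_n -> \bar R} :=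
  if n is n'.+1 then leb_succ (leb R n') else dirac (0 : 'rV[R]_0).


Definition enorm (R : realType) (m n : nat) (x : 'M[R]_(m, n)) : R :=
  Num.sqrt (\sum_i \sum_j x i j ^+ 2).

Definition edot (R : realType) (d : nat) (x y : 'rV[R]_d) : R :=
  \sum_i x 0 i * y 0 i.

Definition diam (R : realType) (d : nat) (A : set 'rV[R]_d) : R :=
  sup [set enorm (xy.1 - xy.2) | xy in A `*` A].

Definition bdry (R : realType) (d : nat) (A : set 'rV[R]_d) : set 'rV[R]_d :=
  closure A `\` interior A.

(* Near each boundary point, in suitable orthonormal coordinates with last axis
   [e], Omega is the part above the graph of a Lipschitz function of the other
   coordinates, i.e. of a Lipschitz function [g] that is constant along [e]. *)
Definition lipschitz_boundary (R : realType) (d : nat) (Omega : set 'rV[R]_d) : Prop :=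
  forall x, bdry Omega x ->
  exists (e : 'rV[R]_d) (g : 'rV[R]_d -> R) (L r : R),
    [/\ enorm e = 1,
        0 < r,
        (forall y t, g (y + t *: e) = g y),
        (forall y z, `|g y - g z| <= L * enorm (y - z)) &
        (forall y, enorm (y - x) < r -> (Omega y <-> g y < edot y e))].

Definition bounded_lipschitz_domain (R : realType) (d : nat) (Omega : set 'rV[R]_d) : Prop :=
  [/\ Omega !=set0, open Omega, connected Omega, bounded_set Omega &
      lipschitz_boundary Omega].

Definition partial (R : realType) (d : nat) (i : 'I_d) (f : 'rV[R]_d -> R) :
    'rV[R]_d -> R := fun x => 'D_(delta_mx 0 i) f x.

Definition test_function (R : realType) (d : nat) (Omega : set 'rV[R]_d)
    (f : 'rV[R]_d -> R) : Prop :=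
  [/\ (forall (s : seq 'I_d) x, differentiable (foldr (@partial R d) f s) x),
      compact (closure [set x | f x != 0]) &
      closure [set x | f x != 0] `<=` Omega].

(* [u] is an H^1-limit of test functions; [G] is its weak gradient. *)
Definition H10 (R : realType) (d : nat) (Omega : set 'rV[R]_d)
    (u : 'rV[R]_d -> R) : Prop :=
  measurable_fun Omega (u : 'rV[R]_d -> measurableTypeR R) /\
  exists (f : nat -> 'rV[R]_d -> R) (G : 'I_d -> 'rV[R]_d -> R),
    [/\ (forall n, test_function Omega (f n)),
        (forall i, measurable_fun Omega (G i : 'rV[R]_d -> measurableTypeR R)),
        (\int[leb R d]_(x in Omega) ((f n x - u x) ^+ 2)%:E @[n --> \oo] --> 0)%E &
        (forall i, (\int[leb R d]_(x in Omega)
          ((partial i (f n) x - G i x) ^+ 2)%:E @[n --> \oo] --> 0)%E)].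

Definition vcomp (R : realType) (d : nat) (v : 'rV[R]_d -> 'rV[R]_d) (i : 'I_d) :
    'rV[R]_d -> R := fun x => v x 0 i.

(* The forms a and b with the integrals taken over D.  They are only applied to
   finite element functions; these are differentiable on the open elements,
   whose complement in Omega is a null set, and there their weak gradient is
   the classical one. *)
Definition form_a (R : realType) (d : nat) (mu rho gamma : R) (D : set 'rV[R]_d)
    (u v : 'rV[R]_d -> 'rV[R]_d) : R :=
  \int[leb R d]_(x in D)
    (mu * (\sum_i \sum_j partial j (vcomp u i) x * partial j (vcomp v i) x)
     + gamma * rho * edot (u x) (v x)).

Definition form_b (R : realType) (d : nat) (D : set 'rV[R]_d)
    (v : 'rV[R]_d -> 'rV[R]_d) (q : 'rV[R]_d -> R) : R :=
  \int[leb R d]_(x in D) (q x * \sum_i partial i (vcomp v i) x).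

Definition cube (R : realType) (d : nat) : set 'rV[R]_d :=
  [set x | forall i, 0 < x 0 i < 1].
Arguments cube : clear implicits.

Definition ccube (R : realType) (d : nat) : set 'rV[R]_d :=
  [set x | forall i, 0 <= x 0 i <= 1].

Definition subcube (R : realType) (d : nat) (c : {ffun 'I_d -> bool}) : set 'rV[R]_d :=
  [set x | forall i, (c i)%:R / 2 < x 0 i < (c i)%:R / 2 + 1 / 2].
Arguments subcube R {d} c.

(* Closed faces of the reference cube, of any dimension: [Some b] fixes a
   coordinate to b, [None] leaves it free. *)
Definition face (R : realType) (d : nat) (c : {ffun 'I_d -> option bool}) : set 'rV[R]_d :=
  [set x | ccube x /\ forall i b, c i = Some b -> x 0 i = b%:R].
Arguments face R {d} c.

Definition facet (R : realType) (d : nat) (i : 'I_d) (b : bool) : set 'rV[R]_d :=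
  face R [ffun j => if j == i then Some b else None].
Arguments facet R {d} i b.

Definition Qpoly (R : realType) (d p : nat) (f : 'rV[R]_d -> R) : Prop :=
  exists c : {ffun 'I_d -> 'I_p.+1} -> R,
    forall x, f x = \sum_a c a * \prod_i x 0 i ^+ a i.

Record mesh (R : realType) (d : nat) := Mesh {
  ncell : nat;
  cell_map : 'I_ncell -> 'rV[R]_d -> 'rV[R]_d }.

Definition cell (R : realType) (d : nat) (Th : mesh R d) (t : 'I_(ncell Th)) :
    set 'rV[R]_d := cell_map t @` cube R d.

(* For d = 2, a bilinear map that is injective on the closed square with convex
   image has a convex quadrilateral as image of the open square; for d = 3,
   injectivity makes J invertible and the image a parallelepiped. *)
Definition admissible_map (R : realType) (d : nat) (T : 'rV[R]_d -> 'rV[R]_d) : Prop :=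
  [/\ set_inj (@ccube R d) T,
      (d = 2%N -> (forall i, Qpoly 1 (vcomp T i)) /\ convex_set (T @` cube R d : set (convex_lmodType 'rV[R]_d))) &
      (d = 3%N -> exists (J : 'M[R]_d) (b : 'rV[R]_d), forall x, T x = x *m J + b)].

Definition facet_on_bdry (R : realType) (d : nat) (Omega : set 'rV[R]_d)
    (T : 'rV[R]_d -> 'rV[R]_d) (ib : 'I_d * bool) : Prop :=
  T @` facet R ib.1 ib.2 `<=` bdry Omega.

Definition conforming_mesh (R : realType) (d : nat) (Omega : set 'rV[R]_d)
    (Th : mesh R d) : Prop :=
  [/\ (forall t : 'I_(ncell Th), admissible_map (cell_map t)),
      (forall t : 'I_(ncell Th), cell t `<=` Omega),
      closure Omega = \bigcup_(t : 'I_(ncell Th)) closure (cell t),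
      (forall t t' : 'I_(ncell Th), t != t' -> cell t `&` cell t' = set0) &
      (forall t t' : 'I_(ncell Th), t != t' ->
         closure (cell t) `&` closure (cell t') = set0 \/
         exists c c', closure (cell t) `&` closure (cell t') = cell_map t @` face R c
                   /\ closure (cell t) `&` closure (cell t') = cell_map t' @` face R c')].

Definition boundary_condition (R : realType) (d : nat) (Omega : set 'rV[R]_d)
    (Th : mesh R d) : Prop :=
  forall t : 'I_(ncell Th),
    (#|[set ib | `[< facet_on_bdry Omega (cell_map t) ib >]]%SET| <= d)%N /\
    forall i, ~ (facet_on_bdry Omega (cell_map t) (i, false) /\
                 facet_on_bdry Omega (cell_map t) (i, true)).

(* The elements are bisected in each reference direction; only the elements are
   prescribed as sets, not the numbering or orientation of the new maps. *)
Definition uniform_refinement (R : realType) (d : nat) (Th Th' : mesh R d) : Prop :=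
  (forall t' : 'I_(ncell Th'), exists (t : 'I_(ncell Th)) c,
     cell t' = cell_map t @` subcube R c) /\
  (forall (t : 'I_(ncell Th)) c, exists t' : 'I_(ncell Th'),
     cell t' = cell_map t @` subcube R c).

Definition shape_regular (R : realType) (d : nat) (Th : nat -> mesh R d) : Prop :=
  exists2 sigma : R, 0 < sigma &
    forall l (t : 'I_(ncell (Th l))) x, ccube x ->
      sigma * diam (cell t) ^+ d <= `|\det (jacobian (cell_map t) x)|.

Definition comparable_size (R : realType) (d : nat) (Th : nat -> mesh R d)
    (h : nat -> R) : Prop :=
  exists2 kappa : R, 0 < kappa &
    forall l (t : 'I_(ncell (Th l))),
      h l <= kappa * diam (cell t) /\ diam (cell t) <= kappa * h l.

Definition mesh_sequence (R : realType) (d : nat) (Omega : set 'rV[R]_d)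
    (Th : nat -> mesh R d) (h : nat -> R) : Prop :=
  [/\ (forall l, 0 < h l),
      (forall l, conforming_mesh Omega (Th l) /\ boundary_condition Omega (Th l)),
      (forall l, uniform_refinement (Th l) (Th l.+1)),
      shape_regular Th &
      comparable_size Th h].

(* One-dimensional nodes of degree p on [0, 1] (equidistant, Gauss-Lobatto,
   ...); the end points and the symmetry are what makes the tensor-product
   nodes of neighbouring elements match. *)
Definition nodes1D (R : realType) (p : nat) (s : 'I_p.+1 -> R) : Prop :=
  [/\ s ord0 = 0, s ord_max = 1, (forall i j : 'I_p.+1, (i < j)%N -> s i < s j) &
      (forall i : 'I_p.+1, s (rev_ord i) = 1 - s i)].

Definition lagrange_points (R : realType) (d p : nat) (s : 'I_p.+1 -> R)
    (Th : mesh R d) : set 'rV[R]_d :=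
  [set y | exists (t : 'I_(ncell Th)) (a : {ffun 'I_d -> 'I_p.+1}),
     y = cell_map t (\row_i s (a i))].

Definition piecewise_Q (R : realType) (d p : nat) (Th : mesh R d)
    (f : 'rV[R]_d -> R) : Prop :=
  forall t : 'I_(ncell Th), exists2 P : 'rV[R]_d -> R, Qpoly p P &
    forall x, cube R d x -> f (cell_map t x) = P x.

Definition V_space (R : realType) (d k : nat) (Omega : set 'rV[R]_d)
    (Th : mesh R d) (v : 'rV[R]_d -> 'rV[R]_d) : Prop :=
  forall i, H10 Omega (vcomp v i) /\ piecewise_Q k Th (vcomp v i).

Definition continuous_Q (R : realType) (d p : nat) (Omega : set 'rV[R]_d)
    (Th : mesh R d) (q : 'rV[R]_d -> R) : Prop :=
  {within closure Omega, continuous q} /\ piecewise_Q p Th q.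

Definition Q_space (R : realType) (d p : nat) (Omega : set 'rV[R]_d)
    (Th : mesh R d) (q : 'rV[R]_d -> R) : Prop :=
  continuous_Q p Omega Th q /\ \int[leb R d]_(x in Omega) q x = 0.

(* Nodal basis of V_l, one function per Lagrange point off the boundary and
   coordinate direction, by continuous representatives extended by zero. *)
Record velocity_basis (R : realType) (d k : nat) (s : 'I_k.+1 -> R)
    (Omega : set 'rV[R]_d) (Th : mesh R d) := VelocityBasis {
  vdim : nat;
  vnode : 'I_vdim -> 'rV[R]_d;
  vdir : 'I_vdim -> 'I_d;
  vfun : 'I_vdim -> 'rV[R]_d -> 'rV[R]_d;
  vnode_inj : injective (fun j => (vnode j, vdir j));
  vnode_range : forall y i, (exists j, vnode j = y /\ vdir j = i) <->
    (lagrange_points s Th y /\ ~ bdry Omega y);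
  vfun_V : forall j, V_space k Omega Th (vfun j);
  vfun_continuous : forall j, continuous (vfun j);
  vfun_out : forall j y, ~ Omega y -> vfun j y = 0;
  vfun_nodal : forall j y, lagrange_points s Th y ->
    vfun j y = if y == vnode j then delta_mx 0 (vdir j) else 0 }.

(* Nodal basis of the continuous piecewise polynomials of degree p in each
   coordinate, before imposing the zero mean value. *)
Record pressure_basis (R : realType) (d p : nat) (s : 'I_p.+1 -> R)
    (Omega : set 'rV[R]_d) (Th : mesh R d) := PressureBasis {
  pdim : nat;
  pnode : 'I_pdim -> 'rV[R]_d;
  pfun : 'I_pdim -> 'rV[R]_d -> R;
  pnode_inj : injective pnode;
  pnode_range : forall y, (exists i, pnode i = y) <-> lagrange_points s Th y;
  pfun_Q : forall i, continuous_Q p Omega Th (pfun i);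
  pfun_nodal : forall i y, lagrange_points s Th y ->
    pfun i y = (y == pnode i)%:R }.

(* The nodal functions do not have mean value zero; the elements of Q_l are
   the combinations whose nodal vector lies in a certain hyperplane of R^pdim.
   [zmx] identifies this hyperplane isometrically with R^zdim, zdim = dim Q_l:
   its columns are orthonormal and are the nodal vectors of a basis of Q_l.  A
   form with nodal matrix N has the matrix zmx^T N zmx on Q_l. *)
Record zero_mean_coords (R : realType) (d p : nat) (s : 'I_p.+1 -> R)
    (Omega : set 'rV[R]_d) (Th : mesh R d) (Pb : pressure_basis s Omega Th) :=
  ZeroMeanCoords {
  zdim : nat;
  zmx : 'M[R]_(pdim Pb, zdim);
  zmx_orthonormal : zmx^T *m zmx = 1%:M;
  zmx_Q : forall c,
    Q_space p Omega Th (fun x => \sum_i zmx i c * pfun i x);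
  zmx_span : forall q, Q_space p Omega Th q -> exists y : 'cV[R]_zdim,
    forall x, closure Omega x -> q x = \sum_i (zmx *m y) i 0 * pfun i x }.

Definition diagm (R : realType) (n : nat) (N : 'M[R]_n) : 'M[R]_n :=
  diag_mx (\row_i N i i).

Definition mat_a (R : realType) (d k : nat) (s : 'I_k.+1 -> R)
    (Omega : set 'rV[R]_d) (Th : mesh R d) (mu rho gamma : R)
    (Vb : velocity_basis s Omega Th) : 'M[R]_(vdim Vb) :=
  \matrix_(i, j) form_a mu rho gamma Omega (vfun j) (vfun i).

Definition mat_b (R : realType) (d k p : nat) (sv : 'I_k.+1 -> R) (sp : 'I_p.+1 -> R)
    (Omega : set 'rV[R]_d) (Th : mesh R d)
    (Vb : velocity_basis sv Omega Th) (Pb : pressure_basis sp Omega Th) :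
    'M[R]_(pdim Pb, vdim Vb) :=
  \matrix_(i, j) form_b Omega (vfun j) (pfun i).

Definition mass_p (R : realType) (d p : nat) (s : 'I_p.+1 -> R)
    (Omega : set 'rV[R]_d) (Th : mesh R d) (Pb : pressure_basis s Omega Th) :
    'M[R]_(pdim Pb) :=
  \matrix_(i, j) \int[leb R d]_(x in Omega) (pfun i x * pfun j x).

(* Degrees of freedom belonging to an element; the local nodal basis functions
   are the restrictions to the element of the corresponding global ones. *)
Definition vdof (R : realType) (d k : nat) (s : 'I_k.+1 -> R)
    (Omega : set 'rV[R]_d) (Th : mesh R d) (Vb : velocity_basis s Omega Th)
    (t : 'I_(ncell Th)) : {set 'I_(vdim Vb)} :=
  [set j | `[< closure (cell t) (vnode j) >]]%SET.

Definition pdof (R : realType) (d p : nat) (s : 'I_p.+1 -> R)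
    (Omega : set 'rV[R]_d) (Th : mesh R d) (Pb : pressure_basis s Omega Th)
    (t : 'I_(ncell Th)) : {set 'I_(pdim Pb)} :=
  [set i | `[< closure (cell t) (pnode i) >]]%SET.

Definition elt_a (R : realType) (d k : nat) (s : 'I_k.+1 -> R)
    (Omega : set 'rV[R]_d) (Th : mesh R d) (mu rho gamma : R)
    (Vb : velocity_basis s Omega Th) (t : 'I_(ncell Th)) : 'M[R]_#|vdof Vb t| :=
  \matrix_(i, j) form_a mu rho gamma (cell t) (vfun (enum_val j)) (vfun (enum_val i)).

Definition elt_b (R : realType) (d k p : nat) (sv : 'I_k.+1 -> R) (sp : 'I_p.+1 -> R)
    (Omega : set 'rV[R]_d) (Th : mesh R d)
    (Vb : velocity_basis sv Omega Th) (Pb : pressure_basis sp Omega Th)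
    (t : 'I_(ncell Th)) : 'M[R]_(#|pdof Pb t|, #|vdof Vb t|) :=
  \matrix_(i, j) form_b (cell t) (vfun (enum_val j)) (pfun (enum_val i)).

Definition elt_restr (R : realType) (d p : nat) (s : 'I_p.+1 -> R)
    (Omega : set 'rV[R]_d) (Th : mesh R d) (Pb : pressure_basis s Omega Th)
    (t : 'I_(ncell Th)) : 'M[R]_(#|pdof Pb t|, pdim Pb) :=
  \matrix_(i, j) (enum_val i == j)%:R.

Inductive schur_diag := SchurGlobal | SchurMass | SchurLocal.

Definition mat_D (R : realType) (d k p : nat) (sv : 'I_k.+1 -> R) (sp : 'I_p.+1 -> R)
    (Omega : set 'rV[R]_d) (Th : mesh R d) (mu rho gamma : R)
    (Vb : velocity_basis sv Omega Th) (Pb : pressure_basis sp Omega Th)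
    (D : schur_diag) : 'M[R]_(pdim Pb) :=
  match D with
  | SchurGlobal =>
      let A := mat_a mu rho gamma Vb in let B := mat_b Vb Pb in
      diagm (B *m invmx (diagm A) *m B^T)
  | SchurMass => diagm (mass_p Pb)
  | SchurLocal =>
      \sum_(t < ncell Th)
        let At := elt_a mu rho gamma Vb t in let Bt := elt_b Vb Pb t in
        (elt_restr Pb t)^T *m diagm (Bt *m invmx (diagm At) *m Bt^T) *m elt_restr Pb t
  end.

Fixpoint chebyshev_poly (R : realType) (n : nat) : {poly R} :=
  match n with
  | 0 => 1
  | n1.+1 => match n1 with
             | 0 => 'X
             | n2.+1 => 2 *: 'X * chebyshev_poly R n1 - chebyshev_poly R n2
             end
  end.

Definition cheb_T (R : realType) (alpha beta : R) (n : nat) : {poly R} :=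
  ((chebyshev_poly R n).[(beta + alpha) / (beta - alpha)])^-1 *:
    (chebyshev_poly R n \Po (((beta + alpha) / (beta - alpha))%:P - (2 / (beta - alpha)) *: 'X)).

Definition cheb_s (R : realType) (alpha beta : R) (j : nat) : {poly R} :=
  (1 - cheb_T alpha beta j.+1) %/ 'X.

(* [horner_mx] is restricted to matrices of positive size. *)
Definition poly_mx (R : realType) (n : nat) (P : {poly R}) (M : 'M[R]_n) : 'M[R]_n :=
  \sum_(i < size P) P`_i *: (M ^+ i).

Definition lambda_max (R : realType) (n : nat) (M : 'M[R]_n) : R :=
  sup [set a | eigenvalue M a].

Definition Cheb (R : realType) (n : nat) (M D : 'M[R]_n) (j : nat) : 'M[R]_n :=
  let beta := lambda_max (invmx D *m M) in
  let alpha := beta / 2 in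
  poly_mx (cheb_s alpha beta j) (invmx D *m M) *m invmx D.

Definition scaled_Cheb (R : realType) (n : nat) (M D : 'M[R]_n) (j : nat) : 'M[R]_n :=
  let c := (chebyshev_poly R j.+1).[3] in (c / (1 + c)) *: Cheb M D j.

Definition Ahat_inv (R : realType) (n : nat) (A : 'M[R]_n) (kA : nat) : 'M[R]_n :=
  scaled_Cheb A (diagm A) kA.

Definition Stilde (R : realType) (n r : nat) (A : 'M[R]_n) (B : 'M[R]_(r, n))
    (kA : nat) : 'M[R]_r := B *m Ahat_inv A kA *m B^T.

Definition Shat_inv (R : realType) (n r : nat) (A : 'M[R]_n) (B : 'M[R]_(r, n))
    (D : 'M[R]_r) (kA kS : nat) : 'M[R]_r :=
  scaled_Cheb (Stilde A B kA) D kS.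

Definition saddle (R : realType) (n r : nat) (A : 'M[R]_n) (B : 'M[R]_(r, n)) :
    'M[R]_(n + r) := block_mx A B^T B 0.

Definition saddle_hat (R : realType) (n r : nat) (A : 'M[R]_n) (B : 'M[R]_(r, n))
    (D : 'M[R]_r) (kA kS : nat) : 'M[R]_(n + r) :=
  block_mx (invmx (Ahat_inv A kA)) B^T
           B (B *m Ahat_inv A kA *m B^T - invmx (Shat_inv A B D kA kS)).

Definition uzawa_iter (R : realType) (n r : nat) (A : 'M[R]_n) (B : 'M[R]_(r, n))
    (D : 'M[R]_r) (kA kS : nat) : 'M[R]_(n + r) :=
  1%:M - invmx (saddle_hat A B D kA kS) *m saddle A B.

Definition X_norm (R : realType) (d n r : nat) (h : R) (x : 'cV[R]_(n + r)) : R :=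
  Num.sqrt (h ^+ (d - 2) * enorm (usubmx x) ^+ 2 + h ^+ d * enorm (dsubmx x) ^+ 2).

Definition Xdual_norm (R : realType) (d n r : nat) (h : R) (f : 'cV[R]_(n + r)) : R :=
  Num.sqrt (h ^- (d - 2) * enorm (usubmx f) ^+ 2 + h ^- d * enorm (dsubmx f) ^+ 2).

Definition X_opnorm (R : realType) (d n r : nat) (h : R) (M : 'M[R]_(n + r)) : R :=
  sup [set Xdual_norm d h (M *m x) | x in [set x : 'cV[R]_(n + r) | X_norm d h x <= 1]].

Definition eta0 (R : realType) (j : nat) : R := 'C(j, j.+1./2)%:R / 2 ^+ j.

(* ||K S^m|| in L(X_l, X_l^* ), all pressure matrices being restricted to Q_l. *)
Definition smoothing_norm (R : realType) (d k p : nat) (sv : 'I_k.+1 -> R)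
    (sp : 'I_p.+1 -> R) (Omega : set 'rV[R]_d) (Th : mesh R d) (mu rho gamma h : R)
    (Vb : velocity_basis sv Omega Th) (Pb : pressure_basis sp Omega Th)
    (Z : zero_mean_coords Pb) (D : schur_diag) (kA kS m : nat) : R :=
  let A := mat_a mu rho gamma Vb in
  let B := (zmx Z)^T *m mat_b Vb Pb in
  let Dt := (zmx Z)^T *m mat_D mu rho gamma Vb Pb D *m zmx Z in
  X_opnorm d h (saddle A B *m (uzawa_iter A B Dt kA kS) ^+ m).

(* Main.v *)
Require Import Defs.
From mathcomp Require Import all_boot all_order all_algebra.
From mathcomp Require Import perm complex.
From mathcomp Require Import all_classical all_reals all_analysis.
From mathcomp Require Import zify ring lra.
From mathcomp Require Import measurable_realfun.
Set Implicit Arguments.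
Unset Strict Implicit.
Unset Printing Implicit Defensive.
Import Order.TTheory GRing.Theory Num.Theory.
Local Open Scope ring_scope.

(* Put N = Khat - K = diag(Ahat - A, B Ahat^-1 B^T - Shat) and E = diag(1, -1).  Then
   K S^m = N (1 - S) S^(m-1), and P = 2 S - 1 is nonexpansive for the seminorm of the positive
   semidefinite matrix E N, because 2 E N <= E Khat + Khat E.  Expanding
   (1 - S) S^j = 2^(-j-1) (1 - P) (1 + P)^j and summing by parts gives the factor eta0(m - 1), so
   only Ahat <= C h^(d-2) and Shat <= C h^d are needed: no inf-sup condition enters, just B <> 0.

   The Chebyshev scaling reduces these bounds to A <= C diag A, B (diag A)^-1 B^T <= C D and to
   the size of the diagonals.  They follow element by element from the boundedness of the number of
   degrees of freedom per element and of the number of elements meeting at a point (disjoint elements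
   contain balls of radius c h), and from b_t(i, j)^2 <= (d / mu) a_t(j, j) m_t(i, i).

   D is positive since each pressure basis function q has a nonzero b-product with some velocity
   basis function supported in one element: for xi a product of the x_m or 1 - x_m, vanishing on the
   facets where q does not, and a suitable direction w,
   2 int q D_w (q xi) = int D_w (q^2 xi) + int q^2 D_w xi = int q^2 D_w xi > 0. *)

(** * Quadratic forms and nonexpansive operators *)

(** The restriction to zero-mean pressures replaces the diagonal matrix D by Z^T D Z, which is no
    longer diagonal. The Chebyshev bounds are therefore proved for any symmetric positive definite D
    by simultaneous diagonalization, and the bounds on D pass to Z^T D Z because Z is an isometry. B
    stays nonzero on the zero-mean pressures because velocity functions supported in one element
    have divergence of mean zero, so that subtracting a constant from q does not change b.

    The geometric obstacle is that the element maps may be bilinear and that the integrands are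
    controlled on open elements only. The inverse Lipschitz bound, the chain rule and the nullity of
    element boundaries all come from exact secant identities T x - T y = (x - y) J(x, y); in the
    bilinear case convexity of the image makes it open. No change of variables occurs: volumes are
    compared with balls, and integrals of derivatives are evaluated by translation invariance. What
    holds almost everywhere on an element returns to the reference cube because images of open sets
    contain balls. *)

Section UnimodalAbel.
Variables (R : realDomainType) (a f : nat -> R) (K : R).
Hypothesis fK : forall i, `|f i| <= K.

(** Summation by parts turns the left side into [a 0 * f 0] plus the sum of
    [(a i.+1 - a i) * f i.+1]; these weights are nonnegative and add up to [a m]. *)
Lemma abel_increasing m :
  (forall i, (i < m)%N -> a i <= a i.+1) -> 0 <= a 0%N ->
  `|\sum_(0 <= i < m) a i * (f i - f i.+1) + a m * f m| <= a m * K.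
Proof.
move=> am a0; elim: m am => [_|m IH am].
  by rewrite big_nil add0r normrM (ger0_norm a0) ler_wpM2l.
have {}IH := IH (fun i im => am i (ltnW im)).
rewrite big_nat_recr //=.
have -> : \sum_(0 <= i < m) a i * (f i - f i.+1) + a m * (f m - f m.+1) + a m.+1 * f m.+1 =
  (\sum_(0 <= i < m) a i * (f i - f i.+1) + a m * f m) + (a m.+1 - a m) * f m.+1 by ring.
have -> : a m.+1 * K = a m * K + (a m.+1 - a m) * K by ring.
apply: (le_trans (ler_normD _ _)); apply: lerD => //.
by rewrite normrM ger0_norm ?subr_ge0 ?am// ler_wpM2l ?subr_ge0 ?am.
Qed.

Lemma abel_decreasing m n :
  (forall i, (m <= i)%N -> a i.+1 <= a i) ->
  `|\sum_(m <= i < m + n) a i * (f i - f i.+1) - a m * f m + a (m + n)%N * f (m + n)%N|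
    <= (a m - a (m + n)%N) * K.
Proof.
move=> am; elim: n => [|n IH].
  by rewrite addn0 big_geq// add0r addNr subrr mul0r normr0.
rewrite addnS big_nat_recr ?leq_addr//=.
set S := \sum_(_ <= i < _) _ in IH *.
have -> : S + a (m + n)%N * (f (m + n)%N - f (m + n).+1) - a m * f m
    + a (m + n).+1 * f (m + n).+1 =
  (S - a m * f m + a (m + n)%N * f (m + n)%N) - (a (m + n)%N - a (m + n).+1) * f (m + n).+1.
  by ring.
have -> : (a m - a (m + n).+1) * K = (a m - a (m + n)%N) * K + (a (m + n)%N - a (m + n).+1) * K.
  by ring.
apply: (le_trans (ler_normB _ _)); apply: lerD => //.
have h : 0 <= a (m + n)%N - a (m + n).+1 by rewrite subr_ge0 am ?leq_addr.
by rewrite normrM ger0_norm// ler_wpM2l.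
Qed.

End UnimodalAbel.

Lemma bin_half_increasing n i : (i < n./2)%N -> ('C(n, i) <= 'C(n, i.+1))%N.
Proof.
move=> lin; rewrite -(leq_pmul2l (ltn0Sn i)) mul_bin_left leq_mul2r; apply/orP; right.
by have := odd_double_half n; rewrite -addnn => <-; rewrite leq_subRL -?addnA; lia.
Qed.

Lemma bin_half_decreasing n i : (n./2 <= i)%N -> ('C(n, i.+1) <= 'C(n, i))%N.
Proof.
move=> lin; rewrite -(leq_pmul2l (ltn0Sn i)) mul_bin_left leq_mul2r; apply/orP; right.
by have := odd_double_half n; case: (odd n) => /=; lia.
Qed.

(** Symmetry of the binomial coefficients matches the index in [eta0] with the index at which the
    row is cut below. *)
Lemma eta_bin_half n : 'C(n, n.+1./2) = 'C(n, n./2).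
Proof.
have h : (n.+1./2 <= n)%N by have := odd_double_half n.+1; lia.
rewrite -(bin_sub h); congr ('C(n, _)).
have := odd_double_half n.+1; have := odd_double_half n; rewrite /=; case: (odd n) => /=; lia.
Qed.

(** The row of binomial coefficients is cut at its peak [n./2]: the boundary terms of the two
    monotone halves cancel, the coefficient of index [n.+1] is 0, and each half costs the peak value
    times K. *)
Lemma abel_binomial (R : realDomainType) (f : nat -> R) (K : R) n :
  (forall i, `|f i| <= K) ->
  `|\sum_(0 <= i < n.+1) 'C(n, i)%:R * (f i - f i.+1)| <= 2 * 'C(n, n./2)%:R * K.
Proof.
move=> fK; set m := n./2; set a : nat -> R := fun i => 'C(n, i)%:R.
have mn : (m <= n.+1)%N by rewrite /m; have := odd_double_half n; lia.
rewrite (big_cat_nat _ mn)//=.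
have h1 := @abel_increasing R a f K fK m.
have h2 := @abel_decreasing R a f K fK m (n.+1 - m).
rewrite subnKC// in h2.
have {}h1 : `|\sum_(0 <= i < m) a i * (f i - f i.+1) + a m * f m| <= a m * K.
  by apply: h1; rewrite ?ler0n// => i im; rewrite ler_nat bin_half_increasing.
have {h2} : `|\sum_(m <= i < n.+1) a i * (f i - f i.+1) - a m * f m + a n.+1 * f n.+1|
    <= (a m - a n.+1) * K.
  by apply: h2 => i im; rewrite ler_nat bin_half_decreasing.
have -> : a n.+1 = 0 by rewrite /a bin_small.
rewrite mul0r addr0 subr0 => h2.
set S1 := \sum_(0 <= i < m) _ in h1 *; set S2 := \sum_(m <= i < n.+1) _ in h2 *.
have -> : S1 + S2 = (S1 + a m * f m) + (S2 - a m * f m) by ring.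
have -> : 2 * a m * K = a m * K + a m * K by ring.
exact: (le_trans (ler_normD _ _) (lerD h1 h2)).
Qed.

Section Forms.
Variable R : realFieldType.

Definition qf n (M : 'M[R]_n) (x y : 'cV[R]_n) : R := (x^T *m M *m y) 0 0.
(** Symmetry is not part of [psd] and [pd]; it is assumed separately where it is used. [lef] is the
    Loewner order. *)
Definition psd n (M : 'M[R]_n) := forall x, 0 <= qf M x x.
Definition lef n (M N : 'M[R]_n) := forall x, qf M x x <= qf N x x.
Definition pd n (M : 'M[R]_n) := forall x, x != 0 -> 0 < qf M x x.

Lemma qfDl n (M : 'M[R]_n) x y z : qf M (x + y) z = qf M x z + qf M y z.
Proof. by rewrite /qf linearD /= !mulmxDl mxE. Qed.
Lemma qfDr n (M : 'M[R]_n) x y z : qf M z (x + y) = qf M z x + qf M z y.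
Proof. by rewrite /qf mulmxDr mxE. Qed.
Lemma qfZl n (M : 'M[R]_n) a x z : qf M (a *: x) z = a * qf M x z.
Proof. by rewrite /qf linearZ /= -!scalemxAl mxE. Qed.
Lemma qfZr n (M : 'M[R]_n) a x z : qf M z (a *: x) = a * qf M z x.
Proof. by rewrite /qf -!scalemxAr mxE. Qed.
Lemma qfNr n (M : 'M[R]_n) x z : qf M z (- x) = - qf M z x.
Proof. by rewrite -scaleN1r qfZr mulN1r. Qed.
Lemma qfNl n (M : 'M[R]_n) x z : qf M (- x) z = - qf M x z.
Proof. by rewrite -scaleN1r qfZl mulN1r. Qed.
Lemma qfBr n (M : 'M[R]_n) x y z : qf M z (x - y) = qf M z x - qf M z y.
Proof. by rewrite qfDr qfNr. Qed.
Lemma qf0r n (M : 'M[R]_n) z : qf M z 0 = 0.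
Proof. by rewrite /qf mulmx0 mxE. Qed.
Lemma qfZ n a (M : 'M[R]_n) x y : qf (a *: M) x y = a * qf M x y.
Proof. by rewrite /qf -scalemxAr -scalemxAl mxE. Qed.
Lemma qfD n (M N : 'M[R]_n) x y : qf (M + N) x y = qf M x y + qf N x y.
Proof. by rewrite /qf mulmxDr mulmxDl mxE. Qed.
Lemma qfB n (M N : 'M[R]_n) x y : qf (M - N) x y = qf M x y - qf N x y.
Proof. by rewrite /qf mulmxBr mulmxBl !mxE. Qed.
Lemma qf_sum n I r (P : pred I) (M : I -> 'M[R]_n) x y :
  qf (\sum_(i <- r | P i) M i) x y = \sum_(i <- r | P i) qf (M i) x y.
Proof. by rewrite /qf mulmx_sumr mulmx_suml summxE. Qed.
Lemma qf_sumr n I r (P : pred I) (M : 'M[R]_n) x (y : I -> 'cV[R]_n) :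
  qf M x (\sum_(i <- r | P i) y i) = \sum_(i <- r | P i) qf M x (y i).
Proof. by rewrite /qf mulmx_sumr summxE. Qed.
Lemma qf_congr n m (M : 'M[R]_n) (P : 'M[R]_(n, m)) x y :
  qf (P^T *m M *m P) x y = qf M (P *m x) (P *m y).
Proof. by rewrite /qf trmx_mul !mulmxA. Qed.
Lemma qf_tr n (M : 'M[R]_n) x y : qf M^T x y = qf M y x.
Proof.
rewrite /qf; transitivity ((y^T *m M *m x)^T 0 0); last by rewrite mxE.
by rewrite !trmx_mul trmxK mulmxA.
Qed.
Lemma qf_sym n (M : 'M[R]_n) x y : M^T = M -> qf M x y = qf M y x.
Proof. by move=> MT; rewrite -{1}MT qf_tr. Qed.
Lemma qf1E n (x y : 'cV[R]_n) : qf 1%:M x y = \sum_i x i 0 * y i 0.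
Proof. by rewrite /qf mulmx1 !mxE; apply: eq_bigr => i _; rewrite mxE. Qed.
Lemma qf1_ge0 n : psd (1%:M : 'M[R]_n).
Proof. by move=> x; rewrite qf1E sumr_ge0// => i _; rewrite -expr2 sqr_ge0. Qed.
Lemma qf_diag n (d : 'rV[R]_n) x y : qf (diag_mx d) x y = \sum_i d 0 i * x i 0 * y i 0.
Proof.
rewrite /qf !mxE; apply: eq_bigr => j _; rewrite mul_mx_diag !mxE; ring.
Qed.
Lemma qfE n (M : 'M[R]_n) x y : qf M x y = \sum_i \sum_j x i 0 * M i j * y j 0.
Proof.
rewrite /qf !mxE exchange_big /=; apply: eq_bigr => j _; rewrite !mxE mulr_suml.
by apply: eq_bigr => i _; rewrite mxE.
Qed.

(* The discriminant of t |-> qf M (t x + y) (t x + y) is nonpositive. *)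
Lemma qf_CS n (M : 'M[R]_n) x y : M^T = M -> psd M ->
  qf M x y ^+ 2 <= qf M x x * qf M y y.
Proof.
move=> MT Mp.
have H t : 0 <= t ^+ 2 * qf M x x + 2 * t * qf M x y + qf M y y.
  have := Mp (t *: x + y); rewrite qfDl !qfDr !qfZl !qfZr (qf_sym y x MT).
  by congr (0 <= _); ring.
have [q0|qn0] := eqVneq (qf M x x) 0.
  rewrite q0 mul0r; apply/eqP/negPn/negP => /negPf h.
  have h0 : qf M x y != 0 by apply/eqP => h0; move: h; rewrite h0 expr0n/= lexx.
  have := H (- (qf M y y + 1) / (2 * qf M x y)); rewrite q0 mulr0 add0r.
  have -> : 2 * (- (qf M y y + 1) / (2 * qf M x y)) * qf M x y = - (qf M y y + 1).
    by field.
  by lra.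
have qp : 0 < qf M x x by rewrite lt_def qn0 Mp.
have := H (- qf M x y / qf M x x).
have -> : (- qf M x y / qf M x x) ^+ 2 * qf M x x + 2 * (- qf M x y / qf M x x) * qf M x y +
  qf M y y = (qf M x x * qf M y y - qf M x y ^+ 2) / qf M x x by field.
by rewrite pmulr_lge0 ?invr_gt0// subr_ge0.
Qed.
End Forms.

Section Smoothing.
Variable R : rcfType.

Lemma qf_CS_sqrt n (M : 'M[R]_n) x y : M^T = M -> psd M ->
  `|qf M x y| <= Num.sqrt (qf M x x) * Num.sqrt (qf M y y).
Proof.
move=> MT Mp; rewrite -sqrtrM// -sqrtr_sqr; exact/ler_wsqrtr/qf_CS.
Qed.

(** The numbers [f i], the values of the form G at y and P^i x, are bounded by Cauchy-Schwarz, since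
    all powers of P are nonexpansive; the binomial expansion makes the left side a weighted sum of
    differences of the [f i]. G may be singular, so the bound is stated for the bilinear form. *)
Lemma nonexpansive_smoothing n (G P : 'M[R]_n) (x y : 'cV[R]_n) j :
  G^T = G -> psd G -> (forall z, qf G (P *m z) (P *m z) <= qf G z z) ->
  `|qf G y ((1 - P) *m (1 + P) ^+ j *m x)|
    <= 2 * 'C(j, j./2)%:R * (Num.sqrt (qf G y y) * Num.sqrt (qf G x x)).
Proof.
move=> GT Gp PG.
have PGi i z : qf G (P ^+ i *m z) (P ^+ i *m z) <= qf G z z.
  elim: i => [|i IH]; first by rewrite expr0 -[1]/(1%:M) mul1mx.
  by rewrite exprS -mulmxA; exact: le_trans (PG _) IH.
set K := Num.sqrt _ * _; pose f i := qf G y (P ^+ i *m x).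
have fK i : `|f i| <= K.
  apply: (le_trans (qf_CS_sqrt _ _ GT Gp)); apply: ler_wpM2l; first exact: sqrtr_ge0.
  exact: ler_wsqrtr.
suff -> : qf G y ((1 - P) *m (1 + P) ^+ j *m x) =
    \sum_(0 <= i < j.+1) 'C(j, i)%:R * (f i - f i.+1) by exact: abel_binomial.
rewrite (exprDn_comm _ (commr_sym (commr1 P))) -[(1 - P) *m _]/((1 - P) * _) mulr_sumr mulmx_suml.
rewrite qf_sumr big_mkord; apply: eq_bigr => i _.
rewrite expr1n mul1r mulrnAr -scaler_nat -scalemxAl qfZr; congr (_ * _).
by rewrite mulrBl mul1r -exprS mulmxBl qfBr.
Qed.
End Smoothing.

(** * Simultaneous diagonalization *)

Lemma pd_unitmx (R : realFieldType) n (D : 'M[R]_n) : pd D -> D \in unitmx.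
Proof.
move=> Dp; rewrite -row_free_unit -kermx_eq0; apply/eqP/row_matrixP => i.
rewrite row0; apply/eqP/negPn/negP => h.
have /sub_kermxP h0 := row_sub i (kermx D).
have ht : (row i (kermx D))^T != 0 by rewrite -(inj_eq trmx_inj) trmxK trmx0.
by have := Dp _ ht; rewrite /qf trmxK h0 mul0mx mxE ltxx.
Qed.

Section SimultaneousDiagonalization.
Variable R : rcfType.
Local Open Scope complex_scope.

Lemma Re_sum I (r : seq I) (P : pred I) (F : I -> R[i]) :
  complex.Re (\sum_(i <- r | P i) F i) = \sum_(i <- r | P i) complex.Re (F i).
Proof. by apply: big_morph => // -[a b] [c d]. Qed.

Lemma Im_sum I (r : seq I) (P : pred I) (F : I -> R[i]) :
  complex.Im (\sum_(i <- r | P i) F i) = \sum_(i <- r | P i) complex.Im (F i).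
Proof. by apply: big_morph => // -[a b] [c d]. Qed.

Lemma mulmx_map_complex m n p (u : 'M[R[i]]_(m, n)) (N : 'M[R]_(n, p)) :
  map_mx (@complex.Re R) (u *m map_mx (real_complex R) N) = map_mx (@complex.Re R) u *m N /\
  map_mx (@complex.Im R) (u *m map_mx (real_complex R) N) = map_mx (@complex.Im R) u *m N.
Proof.
split; apply/matrixP => i j; rewrite !mxE ?Re_sum ?Im_sum; apply: eq_bigr => k _; rewrite !mxE.
  by case: (u i k) => a b /=; rewrite mulr0 subr0.
by case: (u i k) => a b /=; rewrite mulr0 add0r.
Qed.

(** M D^-1 has a left eigenvector a + ib over the complex extension, with eigenvalue z. Comparing a
    M b^T with b M a^T gives Im z (a D a^T + b D b^T) = 0, so z is real and one of a, b is a real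
    eigenvector. *)
Lemma real_generalized_eigenvector n (D M : 'M[R]_n) : (0 < n)%N ->
  D^T = D -> pd D -> M^T = M ->
  exists (l : R) (v : 'rV[R]_n), v != 0 /\ v *m M = l *: (v *m D).
Proof.
move=> n0 DT Dp MT; have uD := pd_unitmx Dp.
pose g := map_mx (real_complex R) (M *m invmx D).
have [z] : exists z, root (char_poly g) z.
  by apply: closed_rootP; rewrite size_char_poly; case: (n) n0.
rewrite -eigenvalue_root_char => /eigenvalueP[u0 u0g u0n0].
have uM : u0 *m map_mx (real_complex R) M = z *: (u0 *m map_mx (real_complex R) D).
  by rewrite -{1}(mulmxKV uD M) map_mxM mulmxA u0g -scalemxAl.
set a := map_mx (@complex.Re R) u0; set b := map_mx (@complex.Im R) u0.
have [ReM ImM] := mulmx_map_complex u0 M; have [ReD ImD] := mulmx_map_complex u0 D.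
have eqa : a *m M = complex.Re z *: (a *m D) - complex.Im z *: (b *m D).
  rewrite /a /b -ReM uM -ReD -ImD; apply/matrixP => i j; rewrite !mxE.
  by case: (z) => x y; case: (\sum_j0 _).
have eqb : b *m M = complex.Re z *: (b *m D) + complex.Im z *: (a *m D).
  rewrite /a /b -ImM uM -ReD -ImD; apply/matrixP => i j; rewrite !mxE.
  by case: (z) => x y; case: (\sum_j0 _).
have sM (N : 'M[R]_n) : N^T = N -> (a *m N *m b^T) 0 0 = (b *m N *m a^T) 0 0.
  by move=> NT; have := @qf_sym _ _ N a^T b^T NT; rewrite /qf !trmxK.
pose f (x y : 'rV[R]_n) : R := (x *m y^T) 0 0.
have fD x y t : f (x + y) t = f x t + f y t by rewrite /f mulmxDl mxE.
have fZ k x t : f (k *: x) t = k * f x t by rewrite /f -scalemxAl mxE.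
have := sM _ MT; rewrite -/(f _ _) -/(f _ _) eqa eqb -scaleN1r !fD !fZ.
rewrite {1}/f (sM _ DT) -/(f _ _).
have fE (x : 'rV[R]_n) : f (x *m D) x = qf D x^T x^T by rewrite /f /qf trmxK.
rewrite !fE => /eqP h.
have Dn (x : 'rV[R]_n) : 0 <= qf D x^T x^T.
  have [->|xn0] := eqVneq x 0; first by rewrite trmx0 qf0r.
  by rewrite ltW// Dp// -(inj_eq trmx_inj) trmxK trmx0.
have [a0|an0] := eqVneq a 0; last first.
  exists (complex.Re z), a; split => //.
  have : complex.Im z * (qf D a^T a^T + qf D b^T b^T) == 0.
    by move: h; rewrite -subr_eq0 => /eqP h; apply/eqP; lra.
  rewrite mulf_eq0 => /orP[/eqP z0|/eqP q0]; first by rewrite eqa z0 scale0r subr0.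
  have : 0 < qf D a^T a^T by rewrite Dp// -(inj_eq trmx_inj) trmxK trmx0.
  by move=> aD; move: (ltr_pwDl aD (Dn b)); rewrite q0 ltxx.
have bn0 : b != 0.
  apply: contraNneq u0n0 => b0; apply/eqP/matrixP => i j; rewrite mxE.
  move/matrixP/(_ i j): a0; move/matrixP/(_ i j): b0; rewrite !mxE.
  by case: (u0 i j) => x y /= -> ->.
by exists (complex.Re z), b; split => //; rewrite eqb a0 mul0mx scaler0 addr0.
Qed.

Lemma row_free_annihilator n (w : 'cV[R]_n.+1) : w != 0 ->
  exists Y : 'M[R]_(n, n.+1), row_free Y /\ Y *m w = 0.
Proof.
move=> w0; have rk : \rank (kermx w) = n.
  by rewrite mxrank_ker -mxrank_tr rank_rV -(inj_eq trmx_inj) trmxK trmx0 w0 subn1.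
have : row_free (row_base (kermx w)) /\ row_base (kermx w) *m w = 0.
  split; first exact: row_base_free.
  by apply/sub_kermxP; rewrite eq_row_base.
by move: (row_base _); rewrite rk => Y HY; exists Y.
Qed.

Lemma pd_row_free n m (D : 'M[R]_n) (Y : 'M[R]_(m, n)) :
  pd D -> row_free Y -> pd (Y *m D *m Y^T).
Proof.
move=> Dp Yf x x0; rewrite -{1}(trmxK Y) qf_congr Dp//.
apply: contraNneq x0 => /(congr1 trmx); rewrite trmx_mul trmxK trmx0 => h.
rewrite -(inj_eq trmx_inj) trmx0 -[_ == 0](mulmx_free_eq0 _ Yf) h eqxx //.
Qed.

Lemma col_mx_congr m1 m2 n (A : 'M[R]_(m1, n)) (B : 'M[R]_(m2, n)) (N : 'M[R]_n) :
  col_mx A B *m N *m (col_mx A B)^T =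
  block_mx (A *m N *m A^T) (A *m N *m B^T) (B *m N *m A^T) (B *m N *m B^T).
Proof. by rewrite tr_col_mx mul_col_mx mul_col_row. Qed.

(** Deflation: the rows of Y span the D-orthogonal complement of an eigenvector v, and M v^T is
    proportional to D v^T, so both forms split into v and Y. The vector v is scaled to D-length 1,
    and induction applies to the compressions to Y. *)
Theorem simultaneous_diagonalization n (D M : 'M[R]_n) :
  D^T = D -> pd D -> M^T = M ->
  exists (W : 'M[R]_n) (l : 'rV[R]_n),
    W^T *m D *m W = 1%:M /\ W^T *m M *m W = diag_mx l.
Proof.
suff : D^T = D -> pd D -> M^T = M ->
  exists (W : 'M[R]_n) (l : 'rV[R]_n), W *m D *m W^T = 1%:M /\ W *m M *m W^T = diag_mx l.
  move=> H DT Dp MT; have [W [l [h1 h2]]] := H DT Dp MT.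
  by exists W^T, l; rewrite trmxK.
elim: n D M => [D M _ _ _|n IH D M DT Dp MT].
  by exists 0, 0; split; apply/matrixP => -[].
have [l [v [v0 vM]]] := real_generalized_eigenvector (ltn0Sn n) DT Dp MT.
have vtn0 : v^T != 0 by rewrite -(inj_eq trmx_inj) trmxK trmx0.
have q0 : 0 < qf D v^T v^T by exact: Dp.
have wn0 : D *m v^T != 0.
  by apply: contraTneq q0 => h; rewrite /qf -mulmxA h mulmx0 mxE ltxx.
have [Y [Yf Yw]] := row_free_annihilator wn0.
have YM : Y *m M *m v^T = 0.
  have -> : Y *m M *m v^T = Y *m (v *m M)^T by rewrite trmx_mul MT mulmxA.
  by rewrite vM linearZ /= trmx_mul DT -scalemxAr Yw scaler0.
have D2T : (Y *m D *m Y^T)^T = Y *m D *m Y^T by rewrite !trmx_mul trmxK DT mulmxA.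
have M2T : (Y *m M *m Y^T)^T = Y *m M *m Y^T by rewrite !trmx_mul trmxK MT mulmxA.
have [W [k [W1 W2]]] := IH _ _ D2T (pd_row_free Dp Yf) M2T.
set q := qf D v^T v^T in q0; pose s : R := (Num.sqrt q)^-1.
have ss : s * s * q = 1.
  by rewrite /s -invfM -expr2 sqr_sqrtr ?ltW// mulVf// gt_eqF.
have vDv : v *m D *m v^T = q%:M.
  by rewrite [LHS]mx11_scalar /q /qf trmxK.
have blk (N : 'M[R]_(1 + n)) : N^T = N ->
   (Y *m N *m v^T = 0) -> (v *m N *m Y^T = 0).
  by move=> NT h; apply: trmx_inj; rewrite trmx0 -h !trmx_mul trmxK NT mulmxA.
exists (col_mx (s *: v) (W *m Y) : 'M[R]_(1 + n)), (row_mx (l%:M) k : 'rV_(1 + n)).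
split.
  refine (etrans (@col_mx_congr 1 n n.+1 (s *: v) (W *m Y) _) _).
  apply/esym; apply: etrans (@scalar_mx_block R 1 n 1) _; apply/esym; congr block_mx.
  - by rewrite linearZ /= -scalemxAr -!scalemxAl scalerA vDv scale_scalar_mx ss.
  - by rewrite trmx_mul -!scalemxAl !mulmxA blk ?mul0mx ?scaler0// -mulmxA.
  - by rewrite linearZ /= -scalemxAr -!mulmxA Yw !mulmx0 scaler0.
  - by rewrite trmx_mul -W1 !mulmxA.
refine (etrans (@col_mx_congr 1 n n.+1 (s *: v) (W *m Y) _) _).
apply/esym; apply: etrans (diag_mx_row _ _) _; apply/esym; congr block_mx.
- rewrite linearZ /= -scalemxAr -!scalemxAl scalerA vM -scalemxAl vDv.
  rewrite !scale_scalar_mx; apply/matrixP => i j; rewrite !ord1 !mxE !eqxx !mulr1n.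
  by rewrite mulrCA ss mulr1.
- by rewrite trmx_mul -!scalemxAl !mulmxA blk ?mul0mx ?scaler0.
- by rewrite linearZ /= -scalemxAr -!mulmxA (mulmxA Y) YM !mulmx0 scaler0.
- by rewrite trmx_mul -W2 !mulmxA.
Qed.
End SimultaneousDiagonalization.

(** * Chebyshev polynomials *)

Section Chebyshev.
Variable R : realType.

(** The index is shifted by one: [chebyshev_U n] is the Chebyshev polynomial of the second kind of
    degree n - 1, so that C_n + U_n sqrt(X^2 - 1) = (X + sqrt(X^2 - 1))^n. *)
Fixpoint chebyshev_U (n : nat) : {poly R} :=
  if n is n'.+1 then 'X * chebyshev_U n' + chebyshev_poly R n' else 0.

Notation C := (chebyshev_poly R).
Notation U := chebyshev_U.

(** A first-order recurrence for the pair, with coefficients nonnegative on [1, oo). The three-term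
    recurrence defining [chebyshev_poly] has a negative coefficient and does not carry inequalities
    through an induction. *)
Lemma chebyshev_pair n :
  C n.+1 = 'X * C n + ('X ^+ 2 - 1) * U n /\ U n.+1 = 'X * U n + C n.
Proof.
split=> //; elim: n => [|n IH]; first by rewrite /= mulr0 addr0 mulr1.
have -> : C n.+2 = 2 *: 'X * C n.+1 - C n by [].
have -> : U n.+1 = 'X * U n + C n by [].
rewrite IH -!mul_polyC; ring.
Qed.

Lemma chebyshev_horner n z :
  (C n.+1).[z] = z * (C n).[z] + (z ^+ 2 - 1) * (U n).[z] /\
  (U n.+1).[z] = z * (U n).[z] + (C n).[z].
Proof.
have [-> ->] := chebyshev_pair n.
by rewrite !hornerE.
Qed.

(** The Pell equation, i.e. the norm of (X + sqrt(X^2 - 1))^n; it replaces the cosine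
    parametrization in bounding C_n on [-1, 1]. *)
Lemma chebyshev_pell n z :
  (C n).[z] ^+ 2 + (1 - z ^+ 2) * (U n).[z] ^+ 2 = 1.
Proof.
elim: n => [|n IH]; first by rewrite /= !hornerE /=; ring.
have [-> ->] := chebyshev_horner n z; rewrite -[RHS]IH; ring.
Qed.

Lemma chebyshev_le1 n z : -1 <= z <= 1 -> -1 <= (C n).[z] <= 1.
Proof.
move=> /andP[z1 z2]; have z3 : 0 <= 1 - z ^+ 2 by nra.
have := chebyshev_pell n z; have := mulr_ge0 z3 (sqr_ge0 (U n).[z]).
by move=> h1 h2; apply/andP; split; nra.
Qed.

Lemma chebyshev_monotone n z y : 1 <= z -> z <= y ->
  [/\ 1 <= (C n).[z], 0 <= (U n).[z], (C n).[z] <= (C n).[y] & (U n).[z] <= (U n).[y]].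
Proof.
move=> z1 zy; elim: n => [|n [c1 u0 cc uu]]; first by rewrite /= !hornerE.
have [-> ->] := chebyshev_horner n z; have [-> ->] := chebyshev_horner n y.
have z2 : 0 <= z ^+ 2 - 1 by nra.
have y2 : z ^+ 2 - 1 <= y ^+ 2 - 1 by nra.
split.
- by have := mulr_ge0 z2 u0; nra.
- nra.
- have : (z ^+ 2 - 1) * (U n).[z] <= (y ^+ 2 - 1) * (U n).[y] by apply: ler_pM.
  have : z * (C n).[z] <= y * (C n).[y] by apply: ler_pM => //; lra.
  lra.
- have : z * (U n).[z] <= y * (U n).[y] by apply: ler_pM => //; lra.
  lra.
Qed.

Lemma chebyshev_growth n z y : 1 <= z -> z <= y -> y - z <= (C n.+1).[y] - (C n.+1).[z].
Proof.
move=> z1 zy; have [c1 u0 cc uu] := chebyshev_monotone n z1 zy.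
have [-> _] := chebyshev_horner n z; have [-> _] := chebyshev_horner n y.
have z2 : 0 <= z ^+ 2 - 1 by nra.
have y2 : z ^+ 2 - 1 <= y ^+ 2 - 1 by nra.
have : (z ^+ 2 - 1) * (U n).[z] <= (y ^+ 2 - 1) * (U n).[y] by apply: ler_pM.
nra.
Qed.

(** The infinitesimal form of [chebyshev_growth]; it bounds the divided difference at the point 3
    itself. *)
Lemma chebyshev_deriv_ge n z : 1 <= z ->
  [/\ 1 <= ((C n.+1)^`()).[z], 0 <= ((C n)^`()).[z] & 0 <= ((U n)^`()).[z]].
Proof.
move=> z1.
have main m : 0 <= ((C m)^`()).[z] -> 0 <= ((U m)^`()).[z] -> 1 <= ((C m.+1)^`()).[z] /\
    0 <= ((U m.+1)^`()).[z].
  move=> c0 u0; have [c1 v0 _ _] := chebyshev_monotone m z1 (lexx z).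
  have [-> ->] := chebyshev_pair m.
  rewrite !poly.derivE !hornerE /=.
  have z2 : 0 <= z ^+ 2 - 1 by nra.
  have := mulr_ge0 z2 u0; split; last by nra.
  have : 0 <= z * ((C m)^`()).[z] by apply: mulr_ge0 => //; lra.
  have : 0 <= z * (U m).[z] by apply: mulr_ge0 => //; lra.
  lra.
suff [h1 h2] : 0 <= ((C n)^`()).[z] /\ 0 <= ((U n)^`()).[z].
  by have [? ?] := main n h1 h2.
elim: n => [|n [h1 h2]]; first by rewrite /= !poly.derivE !hornerE.
by have [h3 ->] := main n h1 h2; split => //; lra.
Qed.

Lemma chebyshev_at1 n : (C n).[1] = 1.
Proof.
elim: n => [|n IH]; first by rewrite /= hornerE.
by have [-> _] := chebyshev_horner n 1; rewrite IH; ring.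
Qed.

Lemma chebyshev3_ge3 n : 3 <= (C n.+1).[3].
Proof. by have := @chebyshev_growth n 1 3; rewrite chebyshev_at1; lra. Qed.

Lemma horner_le_coef_sum (p : {poly R}) (b z : R) : `|z| <= b ->
  `|p.[z]| <= \sum_(i < size p) `|p`_i| * b ^+ i.
Proof.
move=> zb; rewrite horner_coef; apply: (le_trans (ler_norm_sum _ _ _)).
apply: ler_sum => i _; rewrite normrM normrX ler_wpM2l ?normr_ge0//.
by rewrite lerXn2r// nnegrE// (le_trans _ zb).
Qed.

(** E is the divided difference of C_(j+1) at 3. On [-1, 1] its numerator is at least 3 - 1 and its
    denominator at most 4, whence 1/2; on [1, 3] the slope is at least 1. The upper bound is the sum
    of the absolute values of the coefficients, taken at radius 3. *)
Lemma chebyshev_divided_difference j :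
  exists (E : {poly R}) (e1 : R),
    (C j.+1).[3]%:P - C j.+1 = (3%:P - 'X) * E /\
    forall z, -1 <= z <= 3 -> 1 / 2 <= E.[z] <= e1.
Proof.
have : root ((C j.+1).[3]%:P - C j.+1) 3.
  by rewrite /root !hornerE subrr.
move=> /factor_theorem[E0 E0E].
pose E := - E0; exists E, (\sum_(i < size E) `|E`_i| * 3 ^+ i).
have EE : (C j.+1).[3]%:P - C j.+1 = (3%:P - 'X) * E.
  by rewrite E0E /E mulrN mulrC -mulNr opprB.
split=> // z /andP[z1 z3].
have hz : (C j.+1).[3] - (C j.+1).[z] = (3 - z) * E.[z].
  by have := congr1 (fun p => p.[z]) EE; rewrite !hornerE.
apply/andP; split; last first.
  by apply: (le_trans (ler_norm _)); apply: horner_le_coef_sum; rewrite ler_norml; lra.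
have [zlt|] := ltP z 3; last first.
  move=> z3'; have -> : z = 3 by lra.
  have := congr1 (fun p : {poly R} => (p^`()).[3]) EE.
  rewrite !poly.derivE !hornerE subrr mul0r addr0 => h.
  have h3 : (1 : R) <= 3 by lra.
  have [h1 _ _] := chebyshev_deriv_ge j h3; lra.
rewrite -(ler_pM2l (_ : 0 < 3 - z)) ?subr_gt0// -hz.
have [zle|zge] := leP z 1.
  have hz1 : -1 <= z <= 1 by lra.
  by have := chebyshev_le1 j.+1 hz1; have := chebyshev3_ge3 j; lra.
have h1 : 1 <= z by lra.
by have := @chebyshev_growth j z 3 h1 z3; lra.
Qed.

(** With alpha = beta / 2, the interval [0, beta] is mapped to [-1, 3] by 3 - 4 t / beta, and s_j(t)
    = 4 / (c beta) E(3 - 4 t / beta) with c = C_(j+1)(3). The last bound is 1 - T <= 1 + 1 / c, from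
    C_(j+1) >= -1 on [-1, 3]. *)
Lemma cheb_s_bounds j : exists c0 c1 : R, [/\ 0 < c0, 0 < c1 &
  forall beta t, 0 < beta -> 0 <= t <= beta ->
    [/\ c0 / beta <= (cheb_s (beta / 2) beta j).[t],
        (cheb_s (beta / 2) beta j).[t] <= c1 / beta &
        t * (cheb_s (beta / 2) beta j).[t] <= 1 + (C j.+1).[3]^-1]].
Proof.
have [E [e1 [EE Eb]]] := chebyshev_divided_difference j.
set c := (C j.+1).[3]; have c3 : 3 <= c := chebyshev3_ge3 j.
have e1p : 0 < e1 by have := Eb 0; lra.
exists (2 / c), (4 * e1 / c); split; [by rewrite divr_gt0//; lra|by rewrite divr_gt0//; lra|].
move=> beta t b0 /andP[t0 tb].
move: EE.
have n1 : (beta + beta / 2) / (beta - beta / 2) = 3 by field; lra.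
have n2 : 2 / (beta - beta / 2) = 4 / beta by field; lra.
have n3 : 4 / (c * beta) = c^-1 * (4 / beta) by field; lra.
have n4 : 2 / c / beta = 4 / (c * beta) * (1 / 2) by field; lra.
have n5 : 4 * e1 / c / beta = 4 / (c * beta) * e1 by field; lra.
have n6 x : t * (4 / (c * beta) * x) = c^-1 * ((4 / beta * t) * x) by field; lra.
have n7 : 1 + c^-1 = c^-1 * (c + 1) by field; lra.
have cn0 : c != 0 by lra.
have k0 : 0 < 4 / (c * beta) by rewrite divr_gt0// mulr_gt0//; lra.
have zb : -1 <= 3 - 4 / beta * t <= 3.
  have : 0 <= 4 / beta * t <= 4.
    rewrite mulr_ge0 ?divr_ge0//=; try lra.
    by rewrite mulrAC ler_pdivrMr//; lra.
  lra.
have Tlb : -1 <= (C j.+1).[3 - 4 / beta * t].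
  have [zle|zge] := leP (3 - 4 / beta * t) 1.
    have hz1 : -1 <= 3 - 4 / beta * t <= 1 by lra.
    by have := chebyshev_le1 j.+1 hz1; lra.
  have h1 : 1 <= 3 - 4 / beta * t by lra.
  have [? _ _ _] := chebyshev_monotone j.+1 h1 (lexx _); lra.
move=> EE; pose l : {poly R} := 3%:P - (4 / beta) *: 'X.
have Tl : cheb_T (beta / 2) beta j.+1 = c^-1 *: (C j.+1 \Po l).
  by rewrite /cheb_T n1 n2.
have sE : cheb_s (beta / 2) beta j = (4 / (c * beta)) *: (E \Po l).
  rewrite /cheb_s Tl.
  have -> : 1 - c^-1 *: (C j.+1 \Po l) = ((4 / (c * beta)) *: (E \Po l)) * 'X.
    have := congr1 (fun p => p \Po l) EE.
    rewrite rmorphB rmorphM rmorphB /= !comp_polyC comp_polyX => h.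
    have -> : C j.+1 \Po l = c%:P - (3%:P - l) * (E \Po l) by rewrite -h; ring.
    rewrite scalerBr -[c%:P]mulr1 mul_polyC scalerA mulVf// scale1r.
    rewrite /l -!mul_polyC.
    rewrite n3 !polyCM; ring.
  by rewrite mulpK// polyX_eq0.
have sz : (cheb_s (beta / 2) beta j).[t] = 4 / (c * beta) * E.[3 - 4 / beta * t].
  by rewrite sE hornerZ horner_comp /l !hornerE.
have /andP[E1 E2] := Eb _ zb; rewrite sz.
split; [by rewrite n4 ler_pM2l|by rewrite n5 ler_pM2l|].
have hz : c - (C j.+1).[3 - 4 / beta * t] = (4 / beta * t) * E.[3 - 4 / beta * t].
  by have := congr1 (fun p => p.[3 - 4 / beta * t]) EE; rewrite !hornerE subKr.
rewrite n6 -hz n7 ler_pM2l ?invr_gt0 ?(lt_le_trans _ c3)//.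
by rewrite lerD2l lerNl.
Qed.

End Chebyshev.

(** * The Chebyshev-Jacobi preconditioner *)

Lemma qf_gram (R : realFieldType) m n (A : 'M[R]_(m, n)) x y :
  qf (A^T *m A) x y = qf 1%:M (A *m x) (A *m y).
Proof. by rewrite -qf_congr mulmx1. Qed.

Section ChebPreconditioner.
Variable R : realType.

Lemma diag_mxX n (l : 'rV[R]_n) i : diag_mx l ^+ i = diag_mx (\row_k l 0 k ^+ i).
Proof.
elim: i => [|i IH].
  by rewrite expr0; apply/matrixP => a b; rewrite !mxE expr0.
rewrite exprS IH -[_ * _]/(_ *m _); apply/matrixP => a b; rewrite mul_diag_mx !mxE exprS.
by case: eqP => [->|_]; rewrite ?mulr1n// !mulr0n mulr0.
Qed.

Lemma poly_mx_conj n (P : {poly R}) (W W' : 'M[R]_n) l : W' *m W = 1%:M ->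
  poly_mx P (W *m diag_mx l *m W') = W *m diag_mx (\row_k P.[l 0 k]) *m W'.
Proof.
move=> W'W; have WW' := mulmx1C W'W.
have pw i : (W *m diag_mx l *m W') ^+ i = W *m diag_mx (\row_k l 0 k ^+ i) *m W'.
  rewrite -diag_mxX; elim: i => [|i IH].
    by rewrite !expr0 -[1 in RHS]/(1%:M) mulmx1 WW'.
  rewrite !exprS IH -![(_ * _)%R]/(_ *m _) !mulmxA.
  by rewrite -(mulmxA _ W' W) W'W mulmx1.
rewrite /poly_mx.
under eq_bigr do rewrite pw.
have -> : diag_mx (\row_k P.[l 0 k]) = \sum_(i < size P) P`_i *: diag_mx (\row_k l 0 k ^+ i).
  apply/matrixP => a b; rewrite summxE !mxE horner_coef -sumrMnl.
  by apply: eq_bigr => i _; rewrite !mxE mulrnAr.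
rewrite mulmx_sumr mulmx_suml; apply: eq_bigr => i _.
by rewrite -scalemxAr -scalemxAl.
Qed.

Variables (n : nat) (D M : 'M[R]_n).
Hypotheses (DT : D^T = D) (Dp : pd D) (MT : M^T = M) (Mp : psd M).
Let beta := lambda_max (invmx D *m M).

Lemma spectral_decomposition : exists (W W' : 'M[R]_n) (l : 'rV[R]_n),
  [/\ W' *m W = 1%:M, W *m W' = 1%:M, D = W'^T *m W', M = W'^T *m diag_mx l *m W' &
      invmx D = W *m W^T].
Proof.
have [W [l [W1 W2]]] := simultaneous_diagonalization DT Dp MT.
exists W, (W^T *m D), l; split => //; first exact: mulmx1C.
- by rewrite trmx_mul trmxK DT -mulmxA (mulmx1C W1) mulmx1.
- have h2 : D *m W *m W^T = 1%:M.
    by apply: mulmx1C; rewrite mulmxA.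
  rewrite -W2 trmx_mul trmxK DT !mulmxA h2 mul1mx -[LHS]mulmx1 -(mulmx1C W1).
  by rewrite !mulmxA.
have uD := pd_unitmx Dp.
have h : W *m W^T *m D = 1%:M by rewrite -mulmxA (mulmx1C W1).
by rewrite -[LHS]mul1mx -h mulmxK.
Qed.

Hypothesis M0 : M != 0.

Lemma eigenvalue_diag_conj (W W' : 'M[R]_n) l a : W' *m W = 1%:M ->
  eigenvalue (W *m diag_mx l *m W') a <-> exists k, l 0 k = a.
Proof.
move=> W'W; have WW' := mulmx1C W'W; split.
  case/eigenvalueP => v vE v0.
  have : v *m W != 0.
    by apply: contraNneq v0 => h; rewrite -[v]mulmx1 -WW' mulmxA h mul0mx.
  case/rV0Pn => k hk; exists k.
  have : v *m W *m diag_mx l = a *: (v *m W).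
    by rewrite scalemxAl -vE -!mulmxA W'W mulmx1.
  move/matrixP/(_ 0 k); rewrite mul_mx_diag !mxE => /eqP.
  rewrite mulrC -subr_eq0 -mulrBl mulf_eq0 subr_eq0 => /orP[/eqP//|].
  by move: hk; rewrite !mxE => /negPf ->.
case=> k lk; apply/eigenvalueP; exists (delta_mx 0 k *m W').
  rewrite !mulmxA -(mulmxA _ W' W) W'W mulmx1 scalemxAl; congr (_ *m _).
  apply/matrixP => i j; rewrite mul_mx_diag !mxE -lk.
  by case: (j =P k) => [->|]; rewrite ?andbF ?mul0r ?mulr0// mulrC.
apply/eqP => h; have : delta_mx 0 k *m W' *m W = 0 :> 'rV[R]_n by rewrite h mul0mx.
rewrite -mulmxA W'W mulmx1 => /matrixP/(_ 0 k); rewrite !mxE !eqxx.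
by move/eqP; rewrite oner_eq0.
Qed.

(** [M0] makes the supremum defining [beta] range over a nonempty set with a positive element. It is
    then the largest of the entries [l 0 k], hence also the least b with M <= b D. *)
Lemma lambda_max_spec : exists (W W' : 'M[R]_n) (l : 'rV[R]_n),
  [/\ W' *m W = 1%:M, D = W'^T *m W', M = W'^T *m diag_mx l *m W',
      invmx D = W *m W^T &
      [/\ 0 < beta, (forall k, 0 <= l 0 k <= beta), invmx D *m M = W *m diag_mx l *m W' &
      forall b, lef M (b *: D) -> beta <= b]].
Proof.
have [W [W' [l [W'W WW' DE ME DI]]]] := spectral_decomposition.
have DM : invmx D *m M = W *m diag_mx l *m W'.
  by rewrite DI ME !mulmxA -(mulmxA W W^T) -trmx_mul W'W trmx1 mulmx1.
have lE k : l 0 k = qf M (col k W) (col k W).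
  have -> : col k W = W *m delta_mx k 0 by rewrite colE.
  rewrite ME qf_congr mulmxA W'W mul1mx qf_diag (bigD1 k)//= big1 ?addr0.
    by rewrite !mxE !eqxx !mulr1.
  by move=> i ik; rewrite !mxE (negPf ik) mulr0.
have l0 k : 0 <= l 0 k by rewrite lE.
have bE : beta = sup [set l 0 k | k in [set: 'I_n]]%classic.
  rewrite /beta /lambda_max DM; congr sup; apply/seteqP; split => a /=.
    by move/(eigenvalue_diag_conj l a W'W) => [k ka]; exists k.
  by case=> k _ ka; apply/(eigenvalue_diag_conj l a W'W); exists k.
have hs : has_ubound [set l 0 k | k in [set: 'I_n]]%classic.
  exists (\sum_k l 0 k) => _ [k _ <-]; rewrite (bigD1 k)//= lerDl sumr_ge0//.
have lb k : l 0 k <= beta by rewrite bE; apply: ub_le_sup => //; exists k.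
have [k lk0] : exists k, l 0 k != 0.
  apply/existsP; apply: contraNT M0; rewrite negb_exists => /forallP h.
  have lz : l = 0 by apply/rowP => k; rewrite mxE; apply/eqP/negbNE/h.
  by rewrite ME lz linear0 mulmx0 mul0mx.
exists W, W', l; split => //; split => //.
- by apply: (@lt_le_trans _ _ (l 0 k)) => //; rewrite lt_def lk0 l0.
- by move=> i; rewrite l0 lb.
move=> b Mb; rewrite bE; apply: ge_sup; first by exists (l 0 k); exists k.
move=> _ [i _ <-]; rewrite lE; apply: (le_trans (Mb _)).
have -> : qf (b *: D) (col i W) (col i W) = b.
  have -> : col i W = W *m delta_mx i 0 by rewrite colE.
  rewrite qfZ DE qf_gram mulmxA W'W mul1mx qf1E (bigD1 i)//= big1 ?addr0.
    by rewrite !mxE !eqxx !mulr1.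
  by move=> j ij; rewrite !mxE (negPf ij) mulr0.
by [].
Qed.
End ChebPreconditioner.

(** The constants depend on j alone. In the basis diagonalizing D and M, H has the entries s = g
    s_j(l) with g = c / (1 + c). The scaling g turns l s_j(l) <= 1 + 1 / c into l s <= 1, which is M
    <= H^-1; the two-sided bound of s_j by multiples of 1 / beta gives the rest. *)
Lemma scaled_Cheb_spec (R : realType) (j : nat) : exists c1 c2 : R, [/\ 0 < c1, 0 < c2 &
  forall n (D M : 'M[R]_n), D^T = D -> pd D -> M^T = M -> psd M -> M != 0 ->
  let beta := lambda_max (invmx D *m M) in let H := scaled_Cheb M D j in
  [/\ H^T = H, pd H, lef M (invmx H), lef (invmx H) ((c1 * beta) *: D) &
      lef H ((c2 / beta) *: invmx D)] ].
Proof.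
have [c0 [c1 [c0p c1p hc]]] := cheb_s_bounds R j.
set c := (chebyshev_poly R j.+1).[3] in hc.
have c3 : 3 <= c := chebyshev3_ge3 R j.
pose g := c / (1 + c).
have g0 : 0 < g by rewrite divr_gt0//; lra.
exists (g * c0)^-1, (g * c1); split; [by rewrite invr_gt0 mulr_gt0|by rewrite mulr_gt0|].
move=> n D M DT Dp MT Mp M0 beta H.
have [W [W' [l [W'W DE ME DI [b0 lb DM lub]]]]] := lambda_max_spec DT Dp MT Mp M0.
rewrite -/beta in b0 lb lub.
have WW' := mulmx1C W'W.
pose s k := g * (cheb_s (beta / 2) beta j).[l 0 k].
have HE : H = W *m diag_mx (\row_k s k) *m W^T.
  rewrite /H /scaled_Cheb /Cheb -/beta -/c -/g DM (poly_mx_conj _ _ W'W) DI mulmxA.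
  rewrite -(mulmxA _ W' W) W'W mulmx1 scalemxAl scalemxAr; congr (_ *m _ *m _).
  by apply/matrixP => a b; rewrite !mxE mulrnAr.
have sp k : 0 < s k.
  have [h1 _ _] := hc beta (l 0 k) b0 (lb k).
  by rewrite /s mulr_gt0// (lt_le_trans _ h1)// divr_gt0.
have HI : invmx H = W'^T *m diag_mx (\row_k (s k)^-1) *m W'.
  have h : H *m (W'^T *m diag_mx (\row_k (s k)^-1) *m W') = 1%:M.
    rewrite HE !mulmxA -(mulmxA _ W^T) -trmx_mul W'W trmx1 mulmx1 -(mulmxA W).
    have -> : diag_mx (\row_k s k) *m diag_mx (\row_k (s k)^-1) = 1%:M.
      apply/matrixP => a b; rewrite mul_diag_mx !mxE.
      by case: eqP => [->|]; rewrite ?mulr0// mulr1n mulfV// gt_eqF.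
    by rewrite mulmx1.
  have [uH _] := mulmx1_unit h.
  by rewrite -[LHS]mulmx1 -h mulKmx.
split.
- by rewrite HE !trmx_mul trmxK tr_diag_mx mulmxA.
- move=> x x0; rewrite HE -{1}[W]trmxK qf_congr qf_diag.
  have : W^T *m x != 0.
    by apply: contraNneq x0 => h; rewrite -[x]mul1mx -trmx1 -WW' trmx_mul -mulmxA h mulmx0.
  case/cV0Pn => k hk; rewrite (bigD1 k)//= ltr_pwDl//.
    by rewrite mxE -mulrA mulr_gt0// -expr2 exprn_even_gt0.
  by apply: sumr_ge0 => i _; rewrite mxE -mulrA mulr_ge0 ?(ltW (sp _))// -expr2 sqr_ge0.
- move=> x; rewrite HI {1}ME !qf_congr !qf_diag; apply: ler_sum => k _.
  rewrite -!mulrA -expr2; apply: ler_wpM2r; rewrite ?sqr_ge0// mxE.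
  have [_ _ h] := hc beta (l 0 k) b0 (lb k).
  rewrite -[X in _ <= X]mul1r ler_pdivlMr// /s mulrCA /g mulrAC ler_pdivrMr; last by lra.
  have -> : 1 * (1 + c) = c * (1 + c^-1) by field; lra.
  by rewrite ler_pM2l//; lra.
- move=> x; rewrite HI qfZ DE qf_gram qf_congr qf_diag qf1E mulr_sumr; apply: ler_sum => k _.
  rewrite -mulrA; apply: ler_wpM2r; rewrite -?expr2 ?sqr_ge0// mxE.
  have [h _ _] := hc beta (l 0 k) b0 (lb k).
  have -> : (g * c0)^-1 * beta = (g * (c0 / beta))^-1.
    by field; rewrite !gt_eqF.
  have h1 : g * (c0 / beta) <= s k by rewrite /s ler_pM2l.
  rewrite lef_pV2 //; first exact: sp.
  exact: mulr_gt0 g0 (divr_gt0 c0p b0).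
move=> x; have DI2 : invmx D = (W^T)^T *m W^T by rewrite trmxK.
rewrite HE DI2 [leRHS]qfZ qf_gram -{1}[W]trmxK qf_congr qf_diag qf1E mulr_sumr.
apply: ler_sum => k _; rewrite -mulrA; apply: ler_wpM2r; rewrite -?expr2 ?sqr_ge0// mxE.
have [_ h _] := hc beta (l 0 k) b0 (lb k).
by rewrite /s -[leRHS]mulrA; apply: ler_wpM2l; [exact: ltW|].
Qed.

(** * The Uzawa smoother *)

Lemma qf_block (R : realFieldType) n r (a : 'M[R]_n) (b : 'M[R]_(n, r)) (c : 'M[R]_(r, n)) (d : 'M[R]_r)
   (u v : 'cV[R]_n) (p q : 'cV[R]_r) :
  qf (block_mx a b c d) (col_mx u p) (col_mx v q) =
  qf a u v + (u^T *m b *m q) 0 0 + ((p^T *m c *m v) 0 0 + qf d p q).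
Proof.
rewrite /qf tr_col_mx mul_row_block mul_row_col !mulmxDl !mxE; ring.
Qed.

Lemma mx00_0 (R : realFieldType) : (0 : 'M[R]_1) 0 0 = 0. Proof. by rewrite mxE. Qed.

Lemma mx11_tr (R : realFieldType) (M : 'M[R]_1) : M^T 0 0 = M 0 0. Proof. by rewrite mxE. Qed.

Lemma reflection_compl (R : realFieldType) n (S : 'M[R]_n) :
  1 - (2 *: S - 1%:M) = 2 *: (1 - S).
Proof. by rewrite -[1%:M]/1 scalerBr opprB addrA !scaler_nat mulr2n. Qed.

Lemma mx_exprZn (R : realFieldType) n (a : R) (M : 'M[R]_n) j : (a *: M) ^+ j = a ^+ j *: M ^+ j.
Proof.
elim: j => [|j IH]; first by rewrite !expr0 scale1r.
by rewrite !exprS IH -[LHS]/(_ *m _) -scalemxAl -scalemxAr scalerA.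
Qed.

Lemma one_sub_comm (R : realFieldType) n (S T : 'M[R]_n) :
  (1 - S) * (S * T) = S * ((1 - S) * T).
Proof. by rewrite !mulrA mulrBl mulrBr mul1r mulr1. Qed.

Section Uzawa.
Variables (R : realType) (n r : nat) (A Ai : 'M[R]_n) (B : 'M[R]_(r, n)) (Si : 'M[R]_r).
Hypotheses (AT : A^T = A) (Ap : psd A) (AiT : Ai^T = Ai) (Aip : pd Ai).
Hypotheses (SiT : Si^T = Si) (Sip : pd Si).
Let Ah : 'M[R]_n := invmx Ai.
Let Sh : 'M[R]_r := invmx Si.
Hypotheses (AAh : lef A Ah) (BSh : lef (B *m Ai *m B^T) Sh).
Let Kh : 'M[R]_(n + r) := block_mx Ah B^T B (B *m Ai *m B^T - Sh).
Let K := saddle A B.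
Let G : 'M[R]_(n + r) := block_mx (Ah - A) 0 0 (Sh - B *m Ai *m B^T).
Let E : 'M[R]_(n + r) := block_mx 1%:M 0 0 (- 1%:M).
Let S : 'M[R]_(n + r) := 1%:M - invmx Kh *m K.

Let uAi : Ai \in unitmx. Proof. exact: pd_unitmx. Qed.
Let uSi : Si \in unitmx. Proof. exact: pd_unitmx. Qed.

(** Block elimination: the Schur complement of [Ah] in [Kh] is [- Sh]. *)
Lemma uzawa_unitmx : Kh \in unitmx.
Proof.
have -> : Kh = block_mx 1%:M 0 (B *m Ai) 1%:M *m
     block_mx Ah B^T 0 (- Sh).
  by rewrite mulmx_block !mul1mx !mul0mx !addr0 mulmxK.
rewrite unitmx_mul !unitmxE det_lblock det_ublock !det1 mulr1 unitr1 /= unitrM.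
by rewrite -!unitmxE unitmx_inv uAi -scaleN1r unitmxZ ?unitrN1// unitmx_inv.
Qed.

Lemma uzawa_EE : E *m E = 1%:M.
Proof.
rewrite mulmx_block !mulmx1 !mulmx0 !mul0mx !addr0 add0r mulNmx mulmxN opprK mulmx1.
by rewrite -scalar_mx_block.
Qed.

Lemma uzawa_NE : Kh - K = E *m G.
Proof.
rewrite /Kh /K /saddle opp_block_mx add_block_mx mulmx_block.
rewrite !mul1mx !mul0mx !mulmx0 !addr0 !subrr add0r mulNmx mul1mx opprB.
by rewrite subr0.
Qed.

Lemma uzawa_GT : G^T = G.
Proof.
rewrite tr_block_mx !trmx0 !linearB /= AT trmx_inv AiT trmx_inv SiT.
by rewrite !trmx_mul trmxK AiT mulmxA.
Qed.

Lemma uzawa_Gp : psd G.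
Proof.
move=> x; rewrite -(vsubmxK x) qf_block !mulmx0 !mul0mx !mx00_0 !addr0 add0r !qfB.
by rewrite addr_ge0// subr_ge0.
Qed.

Lemma uzawa_KhS m (x : 'M[R]_(n + r, m)) : Kh *m (S *m x) = E *m G *m x.
Proof.
rewrite -uzawa_NE mulmxA /S mulmxBr mulmx1 mulmxA mulmxV ?mul1mx//.
exact: uzawa_unitmx.
Qed.

(** For y = S z one has G z = E Kh y. The off-diagonal blocks B^T and -B of E Kh cancel in its
    quadratic form, which then exceeds that of G by the form of A. Hence G(y, y) <= G(y, z), and
    this is the contraction property of 2 y - z. *)
Lemma uzawa_nonexpansive (z : 'cV[R]_(n + r)) :
  qf G ((2 *: S - 1%:M) *m z) ((2 *: S - 1%:M) *m z) <= qf G z z.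
Proof.
set y := S *m z.
have -> : (2 *: S - 1%:M) *m z = 2 *: y - z.
  by rewrite mulmxBl -scalemxAl mul1mx.
have Gz : G *m z = E *m Kh *m y.
  by rewrite -mulmxA uzawa_KhS !mulmxA uzawa_EE mul1mx.
have key : qf G y y <= qf G y z.
  have -> : qf G y z = qf (E *m Kh) y y.
    by rewrite /qf -mulmxA Gz !mulmxA.
  rewrite -(vsubmxK y); set u := usubmx y; set p := dsubmx y.
  have -> : E *m Kh = block_mx Ah B^T (- B) (Sh - B *m Ai *m B^T).
    by rewrite mulmx_block !mul1mx !mul0mx !addr0 !add0r !mulNmx !mul1mx opprB.
  rewrite !qf_block !mulmx0 !mul0mx !mx00_0 !addr0 add0r addrA lerD2r.
  have -> : (p^T *m (- B) *m u) 0 0 = - (u^T *m B^T *m p) 0 0.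
    rewrite mulmxN mulNmx [LHS]mxE; congr (- _).
    by rewrite -[RHS]mx11_tr !trmx_mul !trmxK mulmxA.
  by rewrite addrK qfB lerBlDr lerDl Ap.
rewrite -scaleN1r !qfDl !qfDr !qfZl !qfZr (qf_sym z y uzawa_GT).
lra.
Qed.

(** Since K = Kh (1 - S) and 1 - S commutes with S, one factor S is consumed in Kh S = E G. The
    power j + 1 leaves the exponent j, whence the argument m - 1 of eta0. *)
Lemma uzawa_KS j : K *m S ^+ j.+1 = (2 ^+ j.+1)^-1 *:
  (E *m (G *m ((1 - (2 *: S - 1%:M)) *m (1 + (2 *: S - 1%:M)) ^+ j))).
Proof.
have -> : 1 + (2 *: S - 1%:M) = 2 *: S by rewrite -[1%:M]/1 addrCA subrr addr0.
rewrite reflection_compl.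
rewrite mx_exprZn -scalemxAl -!scalemxAr !scalerA -exprS.
rewrite mulVf ?expf_neq0 ?pnatr_eq0// scale1r.
have KE : K = Kh *m (1 - S).
  rewrite /S opprB addrC subrK mulmxA mulmxV ?mul1mx//; exact: uzawa_unitmx.
rewrite {1}KE exprS.
have -> : Kh *m (1 - S) *m (S * S ^+ j) = Kh *m (S *m ((1 - S) *m S ^+ j)).
  rewrite -mulmxA; congr (_ *m _); exact: one_sub_comm.
rewrite uzawa_KhS -!mulmxA //.
Qed.

Lemma uzawa_bilinear_bound j x y :
  `|(y^T *m (K *m S ^+ j.+1) *m x) 0 0| <=
  eta0 R j * (Num.sqrt (qf G y y) * Num.sqrt (qf G x x)).
Proof.
rewrite uzawa_KS -scalemxAr -scalemxAl mxE.
set P := 2 *: S - 1%:M; set T := (1 - P) *m (1 + P) ^+ j.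
have ET : E^T = E by rewrite tr_block_mx !trmx0 linearN /= !trmx1.
have -> : (y^T *m (E *m (G *m T)) *m x) 0 0 = qf G (E *m y) (T *m x).
  by rewrite /qf trmx_mul ET !mulmxA.
rewrite normrM ger0_norm ?invr_ge0 ?exprn_ge0//.
(* E only changes the sign of the pressure block, and G is block diagonal. *)
have -> : qf G y y = qf G (E *m y) (E *m y).
  rewrite -(vsubmxK y) mul_block_col !mul1mx !mul0mx mulNmx mul1mx addr0 add0r !qf_block.
  by rewrite !mulmx0 !mul0mx !mx00_0 !addr0 !add0r qfNr qfNl opprK.
have := nonexpansive_smoothing x (E *m y) j uzawa_GT uzawa_Gp uzawa_nonexpansive.
rewrite -/P -/T => h.
rewrite /eta0 eta_bin_half mulrAC -[X in _ <= X]mulrC.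
apply: (le_trans (ler_wpM2l _ h)); first by rewrite invr_ge0 exprn_ge0.
by rewrite exprS invfM; lra.
Qed.

End Uzawa.

(** * The norms of X and its dual, and the smoothing estimate for abstract saddle point matrices *)

Lemma enorm_cV (R : realType) n (x : 'cV[R]_n) : enorm x ^+ 2 = qf 1%:M x x.
Proof.
have s0 : 0 <= \sum_i \sum_j x i j ^+ 2 by rewrite !sumr_ge0// => i _; rewrite sumr_ge0// => j _; rewrite sqr_ge0.
by rewrite /enorm sqr_sqrtr// qf1E; apply: eq_bigr => i _; rewrite big_ord1 expr2.
Qed.

Lemma X_norm_sqr (R : realType) d n r (h : R) (x : 'cV[R]_(n + r)) : 0 < h ->
  X_norm d h x ^+ 2 = h ^+ (d - 2) * qf 1%:M (usubmx x) (usubmx x) + h ^+ d * qf 1%:M (dsubmx x) (dsubmx x).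
Proof.
move=> h0; rewrite /X_norm !enorm_cV sqr_sqrtr//.
by rewrite addr_ge0// mulr_ge0 ?qf1_ge0// exprn_ge0 ?ltW.
Qed.

(** The dual norm of f is attained at its Riesz representative y, whose blocks are those of f scaled
    by the inverse weights. *)
Lemma X_opnorm_le (R : realType) d n r (h c : R) (M : 'M[R]_(n + r)) :
  0 < h -> 0 <= c ->
  (forall x y, `|(y^T *m M *m x) 0 0| <= c * (X_norm d h y * X_norm d h x)) ->
  X_opnorm d h M <= c.
Proof.
move=> h0 c0 H; apply: ge_sup.
  exists (Xdual_norm d h (M *m 0)), 0 => //=.
  rewrite /X_norm !enorm_cV !linear0 !qf0r !mulr0 addr0 sqrtr0; exact: ler01.
move=> _ [x /= x1 <-]; set f := M *m x.
set y : 'cV[R]_(n + r) := col_mx (h ^- (d - 2) *: usubmx f) (h ^- d *: dsubmx f).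
have hn k : 0 < h ^+ k by rewrite exprn_gt0.
have hI k : h ^+ k * h ^- k = 1 by rewrite mulfV// gt_eqF.
set q := h ^- (d - 2) * qf 1%:M (usubmx f) (usubmx f) + h ^- d * qf 1%:M (dsubmx f) (dsubmx f).
have q0 : 0 <= q by rewrite addr_ge0// mulr_ge0 ?qf1_ge0// invr_ge0 ltW.
have XE : Xdual_norm d h f = Num.sqrt q by rewrite /Xdual_norm !enorm_cV.
have yE : X_norm d h y = Num.sqrt q.
  rewrite /X_norm !enorm_cV col_mxKu col_mxKd !qfZl !qfZr; congr Num.sqrt.
  by rewrite !mulrA !hI !mul1r.
have yf : (y^T *m M *m x) 0 0 = q.
  rewrite -mulmxA -/f -[f]vsubmxK tr_col_mx mul_row_col.
  rewrite /q /qf !mulmx1 !linearZ /= -!scalemxAl.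
  by rewrite [LHS]mxE [X in X + _]mxE [X in _ + X = _]mxE.
have := H x y; rewrite yf yE ger0_norm// => le; rewrite XE.
have [s0|sn0] := eqVneq (Num.sqrt q) 0; first by rewrite s0.
have sp : 0 < Num.sqrt q by rewrite lt_def sn0 sqrtr_ge0.
rewrite -(ler_pM2l sp) -expr2 sqr_sqrtr//; apply: (le_trans le).
rewrite mulrCA ler_pM2l// ler_piMr//.
Qed.

Lemma qf_diagm (R : realType) n (A : 'M[R]_n) x :
  qf (diagm A) x x = \sum_i A i i * x i 0 ^+ 2.
Proof. by rewrite qf_diag; apply: eq_bigr => i _; rewrite mxE -mulrA expr2. Qed.

Lemma invmx_diag_mx (R : realType) n (l : 'rV[R]_n) : (forall i, l 0 i != 0) ->
  invmx (diag_mx l) = diag_mx (\row_i (l 0 i)^-1).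
Proof.
move=> l0; have h : diag_mx l *m diag_mx (\row_i (l 0 i)^-1) = 1%:M.
  apply/matrixP => a b; rewrite mul_diag_mx !mxE.
  by case: eqP => [->|]; rewrite ?mulr0// mulr1n mulfV.
have [u _] := mulmx1_unit h.
by rewrite -[LHS]mulmx1 -h mulKmx.
Qed.

Lemma pd_diag_mx (R : realType) n (l : 'rV[R]_n) : (forall i, 0 < l 0 i) -> pd (diag_mx l).
Proof.
move=> l0 x /cV0Pn[k hk]; rewrite qf_diag (bigD1 k)//= ltr_pwDl//.
  by rewrite -mulrA mulr_gt0// -expr2 exprn_even_gt0.
by apply: sumr_ge0 => i _; rewrite -mulrA mulr_ge0 ?(ltW (l0 _))// -expr2 sqr_ge0.
Qed.

Lemma lef_congr (R : realType) n r (M N : 'M[R]_n) (B : 'M[R]_(r, n)) :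
  lef M N -> lef (B *m M *m B^T) (B *m N *m B^T).
Proof. by move=> MN x; rewrite -{1 3}[B]trmxK !qf_congr. Qed.

(** Reduction to Jacobi bounds. With beta_A the largest eigenvalue for A, Ahat <= c1 beta_A diag A,
    where beta_A <= C, and Stilde <= (c2 / beta_A) B (diag A)^-1 B^T, which calls for a lower bound
    of beta_A. The condition on B makes n positive and Stilde nonzero. *)
Theorem saddle_smoothing (R : realType) (kA kS : nat) (C : R) : 0 < C ->
  exists2 c : R, 0 < c &
  forall d n r (h : R) (A : 'M[R]_n) (B : 'M[R]_(r, n)) (D : 'M[R]_r),
  0 < h -> A^T = A -> psd A -> (forall i, 0 < A i i) ->
  lef A (C *: diagm A) -> (forall i, A i i <= C * h ^+ (d - 2)) ->
  D^T = D -> pd D -> lef D ((C * h ^+ d) *: 1%:M) ->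
  lef (B *m invmx (diagm A) *m B^T) (C *: D) -> B != 0 ->
  forall m, (1 <= m)%N ->
  X_opnorm d h (saddle A B *m uzawa_iter A B D kA kS ^+ m) <= c * eta0 R m.-1.
Proof.
move=> C0.
have [c1 [c2 [c1p c2p HA]]] := scaled_Cheb_spec R kA.
have [e1 [e2 [e1p e2p HS]]] := scaled_Cheb_spec R kS.
(* k1 h^(d-2) bounds Ahat and k2 h^d bounds Shat; the factor c1 c2 C in k2 bounds the largest
   eigenvalue for Stilde relative to D. *)
pose k1 := c1 * C * C; pose k2 := e1 * (c1 * c2 * C) * C.
have k1p : 0 < k1 by rewrite !mulr_gt0.
have k2p : 0 < k2 by rewrite !mulr_gt0.
exists (k1 + k2); first by rewrite addr_gt0.
move=> d n r h A B D h0 AT Ap Ad AC Ah DT Dp DC BC B0 [//|m] _ /=.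
have [i0] : exists i : 'I_n, True.
  by case: (n) B B0 {BC A AT Ap Ad AC Ah} => [B|n' B _]; [rewrite thinmx0 eqxx|exists ord0].
move=> _.
have dT : (diagm A)^T = diagm A by rewrite tr_diag_mx.
have dp : pd (diagm A) by apply: pd_diag_mx => i; rewrite mxE.
have A0 : A != 0.
  by apply/eqP => A0; have := Ad i0; rewrite A0 mxE ltxx.
have [AiT Aip AleAh Ahle Aile] := HA n (diagm A) A dT dp AT Ap A0.
have [_ [_ [_ [_ _ _ _ [bA0 _ _ bAC]]]]] := lambda_max_spec dT dp AT Ap A0.
set bA := lambda_max _ in bA0 bAC Ahle Aile.
have {}bAC := bAC _ AC.
(* Evaluated at a unit vector, A <= Ahat <= c1 beta_A diag A has the same diagonal entry of A at
   both ends, and it cancels. *)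
have bAge : c1^-1 <= bA.
  have := le_trans (AleAh (delta_mx i0 0)) (Ahle (delta_mx i0 0)).
  have -> : qf A (delta_mx i0 0) (delta_mx i0 0) = A i0 i0.
    rewrite /qf trmx_delta -rowE -colE !mxE //.
  rewrite qfZ qf_diagm (bigD1 i0)//= big1 => [|i ii0]; last by rewrite !mxE (negPf ii0) expr0n mulr0.
  rewrite !mxE !eqxx expr1n mulr1 addr0 -{1}[A i0 i0]mul1r ler_pM2r// => h1.
  by rewrite -[leLHS]mulr1 ler_pdivrMl// .
set Ai := scaled_Cheb _ _ _ in AiT Aip AleAh Ahle Aile.
pose St := Stilde A B kA.
have StE : St = B *m Ai *m B^T by [].
have StT : St^T = St by rewrite StE !trmx_mul trmxK AiT mulmxA.
have Aipsd : psd Ai.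
  by move=> x; have [->|x0] := eqVneq x 0; [rewrite qf0r|rewrite ltW// Aip].
have Stp : psd St by move=> x; rewrite StE -{1}[B]trmxK qf_congr.
have St0 : St != 0.
  have [i [j Bij]] : exists i j, B i j != 0.
    by case/matrix0Pn : B0 => i [j Bij]; exists i, j.
  apply/eqP => S0.
  have : 0 < qf St (delta_mx i 0) (delta_mx i 0).
    rewrite StE -{1}[B]trmxK qf_congr; apply: Aip; apply/cV0Pn; exists j.
    by rewrite -colE !mxE.
  by rewrite S0 /qf mulmx0 mul0mx mxE ltxx.
have StD : lef St ((c1 * c2 * C) *: D).
  move=> x; rewrite StE; apply: (le_trans (lef_congr B Aile x)).
  rewrite -scalemxAr -scalemxAl qfZ; have := BC x; rewrite qfZ => hx.
  have -> : qf ((c1 * c2 * C) *: D) x x = (c1 * c2) * (C * qf D x x) by rewrite qfZ mulrA.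
  have hp : 0 <= qf (B *m invmx (diagm A) *m B^T) x x.
    rewrite -{1}[B]trmxK qf_congr invmx_diag_mx; last by move=> i; rewrite mxE gt_eqF.
    rewrite qf_diag sumr_ge0// => i _.
    by rewrite !mxE -mulrA mulr_ge0 -?expr2 ?sqr_ge0// invr_ge0 ltW.
  apply: ler_pM => //; first by rewrite divr_ge0 ?ltW.
  by rewrite mulrC ler_pM2r// -[leRHS]invrK lef_pV2 ?posrE ?invr_gt0.
have [SiT Sip SleSh Shle _] := HS r D St DT Dp StT Stp St0.
have [_ [_ [_ [_ _ _ _ [bS0 _ _ bSC]]]]] := lambda_max_spec DT Dp StT Stp St0.
set bS := lambda_max _ in bS0 bSC Shle.
have {}bSC := bSC _ StD.
set Si := scaled_Cheb _ _ _ in SiT Sip SleSh Shle.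
have hd k : 0 < h ^+ k by rewrite exprn_gt0.
pose G : 'M[R]_(n + r) := block_mx (invmx Ai - A) 0 0 (invmx Si - St).
have GX x : qf G x x <= (k1 + k2) * X_norm d h x ^+ 2.
  rewrite X_norm_sqr// -{1 2}[x]vsubmxK qf_block !mulmx0 !mul0mx !mx00_0 !addr0 add0r !qfB.
  set u := usubmx x; set p := dsubmx x.
  have q1 := qf1_ge0 u; have q2 := qf1_ge0 p.
  have hu : qf (invmx Ai) u u <= k1 * (h ^+ (d - 2) * qf 1%:M u u).
    apply: (le_trans (Ahle u)); rewrite qfZ /k1 -!mulrA ler_pM2l//.
    apply: ler_pM; [exact: ltW| |by []|].
      by rewrite qf_diagm sumr_ge0// => i _; rewrite mulr_ge0 ?sqr_ge0// ltW.
    rewrite qf_diagm qf1E !mulr_sumr; apply: ler_sum => i _.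
    by rewrite mulrA -expr2; apply: ler_wpM2r; rewrite ?sqr_ge0.
  have hp : qf (invmx Si) p p <= k2 * (h ^+ d * qf 1%:M p p).
    apply: (le_trans (Shle p)); rewrite qfZ /k2.
    have -> : e1 * (c1 * c2 * C) * C * (h ^+ d * qf 1%:M p p) =
       e1 * (c1 * c2 * C) * ((C * h ^+ d) * qf 1%:M p p) by ring.
    have := DC p; rewrite qfZ => hD.
    apply: ler_pM => //; [by rewrite mulr_ge0 ?ltW| |by rewrite ler_pM2l].
    by have [->|/Dp/ltW//] := eqVneq p 0; rewrite qf0r.
  have a0 := Ap u; have s0 := Stp p.
  have t1 : 0 <= k2 * (h ^+ (d - 2) * qf 1%:M u u) by apply: mulr_ge0; [exact: ltW|apply: mulr_ge0; [exact: ltW|exact: q1]].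
  have t2 : 0 <= k1 * (h ^+ d * qf 1%:M p p) by apply: mulr_ge0; [exact: ltW|apply: mulr_ge0; [exact: ltW|exact: q2]].
  by rewrite mulrDr !mulrDl; lra.
have e0 : 0 <= eta0 R m by rewrite /eta0 divr_ge0// ?ler0n// exprn_ge0.
apply: X_opnorm_le => //; first by rewrite mulr_ge0// addr_ge0// ltW.
move=> x y.
have := uzawa_bilinear_bound AT Ap AiT Aip SiT Sip AleAh SleSh m x y.
rewrite -[block_mx (invmx Ai) _ _ _]/(saddle_hat A B D kA kS).
move/le_trans; apply.
have -> : (k1 + k2) * eta0 R m * (X_norm d h y * X_norm d h x) =
  eta0 R m * ((k1 + k2) * (X_norm d h y * X_norm d h x)) by ring.
apply: ler_wpM2l => //.
have Xn0 (z : 'cV[R]_(n + r)) : 0 <= X_norm d h z by exact: sqrtr_ge0.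
have k0 : 0 <= k1 + k2 by rewrite addr_ge0// ltW.
have sG z : Num.sqrt (qf G z z) <= Num.sqrt (k1 + k2) * X_norm d h z.
  by rewrite -(ger0_norm (Xn0 z)) -sqrtr_sqr -sqrtrM// ler_wsqrtr.
rewrite -{1}(sqr_sqrtr k0) expr2 mulrACA; apply: ler_pM; rewrite ?sqrtr_ge0//.
Qed.

(** * Element-by-element assembly *)

Lemma weighted_CS (R : realFieldType) (I : Type) (r : seq I) (P : pred I) (x w : I -> R) :
  (forall i, P i -> 0 < w i) ->
  (\sum_(i <- r | P i) x i) ^+ 2 <= (\sum_(i <- r | P i) w i) * (\sum_(i <- r | P i) x i ^+ 2 / w i).
Proof.
move=> w0; elim: r => [|i r IH]; first by rewrite !big_nil expr0n mul0r.
rewrite !big_cons; case: ifP => // Pi.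
have S0 : 0 <= \sum_(j <- r | P j) w j by apply: sumr_ge0 => j /w0 /ltW.
have Q0 : 0 <= \sum_(j <- r | P j) x j ^+ 2 / w j.
  by apply: sumr_ge0 => j /w0 wj; rewrite divr_ge0 ?sqr_ge0// ltW.
move: IH S0 Q0 (w0 i Pi); set X := \sum_(j <- r | P j) x j; set S := \sum_(j <- r | P j) w j.
set Q := \sum_(j <- r | P j) _ => IH S0 Q0 wi.
have E : x i ^+ 2 = w i * (x i ^+ 2 / w i) by field; rewrite gt_eqF.
move: E; set q := x i ^+ 2 / w i => E.
have q0 : 0 <= q by rewrite divr_ge0 ?sqr_ge0// ltW.
have H : 2 * (x i * X) <= w i * Q + S * q.
  have h : (x i * X) ^+ 2 <= (w i * Q) * (S * q).
    rewrite exprMn E (_ : w i * Q * (S * q) = w i * q * (S * Q)); last by ring.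
    by rewrite ler_wpM2l// mulr_ge0// ltW.
  have a0 : 0 <= w i * Q by rewrite mulr_ge0// ltW.
  have b0 : 0 <= S * q by rewrite mulr_ge0.
  move: h a0 b0; move: (x i * X) (w i * Q) (S * q) => z a b h a0 b0.
  rewrite leNgt; apply/negP => lt.
  have : (a + b) ^+ 2 < (2 * z) ^+ 2 by rewrite ltrXn2r// ?nnegrE ?addr_ge0//; lra.
  rewrite exprMn => h2; have := sqr_ge0 (a - b).
  by rewrite sqrrB; move: h2; rewrite sqrrD; lra.
rewrite sqrrD mulrDl !mulrDr -E mulr2n.
by move: IH H; lra.
Qed.

Section PsdSupport.
Variables (R : realType) (n : nat).

Lemma psd_offdiag (M : 'M[R]_n) (x y : 'cV[R]_n) : M^T = M -> psd M ->
  qf M x y *+ 2 <= qf M x x + qf M y y.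
Proof.
move=> MT Mp; have := Mp (x - y); rewrite qfBr !(qf_sym (x - y) _ MT) !qfBr (qf_sym y x MT).
by rewrite mulr2n; lra.
Qed.

(** Each product 2 M_ij x_i x_j is at most M_ii x_i^2 + M_jj x_j^2, and every index of S is paired
    with the #|S| indices of S. *)
Lemma psd_support (M : 'M[R]_n) (S : {set 'I_n}) (x : 'cV[R]_n) : M^T = M -> psd M ->
  (forall i j, i \notin S -> M i j = 0) ->
  qf M x x <= #|S|%:R * \sum_i M i i * x i 0 ^+ 2.
Proof.
move=> MT Mp M0.
have M0' i j : j \notin S -> M i j = 0 by move=> jS; rewrite -MT mxE M0.
have E i j : x i 0 * M i j * x j 0 = qf M (x i 0 *: delta_mx i 0) (x j 0 *: delta_mx j 0).
  by rewrite qfZl qfZr /qf trmx_delta -rowE -colE !mxE; ring.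
rewrite qfE.
have -> : \sum_i \sum_j x i 0 * M i j * x j 0 = \sum_(i in S) \sum_(j in S) x i 0 * M i j * x j 0.
  rewrite [RHS]big_mkcond; apply: eq_bigr => i _; case: ifPn => iS; last first.
    by rewrite big1// => j _; rewrite M0// mulr0 mul0r.
  rewrite [RHS]big_mkcond; apply: eq_bigr => j _; case: ifPn => // jS.
  by rewrite M0'// mulr0 mul0r.
have -> : \sum_i M i i * x i 0 ^+ 2 = \sum_(i in S) M i i * x i 0 ^+ 2.
  rewrite [RHS]big_mkcond; apply: eq_bigr => i _; case: ifPn => // iS.
  by rewrite M0// mul0r.
set s := \sum_(i in S) M i i * _.
have -> : #|S|%:R * s = \sum_(i in S) \sum_(j in S) (M i i * x i 0 ^+ 2 + M j j * x j 0 ^+ 2) / 2.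
  transitivity ((\sum_(i in S) \sum_(j in S) M i i * x i 0 ^+ 2 + \sum_(i in S) \sum_(j in S) M j j * x j 0 ^+ 2) / 2).
    rewrite sumr_const -mulr_natl; under eq_bigr do rewrite sumr_const -mulr_natl.
    by rewrite -mulr_sumr -/s; field.
  rewrite -big_split /= mulr_suml; apply: eq_bigr => i _.
  by rewrite -big_split /= mulr_suml.
apply: ler_sum => i _; apply: ler_sum => j _; rewrite E.
have := psd_offdiag (x i 0 *: delta_mx i 0) (x j 0 *: delta_mx j 0) MT Mp; rewrite -!E mulr2n.
by move: (x i 0) (x j 0) => a b; rewrite !expr2; lra.
Qed.
End PsdSupport.

(* The element-by-element structure of the matrices of a and b: [vd t], [pd t] are the degrees of
   freedom of element [t] and [mt t i] is its contribution to the diagonal of the mass matrix. *)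
Record assembly (R : realType) (nc nv np : nat) (at_ : 'I_nc -> 'M[R]_nv)
    (bt : 'I_nc -> 'M[R]_(np, nv)) (mt : 'I_nc -> 'I_np -> R)
    (vd : 'I_nc -> {set 'I_nv}) (pd : 'I_nc -> {set 'I_np}) (N : nat) (C1 : R) : Prop := Assembly {
  as_sym : forall t, (at_ t)^T = at_ t;
  as_psd : forall t, psd (at_ t);
  as_supp_a : forall t i j, i \notin vd t -> at_ t i j = 0;
  as_supp_bv : forall t i j, j \notin vd t -> bt t i j = 0;
  as_supp_bp : forall t i j, i \notin pd t -> bt t i j = 0;
  as_pos : forall t j, j \in vd t -> 0 < at_ t j j;
  as_card_v : forall t, (#|vd t| <= N)%N;
  as_card_p : forall t, (#|pd t| <= N)%N;
  as_card_t : forall j, (#|[set t | j \in vd t]| <= N)%N;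
  as_cover : forall j, exists t, j \in vd t;
  as_C1 : 0 <= C1;
  as_b : forall t i j, bt t i j ^+ 2 <= C1 * at_ t j j * mt t i;
  as_m : forall t i, 0 <= mt t i;
  as_pin : forall i, exists t j, bt t i j != 0 /\ \sum_t' bt t' i j = bt t i j }.

Section Assembly.
Variables (R : realType) (nc nv np : nat) (at_ : 'I_nc -> 'M[R]_nv).
Variables (bt : 'I_nc -> 'M[R]_(np, nv)) (mt : 'I_nc -> 'I_np -> R).
Variables (vd : 'I_nc -> {set 'I_nv}) (pd : 'I_nc -> {set 'I_np}) (N : nat) (C1 : R).
Hypothesis H : assembly at_ bt mt vd pd N C1.

Let A := \sum_t at_ t.
Let B := \sum_t bt t.
(** Together with [global_schur] and [total_mass], the diagonal entries of the three choices of the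
    matrix D. *)
Definition local_schur i := \sum_t \sum_(j in vd t) bt t i j ^+ 2 / at_ t j j.
Definition global_schur i := \sum_j B i j ^+ 2 / A j j.
Definition total_mass i := \sum_t mt t i.

Let AE i j : A i j = \sum_t at_ t i j.
Proof. by rewrite /A summxE. Qed.
Let BE i j : B i j = \sum_t bt t i j.
Proof. by rewrite /B summxE. Qed.

Lemma assembly_at_ge0 t j : 0 <= at_ t j j.
Proof.
have [jv|jv] := boolP (j \in vd t); first exact/ltW/(as_pos H).
by rewrite (as_supp_a H).
Qed.

Lemma assembly_sym : A^T = A.
Proof. by rewrite /A raddf_sum; apply: eq_bigr => t _; exact: (as_sym H). Qed.

Lemma assembly_psd : psd A.
Proof. by move=> x; rewrite qf_sum sumr_ge0// => t _; exact: (as_psd H). Qed.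

Lemma assembly_pos j : 0 < A j j.
Proof.
have [t jt] := as_cover H j; rewrite AE (bigD1 t)//= ltr_pwDl ?(as_pos H)//.
by apply: sumr_ge0 => t' _; exact: assembly_at_ge0.
Qed.

Lemma assembly_lef : lef A (N%:R *: diagm A).
Proof.
move=> x; rewrite qf_sum qfZ qf_diagm.
apply: (@le_trans _ _ (\sum_t N%:R * \sum_i at_ t i i * x i 0 ^+ 2)).
  apply: ler_sum => t _.
  have h := psd_support x (as_sym H t) (@as_psd _ _ _ _ _ _ _ _ _ _ _ H t) (as_supp_a H (t := t)).
  apply: (le_trans h); clear h.
  apply: ler_wpM2r; last by rewrite ler_nat (as_card_v H).
  by apply: sumr_ge0 => i _; rewrite mulr_ge0 ?sqr_ge0// assembly_at_ge0.
rewrite -mulr_sumr exchange_big /=; apply: ler_wpM2l => //; apply: ler_sum => i _.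
by rewrite -mulr_suml AE.
Qed.

Lemma schur_qf y : qf (B *m invmx (diagm A) *m B^T) y y = \sum_j (\sum_i B i j * y i 0) ^+ 2 / A j j.
Proof.
rewrite -[X in X *m _ *m _]trmxK qf_congr invmx_diag_mx; last first.
  by move=> i; rewrite mxE gt_eqF// assembly_pos.
rewrite qf_diag; apply: eq_bigr => j _; rewrite !mxE.
rewrite (eq_bigr (fun i => B i j * y i 0)); last by move=> i _; rewrite !mxE.
by rewrite mulrC expr2; ring.
Qed.

Lemma global_schurE i : (B *m invmx (diagm A) *m B^T) i i = global_schur i.
Proof.
have -> : (B *m invmx (diagm A) *m B^T) i i =
    qf (B *m invmx (diagm A) *m B^T) (delta_mx i 0) (delta_mx i 0).
  by rewrite /qf trmx_delta -rowE -colE !mxE.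
rewrite schur_qf; apply: eq_bigr => j _; congr (_ ^+ 2 / _).
rewrite (bigD1 i)//= big1 ?addr0 => [|k ki]; first by rewrite mxE !eqxx mulr1.
by rewrite mxE (negPf ki) mulr0.
Qed.

(** For fixed j, weighted Cauchy-Schwarz over the pairs (t, i) with weights a_t(j, j): the weights
    add up to at most N A_jj, because an element has at most N pressure degrees of freedom. *)
Lemma schur_le_local y :
  qf (B *m invmx (diagm A) *m B^T) y y <= N%:R * \sum_i local_schur i * y i 0 ^+ 2.
Proof.
rewrite schur_qf.
apply: (@le_trans _ _ (\sum_j N%:R * \sum_(t | j \in vd t) \sum_i bt t i j ^+ 2 / at_ t j j * y i 0 ^+ 2)).
  apply: ler_sum => j _; rewrite ler_pdivrMr ?assembly_pos//.
  have -> : \sum_i B i j * y i 0 = \sum_(p : 'I_nc * 'I_np | (j \in vd p.1) && (p.2 \in pd p.1))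
      bt p.1 p.2 j * y p.2 0.
    rewrite -(pair_big_dep (fun t => j \in vd t) (fun t i => i \in pd t) (fun t i => bt t i j * y i 0)) /=.
    under eq_bigr do rewrite BE mulr_suml.
    rewrite exchange_big /= [RHS]big_mkcond; apply: eq_bigr => t _; case: ifPn => jt; last first.
      by rewrite big1// => i _; rewrite (as_supp_bv H)// mul0r.
    rewrite [RHS]big_mkcond; apply: eq_bigr => i _; case: ifPn => // it.
    by rewrite (as_supp_bp H)// mul0r.
  apply: (le_trans (@weighted_CS _ _ _ _ _ (fun p => at_ p.1 j j) _)).
    by move=> [t i] /= /andP[jt _]; exact: (as_pos H).
  rewrite -(pair_big_dep (fun t => j \in vd t) (fun t i => i \in pd t) (fun t i => at_ t j j)) /=.
  rewrite -(pair_big_dep (fun t => j \in vd t) (fun t i => i \in pd t)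
    (fun t i => (bt t i j * y i 0) ^+ 2 / at_ t j j)) /= mulrAC; apply: ler_pM.
  - by apply: sumr_ge0 => t _; apply: sumr_ge0 => i _; exact: assembly_at_ge0.
  - apply: sumr_ge0 => t _; apply: sumr_ge0 => i _.
    by rewrite divr_ge0 ?sqr_ge0// assembly_at_ge0.
  - rewrite AE mulr_sumr big_mkcond; apply: ler_sum => t _; case: ifP => _; last first.
      by rewrite mulr_ge0// assembly_at_ge0.
    rewrite sumr_const -[leLHS]mulr_natl ler_wpM2r ?assembly_at_ge0// ler_nat; exact: (as_card_p H).
  - apply: ler_sum => t _; rewrite big_mkcond; apply: ler_sum => i _; case: ifP => _.
      by rewrite exprMn mulrAC.
    by rewrite mulr_ge0 ?divr_ge0 ?sqr_ge0// assembly_at_ge0.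
rewrite -mulr_sumr ler_wpM2l// /local_schur le_eqVlt; apply/orP; left; apply/eqP.
rewrite (exchange_big_dep xpredT) //=.
transitivity (\sum_t \sum_i \sum_(j in vd t) bt t i j ^+ 2 / at_ t j j * y i 0 ^+ 2).
  by apply: eq_bigr => t _; rewrite exchange_big.
rewrite exchange_big /=; apply: eq_bigr => i _; rewrite mulr_suml; apply: eq_bigr => t _.
by rewrite mulr_suml.
Qed.

(** A column j of B has at most N^2 nonzero entries: at most N elements contain j, each with at most
    N pressure degrees of freedom. *)
Lemma schur_le_global y :
  qf (B *m invmx (diagm A) *m B^T) y y <= (N * N)%:R * \sum_i global_schur i * y i 0 ^+ 2.
Proof.
rewrite schur_qf.
apply: (@le_trans _ _ (\sum_j (N * N)%:R * \sum_i B i j ^+ 2 / A j j * y i 0 ^+ 2)).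
  apply: ler_sum => j _.
  pose S := \bigcup_(t in [set t | j \in vd t]) pd t.
  have SN : (#|S| <= N * N)%N.
    apply: (@leq_trans (\sum_(t in [set t | j \in vd t]) #|pd t|)).
      rewrite /S; elim/big_rec2: _ => [|t n U _ IH]; first by rewrite cards0.
      by apply: (leq_trans (leq_card_setU _ _)); rewrite leq_add2l.
    apply: (@leq_trans (\sum_(t in [set t | j \in vd t]) N)).
      by apply: leq_sum => t _; exact: (as_card_p H).
    by rewrite sum_nat_const leq_mul2r (as_card_t H) orbT.
  have BS i : i \notin S -> B i j = 0.
    move=> iS; rewrite BE big1// => t _; have [jt|jt] := boolP (j \in vd t); last exact: (as_supp_bv H).
    apply: (as_supp_bp H); apply: contra iS => it; apply/bigcupP; exists t => //.
    by rewrite inE.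
  have -> : \sum_i B i j * y i 0 = \sum_(i in S) B i j * y i 0.
    rewrite [RHS]big_mkcond; apply: eq_bigr => i _; case: ifPn => // /BS ->.
    by rewrite mul0r.
  have Aj := assembly_pos j.
  rewrite ler_pdivrMr//.
  have := @weighted_CS R _ (index_enum 'I_np) [in S] (fun i => B i j * y i 0) (fun=> 1) (fun _ _ => ltr01).
  move=> /le_trans; apply; rewrite sumr_const -mulrA; apply: ler_pM => //.
  - by apply: sumr_ge0 => i _; rewrite divr1 sqr_ge0.
  - by rewrite ler_nat.
  - rewrite mulr_suml big_mkcond; apply: ler_sum => i _.
    have -> : B i j ^+ 2 / A j j * y i 0 ^+ 2 * A j j = (B i j * y i 0) ^+ 2.
      by field; rewrite gt_eqF.
    by case: ifP => _; rewrite ?divr1// sqr_ge0.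
rewrite -mulr_sumr ler_wpM2l// exchange_big /= ler_sum// => i _.
by rewrite -mulr_suml.
Qed.

Lemma local_le_mass i : local_schur i <= N%:R * C1 * total_mass i.
Proof.
rewrite /local_schur /total_mass mulr_sumr; apply: ler_sum => t _.
apply: (@le_trans _ _ (\sum_(j in vd t) C1 * mt t i)).
  apply: ler_sum => j jt; rewrite ler_pdivrMr ?(as_pos H)//.
  by rewrite mulrAC; exact: (as_b H).
rewrite sumr_const -[leLHS]mulr_natl -mulrA ler_wpM2r ?ler_nat ?(as_card_v H)//.
by rewrite mulr_ge0 ?(as_C1 H) ?(as_m H).
Qed.

(** The estimate [schur_le_local] at a unit vector. *)
Lemma global_le_local i : global_schur i <= N%:R * local_schur i.
Proof.
have := schur_le_local (delta_mx i 0); rewrite (bigD1 i)//= big1 => [|k ki]; last first.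
  by rewrite mxE (negPf ki) expr0n mulr0.
rewrite addr0 mxE !eqxx expr1n mulr1 -global_schurE => /(le_trans _); apply.
by rewrite /qf trmx_delta -rowE -colE !mxE.
Qed.

Lemma local_schur_gt0 i : 0 < local_schur i.
Proof.
have [t [j [bne _]]] := as_pin H i.
have jt : j \in vd t by apply: contraNT bne => jt; rewrite (as_supp_bv H).
have ge0 t' j' : 0 <= bt t' i j' ^+ 2 / at_ t' j' j' by rewrite divr_ge0 ?sqr_ge0 ?assembly_at_ge0.
rewrite /local_schur (bigD1 t)//= ltr_pwDl//; last first.
  by apply: sumr_ge0 => t' _; apply: sumr_ge0.
rewrite (bigD1 j)//= ltr_pwDl//; last by apply: sumr_ge0.
by rewrite divr_gt0 ?(as_pos H)// exprn_even_gt0.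
Qed.

(** Element contributions might cancel in the assembled B; [as_pin] supplies a j for which the
    assembled entry equals the nonzero contribution of a single element. *)
Lemma global_schur_gt0 i : 0 < global_schur i.
Proof.
have [t [j [bne BB]]] := as_pin H i.
rewrite /global_schur (bigD1 j)//= ltr_pwDl//.
  by rewrite divr_gt0 ?assembly_pos// exprn_even_gt0//= BE BB.
by apply: sumr_ge0 => j' _; rewrite divr_ge0 ?sqr_ge0// ltW// assembly_pos.
Qed.

Lemma total_mass_gt0 i : 0 < total_mass i.
Proof.
have [t [j [bne _]]] := as_pin H i; rewrite /total_mass (bigD1 t)//= ltr_pwDl//; last first.
  by apply: sumr_ge0 => t' _; exact: (as_m H).
have := as_b H t i j; rewrite lt_neqAle (as_m H) andbT eq_sym => hb.
apply: contra bne => /eqP m0; move: hb; rewrite m0 mulr0 -[_ == 0]sqrf_eq0 => hb.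
by rewrite eq_le hb sqr_ge0.
Qed.

End Assembly.

(** * The function eta0 *)

Import numFieldNormedType.Exports.
Local Open Scope classical_set_scope.
Local Open Scope ring_scope.

Lemma central_binomial_half n : ('C(n.*2.+2, n.+1) = 2 * 'C(n.*2.+1, n.+1))%N.
Proof.
have h3 : ('C(n.*2.+1, n) = 'C(n.*2.+1, n.+1))%N.
  rewrite -(@bin_sub n.*2.+1 n.+1); last by lia.
  by congr ('C(_, _)); lia.
by rewrite binS h3; lia.
Qed.

Lemma central_binomial_rec n :
  (n.+1 * 'C(n.*2.+2, n.+1) = 2 * n.*2.+1 * 'C(n.*2, n))%N.
Proof.
have := mul_bin_diag n.*2.+1 n; rewrite /= central_binomial_half; lia.
Qed.

Section Eta.
Variable R : realType.

(** Wallis-type induction: each step multiplies the left side by (2n+1)(2n+3) / (2n+2)^2 < 1. *)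
Lemma central_binomial_bound n :
  ('C(n.*2, n)%:R / 4 ^+ n : R) ^+ 2 * n.*2.+1%:R <= 1.
Proof.
elim: n => [|n IH]; first by rewrite bin0 expr0 divr1 expr1n mul1r.
have h : n.+1%:R * 'C(n.*2.+2, n.+1)%:R = 2 * n.*2.+1%:R * 'C(n.*2, n)%:R :> R.
  by rewrite -!natrM central_binomial_rec.
have nn : 0 < (n.+1%:R : R) by rewrite ltr0n.
have -> : 'C(n.+1.*2, n.+1)%:R / 4 ^+ n.+1 =
   ('C(n.*2, n)%:R / 4 ^+ n) * (n.*2.+1%:R / (2 * n.+1%:R)) :> R.
  have -> : 'C(n.+1.*2, n.+1)%:R = 2 * n.*2.+1%:R * 'C(n.*2, n)%:R / n.+1%:R :> R.
    by rewrite -h mulrAC mulfV ?mul1r// gt_eqF.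
  by rewrite exprS; field; rewrite ?gt_eqF ?exprn_gt0//.
set a := _ / 4 ^+ n in IH *; rewrite exprMn.
have -> : a ^+ 2 * (n.*2.+1%:R / (2 * n.+1%:R)) ^+ 2 * n.+1.*2.+1%:R =
  (a ^+ 2 * n.*2.+1%:R) * (n.*2.+1%:R * n.+1.*2.+1%:R / (2 * n.+1%:R) ^+ 2) :> R.
  by field; rewrite gt_eqF.
rewrite -[leRHS]mulr1; apply: ler_pM => //.
- by rewrite mulr_ge0 ?sqr_ge0 ?ler0n.
rewrite ler_pdivrMr ?exprn_gt0 ?mulr_gt0// mul1r -!natrM -natrX ler_nat; lia.
Qed.

(** Both parities reduce to normalized central binomial coefficients: eta0(2n) is the one of order
    n, and eta0(2n+1) the one of order n + 1. *)
Lemma eta0_sqr_bound j : eta0 R j ^+ 2 * j.+1%:R <= 1.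
Proof.
rewrite -(odd_double_half j); case: (odd j); rewrite ?add0n ?add1n.
  set n := j./2.
  have -> : eta0 R n.*2.+1 = 'C(n.+1.*2, n.+1)%:R / 4 ^+ n.+1.
    rewrite /eta0 -doubleS doubleK doubleS central_binomial_half natrM.
    have -> : 4 = 2 ^+ 2 :> R by ring.
    rewrite -exprM.
    have -> : (2 * n.+1 = n.*2.+1.+1)%N by lia.
    by rewrite [in RHS]exprS invfM mulrACA mulfV ?mul1r ?pnatr_eq0.
  apply: le_trans (central_binomial_bound n.+1).
  by apply: ler_wpM2l; [exact: sqr_ge0|rewrite ler_nat; lia].
set n := j./2.
have -> : eta0 R n.*2 = 'C(n.*2, n)%:R / 4 ^+ n.
  rewrite /eta0.
  have -> : (n.*2.+1./2 = n)%N by rewrite /= uphalf_double.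
  have -> : 4 = 2 ^+ 2 :> R by ring.
  by rewrite -exprM mul2n.
exact: central_binomial_bound.
Qed.

Lemma eta0_ge0 j : 0 <= eta0 R j.
Proof. by rewrite /eta0 divr_ge0 ?ler0n ?exprn_ge0. Qed.

Lemma eta0_le_invsqrt j : eta0 R j <= (Num.sqrt (j.+1%:R : R))^-1.
Proof.
have s0 : 0 < Num.sqrt (j.+1%:R : R) by rewrite sqrtr_gt0 ltr0n.
rewrite -[leRHS]mul1r ler_pdivlMr//.
rewrite -[leRHS]sqrtr1 -[eta0 R j]ger0_norm ?eta0_ge0// -sqrtr_sqr -sqrtrM ?sqr_ge0//.
exact/ler_wsqrtr/eta0_sqr_bound.
Qed.

Lemma eqO_of_bound (c : R) (eta : nat -> R) (g : nat -> R) : 0 < c ->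
  (forall m, (1 <= m)%N -> `|eta m| <= c * `|g m|) -> eta =O_\oo g.
Proof.
move=> c0 H; apply/eqO_exP; exists c; first by [].
by exists 1%N => //= m /= m1; exact: H.
Qed.
End Eta.

(** * Lebesgue measure and integration on R^d *)

Section LebRV.
Variable R : realType.

Lemma measurable_preimage_coord n (i : 'I_n) (A : set (measurableTypeR R)) :
  measurable A -> measurable [set x : 'rV[R]_n | A (x 0 i)].
Proof.
move=> mA; have := measurable_coord (R := R) i; move=> /(_ measurableT A mA).
by rewrite setTI.
Qed.

Definition rV_box n (a b : 'rV[R]_n) : set 'rV[R]_n :=
  [set x | forall i, a 0 i < x 0 i < b 0 i].

Lemma measurable_box n (a b : 'rV[R]_n) : measurable (rV_box a b).
Proof.
have -> : rV_box a b = \bigcap_(i in [set: 'I_n]) [set x | `]a 0 i, b 0 i[%classic (x 0 i)].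
  apply/seteqP; split => x /=.
    by move=> H i _ /=; rewrite in_itv /= H.
  by move=> H i; have := H i I; rewrite /= in_itv.
apply: fin_bigcap_measurable; first exact: finite_finset.
by move=> i _; apply: measurable_preimage_coord.
Qed.

Lemma leb_box n (a b : 'rV[R]_n) : (forall i, a 0 i < b 0 i) ->
  leb R n (rV_box a b) = (\prod_i (b 0 i - a 0 i))%:E.
Proof.
elim: n a b => [|n IH] a b ab.
  rewrite big_ord0 /= /dirac indicE mem_set//; by case.
rewrite big_ord_recl /= /leb_succ /pushforward.
have -> : rV_cons (R := R) (n := n) @^-1` rV_box a b =
   `]a 0 ord0, b 0 ord0[%classic `*` rV_box (\row_j a 0 (lift ord0 j)) (\row_j b 0 (lift ord0 j)).
  apply/seteqP; split => -[t y] /=.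
    move=> H; split; first by have := H ord0; rewrite !mxE unlift_none /= in_itv.
    by move=> i; have := H (lift ord0 i); rewrite !mxE liftK.
  rewrite in_itv /= => -[t1 H] i; rewrite mxE; case: (unliftP ord0 i) => [j|] -> //=.
  by have := H j; rewrite !mxE.
rewrite product_measure1E//; last exact: measurable_box.
rewrite IH => [|i]; last by rewrite !mxE.
have := @lebesgue_measure_itv R `]a 0 ord0, b 0 ord0[; rewrite /= lte_fin ab -EFinD => hl.
rewrite EFinM -hl; congr (_ * _)%E; congr (_%:E).
by apply: eq_bigr => i _; rewrite !mxE.
Qed.

Lemma measurable_addr n (v : 'rV[R]_n) : measurable_fun setT (fun x : 'rV[R]_n => x + v).
Proof.
apply: measurable_rV => i.
rewrite [X in measurable_fun _ X](_ : _ = (fun x : 'rV[R]_n => x 0 i + v 0 i)); last first.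
  by apply/funext => x; rewrite /rV_coord mxE.
apply: measurable_funD; first exact: measurable_coord.
exact: measurable_cst.
Qed.

Lemma lebesgue_translate (v : R) (A : set (measurableTypeR R)) : measurable A ->
  lebesgue_measure ([set x | A (x + v)] : set (measurableTypeR R)) = lebesgue_measure A.
Proof.
have mf : measurable_fun [set: measurableTypeR R]
    (fun x : measurableTypeR R => (x + v : measurableTypeR R)).
  by apply: measurable_funD => //; exact: measurable_cst.
pose m : {measure set (measurableTypeR R) -> \bar R} :=
  measure_function_pushforward__canonical__measure_function_Measure lebesgue_measure mf.
move=> mA; apply/esym; apply: (@lebesgue_measure_unique R m) mA => _ [[a b]] _ <-.
rewrite /m /= /pushforward.
have -> : (fun x : measurableTypeR R => x + v) @^-1` `]a, b]%classic = `]a - v, b - v]%classic.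
  by apply/seteqP; split => x; rewrite /= !in_itv /= ltrBlDr lerBrDr.
rewrite !lebesgue_measure_itv /= !lte_fin ltrD2r; case: ifP => //= _.
by rewrite -!EFinD; congr (_%:E); ring.
Qed.

(** The translated measure agrees with the product measure on rectangles, by translation invariance
    in each factor, and a product measure is determined by its values there. *)
Lemma leb_translate n (v : 'rV[R]_n) (A : set 'rV[R]_n) : measurable A ->
  leb R n [set x | A (x + v)] = leb R n A.
Proof.
elim: n v A => [|n IH] v A mA.
  congr (leb R 0 _); apply/seteqP; split => x /=; by rewrite [x + v]thinmx0 [x]thinmx0.
rewrite /= /leb_succ /pushforward.
pose w : 'rV[R]_n := \row_j v 0 (lift ord0 j).
pose sh (p : measurableTypeR R * 'rV[R]_n) : measurableTypeR R * 'rV[R]_n :=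
  (p.1 + v 0 ord0, p.2 + w).
have msh : measurable_fun setT sh.
  apply: measurable_fun_pair.
    by apply: (measurable_funD measurable_fst); exact: measurable_cst.
  exact: measurableT_comp (measurable_addr w) measurable_snd.
pose m : {measure set (measurableTypeR R * 'rV[R]_n) -> \bar R} :=
  measure_function_pushforward__canonical__measure_function_Measure
    (@lebesgue_measure R \x leb R n)%E msh.
have h := @product_measure_unique _ _ _ _ R lebesgue_measure (leb R n) m.
rewrite [RHS]h; last 2 first.
- move=> B C mB mC; rewrite /m /= /pushforward.
  have -> : sh @^-1` (B `*` C) = [set x | B (x + v 0 ord0)] `*` [set y | C (y + w)].
    by apply/seteqP; split.
  have mB' : measurable [set x : measurableTypeR R | B (x + v 0 ord0)].
    have mf : measurable_fun [set: measurableTypeR R]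
        (fun x : measurableTypeR R => (x + v 0 ord0 : measurableTypeR R)).
      by apply: measurable_funD => //; exact: measurable_cst.
    by have := mf measurableT B mB; rewrite setTI.
  have mC' : measurable [set y | C (y + w)].
    by have mf := @measurable_addr n w; have := mf measurableT C mC; rewrite setTI.
  by rewrite product_measure1E// IH//; congr (_ * _)%E; exact: lebesgue_translate.
- exact: measurable_rV_cons_preimage.
rewrite /m /= /pushforward; congr ((_ \x _)%E _).
apply/seteqP; split => -[t y] /=.
  suff -> : rV_cons (t, y) + v = rV_cons (t + v 0 ord0, y + w) by [].
  by apply/rowP => i; rewrite !mxE; case: (unliftP ord0 i) => [j|] -> //=; rewrite !mxE.
suff -> : rV_cons (t, y) + v = rV_cons (t + v 0 ord0, y + w) by [].
by apply/rowP => i; rewrite !mxE; case: (unliftP ord0 i) => [j|] -> //=; rewrite !mxE.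
Qed.

Lemma rV_norm_lt n (x : 'rV[R]_n) (e : R) : 0 < e ->
  (forall i, `|x 0 i| < e) -> `|x| < e.
Proof.
move=> e0 H; rewrite /Num.Def.normr /= mx_normrE; apply: bigmax_lt => // -[i j] _ /=.
by rewrite ord1.
Qed.

Lemma rV_norm_le n (x : 'rV[R]_n) (e : R) : 0 <= e ->
  (forall i, `|x 0 i| <= e) -> `|x| <= e.
Proof.
move=> e0 H; rewrite /Num.Def.normr /= mx_normrE; apply: bigmax_le => // -[i j] _ /=.
by rewrite ord1.
Qed.

Lemma coord_le_norm n (x : 'rV[R]_n) i : `|x 0 i| <= `|x|.
Proof.
rewrite [leRHS]/Num.Def.normr /= mx_normrE.
by apply/bigmax_geP; right => /=; exists (0, i).
Qed.

Lemma rV_nbhsP n (x : 'rV[R]_n) (A : set 'rV[R]_n) : nbhs x A <->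
  exists2 e : R, 0 < e & forall y, `|y - x| < e -> A y.
Proof.
split.
  move/nbhs_ballP => [e /= e0 H]; exists e => // y yx; apply: H.
  by rewrite mx_norm_ball /ball_ /= distrC.
move=> [e e0 H]; apply/nbhs_ballP; exists e => //= y.
by rewrite mx_norm_ball /ball_ /= distrC; exact: H.
Qed.

Lemma rV_openP n (A : set 'rV[R]_n) : open A <->
  forall x, A x -> exists2 e : R, 0 < e & forall y, `|y - x| < e -> A y.
Proof.
split=> [/[swap] x oA Ax|H].
  by apply/rV_nbhsP; exact: open_nbhs_nbhs.
by rewrite openE => x Ax; apply/rV_nbhsP; exact: H.
Qed.

(** The sigma-algebra is generated by the coordinates, so an open set has to be exhibited as a
    countable union of boxes, here with rational centres and half-widths 1 / (k + 1). *)
Lemma rV_open_measurable n (A : set 'rV[R]_n) : open A -> measurable A.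
Proof.
move=> /rV_openP oA.
pose I : Type := ({ffun 'I_n -> rat} * nat)%type.
pose bx (p : I) := rV_box (\row_i (ratr (p.1 i) - p.2.+1%:R^-1) : 'rV[R]_n)
                         (\row_i (ratr (p.1 i) + p.2.+1%:R^-1)).
have -> : A = \bigcup_(p in [set p : I | bx p `<=` A]) bx p.
  apply/seteqP; split => [y Ay|y [p /= pA py]]; last exact: pA.
  have [e e0 H] := oA _ Ay.
  have [k hk] : exists k : nat, k.+1%:R^-1 < e / 2.
    have e2 : 0 < 2 / e by rewrite divr_gt0.
    have h2 : 2 / e < (Num.bound (2 / e)).+1%:R.
      by apply: (lt_le_trans (archi_boundP (ltW e2))); rewrite ler_nat.
    exists (Num.bound (2 / e)); rewrite -[e / 2]invrK invf_div ltf_pV2//.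
    by rewrite posrE (lt_trans _ h2).
  have k0 : 0 < (k.+1%:R^-1 : R) by rewrite invr_gt0 ltr0n.
  have /choice[q hq] (i : 'I_n) : exists q : rat, `|ratr q - y 0 i| < k.+1%:R^-1.
    have [|q] := @rat_in_itvoo R (y 0 i - k.+1%:R^-1) (y 0 i + k.+1%:R^-1); first by rewrite ltrBlDr -addrA ltrDl addr_gt0.
    rewrite in_itv /= => hq; exists q; rewrite ltr_norml.
    by move: (k.+1%:R^-1) hq => dl hq; lra.
  exists ([ffun i => q i], k).
    move=> z /= zb; apply: H; apply: rV_norm_lt => // i.
    have := zb i; have := hq i; rewrite !mxE /= !ffunE ltr_norml => h1 h2.
    by rewrite ltr_norml; move: (k.+1%:R^-1) hk h1 h2 => dl hk h1 h2; lra.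
  move=> i; have := hq i; rewrite !mxE /= !ffunE ltr_norml.
  by move: (k.+1%:R^-1) => dl h1; lra.
rewrite bigcup_mkcond; apply: countable_bigcupT_measurable; first exact: countableP.
by move=> p; case: ifP => // _; exact: measurable_box.
Qed.
End LebRV.

Section Hyperplane.
Variable R : realType.

Lemma measurable_edot n (w : 'rV[R]_n) : measurable_fun [set: 'rV[R]_n] (fun x : 'rV[R]_n => edot x w).
Proof.
apply: measurable_sum => i; apply: measurable_funM; first exact: measurable_coord.
exact: measurable_cst.
Qed.

Lemma measurable_hyperplane n (w : 'rV[R]_n) (c : R) : measurable [set x | edot x w = c].
Proof.
have mf := @measurable_edot n w.
by have := mf measurableT [set c] (measurable_set1 c); rewrite setTI.
Qed.

(** Induction by slices: at a fixed first coordinate the slice is a hyperplane in the remaining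
    ones, unless w is a multiple of the first axis; then the set is a point times the whole
    space. *)
Lemma leb_hyperplane n (w : 'rV[R]_n) (c : R) : w != 0 -> leb R n [set x | edot x w = c] = 0%E.
Proof.
elim: n w c => [|n IH] w c w0; first by rewrite [w]thinmx0 eqxx in w0.
pose w' : 'rV[R]_n := \row_j w 0 (lift ord0 j).
have cE t (y : 'rV[R]_n) : edot (rV_cons (t, y)) w = t * w 0 ord0 + edot y w'.
  rewrite /edot big_ord_recl !mxE unlift_none /=; congr (_ + _).
  by apply: eq_bigr => i _; rewrite !mxE liftK.
have mH := measurable_rV_cons_preimage (measurable_hyperplane w c).
rewrite /= /leb_succ /pushforward.
have [w'0|w'0] := eqVneq w' 0.
  have wn0 : w 0 ord0 != 0.
    apply: contraNneq w0 => h; apply/eqP/rowP => i; rewrite mxE.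
    case: (unliftP ord0 i) => [j|] -> //.
    by have /rowP/(_ j) := w'0; rewrite !mxE.
  have -> : rV_cons (R := R) (n := n) @^-1` [set x | edot x w = c] =
     [set c / w 0 ord0] `*` setT.
    apply/seteqP; split => -[t y] /=; rewrite cE w'0.
      move=> h; split => //; rewrite -h /edot big1 ?addr0 ?mulfK// => i _.
      by rewrite mxE mulr0.
    move=> [-> _]; rewrite divfK// /edot big1 ?addr0// => i _.
    by rewrite mxE mulr0.
  rewrite product_measure1E//.
  by have := lebesgue_measure_set1 (c / w 0 ord0) => h; rewrite [X in (X * _)%E]h mul0e.
rewrite /product_measure1.
rewrite (eq_integral (cst 0%E)) ?integral0// => t _ /=.
rewrite -[RHS](IH w' (c - t * w 0 ord0) w'0); congr (leb R n _).
apply/seteqP; split => y.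
  by rewrite /xsection /= inE /= cE => <-; rewrite addrC addKr.
by rewrite /xsection /= inE /= cE => ->; rewrite addrC subrK.
Qed.

Lemma leb_ball n (x : 'rV[R]_n) (r : R) : 0 < r -> leb R n [set y | `|y - x| < r] = ((2 * r) ^+ n)%:E.
Proof.
move=> r0.
have -> : [set y | `|y - x| < r] = rV_box (\row_i (x 0 i - r)) (\row_i (x 0 i + r)).
  apply/seteqP; split => y /=.
    move=> yx i; have := coord_le_norm (y - x) i; rewrite !mxE => h.
    by have := le_lt_trans h yx; rewrite ltr_norml; lra.
  move=> H; apply: rV_norm_lt => // i; have := H i; rewrite !mxE ltr_norml; lra.
rewrite leb_box; last by move=> i; rewrite !mxE; lra.
rewrite (eq_bigr (fun=> 2 * r)); last by move=> i _; rewrite !mxE; ring.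
by rewrite prodr_const card_ord.
Qed.
End Hyperplane.

(** * Removing null sets from integrals of arbitrary functions *)

Section NegligibleRestriction.
Context d (T : measurableType d) (R : realType) (mu : {measure set T -> \bar R}).
Import HBNNSimple.

(** The supremum by which the integral of a nonnegative function, measurable or not, is defined. *)
Definition simple_lower_integral (f : T -> \bar R) : \bar R :=
  ereal_sup [set sintegral mu h | h in [set h : {nnsfun T >-> R} | forall x, ((h x)%:E <= f x)%E]].

Lemma simple_lower_integral_negligible (N : set T) (f : T -> \bar R) : measurable N -> mu N = 0%E ->
  (forall x, (0 <= f x)%E) -> simple_lower_integral f = simple_lower_integral (f \_ (~` N)).
Proof.
move=> mN N0 f0; apply/eqP; rewrite eq_le; apply/andP; split.
  apply: ge_ereal_sup => /= _ [h /= hf <-].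
  have mNC : measurable (~` N) by exact: measurableC.
  apply: ereal_sup_ubound => /=; exists (proj_nnsfun h mNC).
    move=> x; rewrite /= /patch mindicE.
    by case: ifPn => xN; rewrite ?mulr1 ?mulr0.
  rewrite -!integralT_nnsfun.
  apply: ge0_ae_eq_integral => //.
  - exact/measurable_EFinP.
  - exact/measurable_EFinP.
  - by move=> x _; rewrite lee_fin.
  - by move=> x _; rewrite lee_fin.
  exists N; split => // x /=; rewrite mindicE => hx.
  apply: contrapT => xN; apply: hx => _; rewrite mem_set ?mulr1//.
apply: ge_ereal_sup => /= _ [h /= hf <-].
apply: ereal_sup_ubound => /=; exists h => // x.
by apply: (le_trans (hf x)); rewrite /patch; case: ifP.
Qed.

(** f and D are arbitrary: the forms integrate classical derivatives over Omega, and on element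
    boundaries nothing is known about these, not even measurability. A simple function below f can
    be cut off on N without changing its integral. *)
Lemma integral_setD_negligible (D N : set T) (f : T -> \bar R) : measurable N -> mu N = 0%E ->
  (\int[mu]_(x in D) f x = \int[mu]_(x in D `\` N) f x)%E.
Proof.
move=> mN N0; rewrite /integral.
have patchE (g : T -> \bar R) : g \_ (D `\` N) = (g \_ D) \_ (~` N).
  apply/funext => x; rewrite /patch in_setD in_setC.
  by case: (x \in D) => //=; case: (x \in N).
rewrite patchE -!/(simple_lower_integral _); congr (_ - _)%E.
  by rewrite (simple_lower_integral_negligible mN N0) -?funepos_restrict// => x; rewrite funepos_ge0.
by rewrite (simple_lower_integral_negligible mN N0) -?funeneg_restrict// => x; rewrite funeneg_ge0.
Qed.
End NegligibleRestriction.

(** * Bounded measurable functions on a set of finite measure *)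

Section BoundedMeasurable.
Context d (T : measurableType d) (R : realType) (mu : {measure set T -> \bar R}).
Variables (D : set T) (mD : measurable D) (Dfin : (mu D < +oo)%E).

(** The class of the integrands on an element. It is an algebra of integrable functions, so
    linearity of the integral is available without integrability arguments for each term. *)
Definition bmf (f : T -> R) := measurable_fun D f /\ exists M : R, forall x, D x -> `|f x| <= M.

Lemma bmf_integrable f : bmf f -> mu.-integrable D (EFin \o f).
Proof.
move=> [mf [M fM]]; apply: measurable_bounded_integrable => //.
exists M; split; first exact: num_real.
by move=> x Mx y Dy /=; rewrite (le_trans (fM _ Dy))// ltW.
Qed.

Lemma bmf_cst c : bmf (fun=> c).
Proof. by split; [exact: measurable_cst|exists `|c|]. Qed.

Lemma bmfD f g : bmf f -> bmf g -> bmf (fun x => f x + g x).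
Proof.
move=> [mf [M fM]] [mg [N gN]]; split; first exact: measurable_funD.
exists (M + N) => x Dx; rewrite (le_trans (ler_normD _ _))// lerD ?fM ?gN//.
Qed.

Lemma bmfM f g : bmf f -> bmf g -> bmf (fun x => f x * g x).
Proof.
move=> [mf [M fM]] [mg [N gN]]; split; first exact: measurable_funM.
by exists (M * N) => x Dx; rewrite normrM ler_pM ?fM ?gN.
Qed.

Lemma bmfZ c f : bmf f -> bmf (fun x => c * f x).
Proof. by move=> bf; apply: bmfM => //; exact: bmf_cst. Qed.

Lemma bmfN f : bmf f -> bmf (fun x => - f x).
Proof.
move=> /(bmfZ (-1)); congr bmf; apply/funext => x; exact: mulN1r.
Qed.

Lemma bmfX f n : bmf f -> bmf (fun x => f x ^+ n).
Proof.
move=> bf; elim: n => [|n IH].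
  by rewrite (_ : (fun _ => _) = fun=> 1); [exact: bmf_cst|apply/funext => x; rewrite expr0].
rewrite (_ : (fun _ => _) = fun x => f x * f x ^+ n); first exact: bmfM.
by apply/funext => x; rewrite exprS.
Qed.

Lemma bmf_sum I (r : seq I) (P : pred I) (f : I -> T -> R) : (forall i, P i -> bmf (f i)) ->
  bmf (fun x => \sum_(i <- r | P i) f i x).
Proof.
move=> bf; elim: r => [|i r IH].
  by rewrite (_ : (fun _ => _) = fun=> 0); [exact: bmf_cst|apply/funext => x; rewrite big_nil].
case Pi : (P i).
  rewrite (_ : (fun _ => _) = fun x => f i x + \sum_(j <- r | P j) f j x).
    by apply: bmfD => //; exact: bf.
  by apply/funext => x; rewrite big_cons Pi.
by rewrite (_ : (fun _ => _) = fun x => \sum_(j <- r | P j) f j x)//; apply/funext => x; rewrite big_cons Pi.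
Qed.

Lemma RintD f g : bmf f -> bmf g ->
  \int[mu]_(x in D) (f x + g x) = \int[mu]_(x in D) f x + \int[mu]_(x in D) g x.
Proof. by move=> bf bg; apply: RintegralD => //; exact: bmf_integrable. Qed.

Lemma RintZ c f : bmf f -> \int[mu]_(x in D) (c * f x) = c * \int[mu]_(x in D) f x.
Proof. by move=> bf; apply: RintegralZl => //; exact: bmf_integrable. Qed.

Lemma Rint0 : \int[mu]_(x in D) (0 : R) = 0.
Proof. by rewrite Rintegral_cst// mul0r. Qed.

Lemma Rint_sum I (r : seq I) (P : pred I) (f : I -> T -> R) : (forall i, P i -> bmf (f i)) ->
  \int[mu]_(x in D) (\sum_(i <- r | P i) f i x) = \sum_(i <- r | P i) \int[mu]_(x in D) f i x.
Proof.
move=> bf; elim: r => [|i r IH].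
  by rewrite big_nil -[RHS]Rint0; apply: eq_Rintegral => x _; rewrite big_nil.
rewrite big_cons; case Pi : (P i).
  rewrite -IH -RintD; [|exact: bf|exact: bmf_sum].
  by apply: eq_Rintegral => x _; rewrite big_cons Pi.
by rewrite -IH; apply: eq_Rintegral => x _; rewrite big_cons Pi.
Qed.

Lemma Rint_le f g : bmf f -> bmf g -> (forall x, D x -> f x <= g x) ->
  \int[mu]_(x in D) f x <= \int[mu]_(x in D) g x.
Proof. by move=> bf bg; apply: le_Rintegral => //; exact: bmf_integrable. Qed.

Lemma Rint_ge0 f : (forall x, D x -> 0 <= f x) -> 0 <= \int[mu]_(x in D) f x.
Proof. exact: Rintegral_ge0. Qed.

Lemma Rint_le_bound f M : bmf f -> (forall x, D x -> f x <= M) ->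
  \int[mu]_(x in D) f x <= M * fine (mu D).
Proof.
move=> bf fM; rewrite -Rintegral_cst//; apply: Rint_le => //; exact: bmf_cst.
Qed.

Lemma Rint_CS f g : bmf f -> bmf g ->
  (\int[mu]_(x in D) (f x * g x)) ^+ 2 <=
  (\int[mu]_(x in D) (f x ^+ 2)) * (\int[mu]_(x in D) (g x ^+ 2)).
Proof.
move=> bf bg.
set a := \int[mu]_(x in D) (f x ^+ 2); set b := \int[mu]_(x in D) (f x * g x).
set c := \int[mu]_(x in D) (g x ^+ 2).
have H t : 0 <= t ^+ 2 * a + 2 * t * b + c.
  have : 0 <= \int[mu]_(x in D) ((t ^+ 2 * f x ^+ 2 + 2 * t * (f x * g x)) + g x ^+ 2).
    apply: Rint_ge0 => x _.
    have -> : (t ^+ 2 * f x ^+ 2 + 2 * t * (f x * g x)) + g x ^+ 2 = (t * f x + g x) ^+ 2 by ring.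
    exact: sqr_ge0.
  rewrite RintD; [|apply: bmfD; apply: bmfZ; [exact: bmfX|exact: bmfM]|exact: bmfX].
  rewrite RintD; [|apply: bmfZ; exact: bmfX|apply: bmfZ; exact: bmfM].
  by rewrite RintZ ?RintZ//; [exact: bmfM|exact: bmfX].
have a0 : 0 <= a by apply: Rint_ge0 => x _; exact: sqr_ge0.
have [q0|an0] := eqVneq a 0.
  rewrite q0 mul0r; apply/eqP/negPn/negP => /negPf h.
  have h0 : b != 0 by apply/eqP => h0; move: h; rewrite h0 expr0n/= lexx.
  have := H (- (c + 1) / (2 * b)); rewrite q0 mulr0 add0r.
  have -> : 2 * (- (c + 1) / (2 * b)) * b = - (c + 1) by field.
  by lra.
have ap : 0 < a by rewrite lt_def an0.
have := H (- b / a).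
have -> : (- b / a) ^+ 2 * a + 2 * (- b / a) * b + c = (a * c - b ^+ 2) / a by field.
by rewrite pmulr_lge0 ?invr_gt0// subr_ge0.
Qed.

Lemma Rint_eq0_negligible f : bmf f -> (forall x, D x -> 0 <= f x) ->
  \int[mu]_(x in D) f x = 0 ->
  exists N, [/\ measurable N, mu N = 0%E & forall x, D x -> ~ N x -> f x = 0].
Proof.
move=> bf f0 If0; have fi := bmf_integrable bf.
have : (\int[mu]_(x in D) `|(f x)%:E| = 0)%E.
  rewrite (eq_integral (fun x => (f x)%:E)).
    by rewrite -[LHS]fineK ?integrable_fin_num//; congr (_%:E); exact: If0.
  by move=> x; rewrite inE => Dx; rewrite gee0_abs// lee_fin f0.
move/(ae_eq_integral_abs mu mD (f := EFin \o f)); case.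
  by apply/measurable_EFinP; case: bf.
move=> N [mN N0 sub]; exists N; split => // x Dx Nx.
apply: contrapT => fx; apply: Nx; apply: sub => /= /(_ Dx) []; exact: fx.
Qed.
End BoundedMeasurable.

(** * Integrals of directional derivatives *)

Section DifferenceQuotients.
Variables (R : realType) (V : normedModType R).

Lemma invS_dnbhs0 : (fun k : nat => k.+1%:R^-1 : R) @ \oo --> (0 : R)^'.
Proof.
move=> A /= [e /= e0 H].
have := near_infty_natSinv_lt (PosNum e0); apply: filterS => k /= hk.
apply: H => /=; last by rewrite gt_eqF// invr_gt0.
by rewrite /ball_ /= sub0r normrN ger0_norm// invr_ge0.
Qed.

(** The steps run through the sequence 1 / (k + 1), as limits of measurable functions and dominated
    convergence require. *)
Lemma derivable_quotients (f : V -> R) (a v : V) : derivable f a v ->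
  (fun k : nat => k.+1%:R * (f (a + k.+1%:R^-1 *: v) - f a)) @ \oo --> 'D_v f a.
Proof.
move=> df; have := @cvg_comp _ _ _ (fun k : nat => k.+1%:R^-1 : R)
  (fun h : R => h^-1 *: ((f \o shift a) (h *: v) - f a)) \oo 0^' _ invS_dnbhs0 df.
apply: cvg_trans; apply: near_eq_cvg; apply: nearW => k /=.
by rewrite invrK [a + _]addrC.
Qed.
End DifferenceQuotients.

Section IntegralDerivative.
Variables (R : realType) (n : nat).
Let mu : {measure set 'rV[R]_n -> \bar R} := leb R n.
Let tr (v : 'rV[R]_n) (x : 'rV[R]_n) : 'rV[R]_n := x + v.

Lemma ge0_integral_translate (v : 'rV[R]_n) (g : 'rV[R]_n -> \bar R) :
  measurable_fun setT g -> (forall x, (0 <= g x)%E) ->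
  (\int[mu]_x (g \o tr v) x = \int[mu]_x g x)%E.
Proof.
move=> mg g0; have mv := @measurable_addr R n v.
have := @ge0_integral_pushforward _ _ _ _ R _ mv mu setT g measurableT mg (fun y _ => g0 y).
rewrite preimage_setT /= => <-.
apply: eq_measure_integral => A mA _.
rewrite /= /pushforward; exact: leb_translate.
Qed.

Lemma integral_translate (v : 'rV[R]_n) (g : 'rV[R]_n -> \bar R) :
  measurable_fun setT g -> (\int[mu]_x (g \o tr v) x = \int[mu]_x g x)%E.
Proof.
move=> mg; rewrite integralE [RHS]integralE funepos_comp funeneg_comp.
rewrite (ge0_integral_translate v (measurable_funepos mg)); last by move=> x; rewrite funepos_ge0.
by rewrite (ge0_integral_translate v (measurable_funeneg mg)); last by move=> x; rewrite funeneg_ge0.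
Qed.

Lemma leb_bounded_fin (A : set 'rV[R]_n) (r : R) : measurable A -> 0 < r ->
  (forall y, A y -> `|y| < r) -> (mu A < +oo)%E.
Proof.
move=> mA r0 Ar; have := leb_ball (0 : 'rV[R]_n) r0 => hb.
apply: le_lt_trans (ltry ((2 * r) ^+ n)); rewrite -hb.
apply: le_measure; rewrite ?inE//.
  have -> : [set y : 'rV[R]_n | `|y - 0| < r] = ball 0 r.
    by apply/seteqP; split => y; rewrite mx_norm_ball /ball_ /= distrC.
  by apply: rV_open_measurable; exact: ball_open.
by move=> y /Ar; rewrite /= subr0.
Qed.

Lemma compact_support_integrable (g : 'rV[R]_n -> R) (M r : R) :
  measurable_fun setT g -> 0 < r -> (forall y, `|g y| <= M) ->
  (forall y, r <= `|y| -> g y = 0) -> mu.-integrable setT (EFin \o g).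
Proof.
move=> mg r0 gM gr.
have mB : measurable (ball (0 : 'rV[R]_n) r) by apply: rV_open_measurable; exact: ball_open.
have -> : EFin \o g = (EFin \o g) \_ (ball (0 : 'rV[R]_n) r).
  apply/funext => y; rewrite /patch; case: ifPn => //; rewrite notin_setE.
  rewrite mx_norm_ball /ball_ /= sub0r normrN => /negP; rewrite -leNgt => /gr -> //.
apply: (integrable_mkcond _ mB).1; apply: (@bmf_integrable _ _ R mu _ mB).
  apply: (leb_bounded_fin mB r0) => y; by rewrite mx_norm_ball /ball_ /= sub0r normrN.
split; last by exists M => y _; exact: gM.
exact: measurable_funS mg.
Qed.


(** Translation invariance makes the integral of every difference quotient of f vanish. The
    quotients are bounded by |L| |v| and supported in a fixed ball, and they tend to D_v f on C and
    to 0 off C and N, so dominated convergence applies. In the application C is an element and N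
    contains its boundary. *)
Lemma Rintegral_derivative_eq0 (f : 'rV[R]_n -> R) (v : 'rV[R]_n) (L M r : R) (C N : set 'rV[R]_n) :
  measurable_fun setT f -> (forall y z, `|f y - f z| <= L * `|y - z|) ->
  (forall y, `|f y| <= M) -> 0 < r -> (forall y, r <= `|y| -> f y = 0) ->
  measurable C -> measurable N -> mu N = 0%E ->
  (forall y, C y -> derivable f y v) ->
  (forall y, ~ C y -> ~ N y -> \forall z \near y, f z = 0) ->
  \int[mu]_(x in C) 'D_v f x = 0.
Proof.
move=> mf fL fM r0 fr mC mN N0 fC fN.
pose q k y := k.+1%:R * (f (tr (k.+1%:R^-1 *: v) y) - f y).
have kI k : `|(k.+1%:R^-1 : R)| <= 1.
  by rewrite ger0_norm ?invr_ge0// invf_le1// ler1n.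
have mft k : measurable_fun setT (f \o tr (k.+1%:R^-1 *: v)).
  by apply: measurableT_comp mf _; exact: measurable_addr.
have mq k : measurable_fun setT (q k).
  apply: measurable_funM; first exact: measurable_cst.
  exact: measurable_funB (mft k) mf.
(* All steps have length at most |v|, so f and all its translates vanish beyond this radius. *)
pose rv := r + `|v|.
have rv0 : 0 < rv by rewrite ltr_pwDl.
have tr0 k y : rv <= `|y| -> f (tr (k.+1%:R^-1 *: v) y) = 0.
  move=> yrv; apply: fr; rewrite /tr.
  have h1 : `|k.+1%:R^-1 *: v| <= `|v| by rewrite normrZ ler_piMl.
  have := ler_normB (y + k.+1%:R^-1 *: v) (k.+1%:R^-1 *: v); rewrite addrK.
  by move: (k.+1%:R^-1 *: v) yrv h1 => w; rewrite /rv; lra.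
have y0 y : rv <= `|y| -> f y = 0.
  by move=> h; apply: fr; apply: le_trans h; rewrite lerDl.
have qL k y : `|q k y| <= `|L| * `|v|.
  rewrite /q normrM ger0_norm//.
  apply: (@le_trans _ _ (k.+1%:R * (`|L| * `|k.+1%:R^-1 *: v|))).
    rewrite ler_wpM2l//; apply: (le_trans (fL _ _)).
    by rewrite /tr [y + _]addrC addrK; apply: ler_wpM2r => //; exact: ler_norm.
  by rewrite normrZ ger0_norm ?invr_ge0// mulrCA mulVKf// pnatr_eq0.
have q0 k y : rv <= `|y| -> q k y = 0.
  by move=> h; rewrite /q tr0// y0// subr0 mulr0.
have if_ : mu.-integrable setT (EFin \o f) by exact: compact_support_integrable mf r0 fM fr.
have ift k : mu.-integrable setT (EFin \o (f \o tr (k.+1%:R^-1 *: v))).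
  by apply: (@compact_support_integrable _ M rv (mft k) rv0) => [y|y h] /=; [exact: fM|exact: tr0].
have iq k : (\int[mu]_y (q k y)%:E = 0)%E.
  rewrite (eq_integral (fun y => k.+1%:R%:E * ((EFin \o (f \o tr (k.+1%:R^-1 *: v))) y - (EFin \o f) y))%E) => [|//].
  rewrite integralZl//; last exact: integrableB.
  rewrite integralB//.
  have := @integral_translate (k.+1%:R^-1 *: v) (EFin \o f).
  move=> ->; last exact/measurable_EFinP.
  by rewrite subee ?mule0//; exact: integrable_fin_num.
pose g := ('D_v f) \_ C.
pose G (y : 'rV[R]_n) : R := `|L| * `|v| * \1_(ball (0 : 'rV[R]_n) rv) y.
have mB : measurable (ball (0 : 'rV[R]_n) rv) by apply: rV_open_measurable; exact: ball_open.
have G1 y : `|y| < rv -> G y = `|L| * `|v|.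
  by move=> h; rewrite /G indicE mem_set ?mulr1// mx_norm_ball /ball_ /= sub0r normrN.
have G0 y : rv <= `|y| -> G y = 0.
  move=> h; rewrite /G indicE memNset ?mulr0// mx_norm_ball /ball_ /= sub0r normrN.
  by apply/negP; rewrite -leNgt.
have iG : mu.-integrable setT (EFin \o G).
  apply: (@compact_support_integrable _ (`|L| * `|v|) rv) => //.
    by apply: measurable_funM; [exact: measurable_cst|exact: measurable_indic].
  move=> y; have [yr|yr] := ltP `|y| rv.
    by rewrite G1// ger0_norm// mulr_ge0.
  by rewrite G0// normr0 mulr_ge0.
have Cq y : C y -> q ^~ y @ \oo --> 'D_v f y.
  by move=> Cy; exact: derivable_quotients (fC y Cy).
have mD : measurable_fun C ('D_v f).
  apply: (@measurable_fun_cvg _ _ _ C q) => // k; exact: measurable_funS (mq k).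
have mg : measurable_fun setT g by apply/measurable_restrict => //; rewrite setTI.
have [|||||_ _] := @dominated_convergence _ _ _ mu setT measurableT (fun k => EFin \o q k) (EFin \o g) (EFin \o G).
- by move=> k; exact/measurable_EFinP.
- exact/measurable_EFinP.
- exists N; split => // y /= H; apply: contrapT => Ny; apply: H => _.
  apply: cvg_EFin; first exact: nearW.
  rewrite /g /patch; case: ifPn; rewrite ?inE ?notin_setE => Cy; first exact: Cq.
  have /rV_nbhsP[e e0 He] := fN y Cy Ny.
  apply: cvg_near_cst.
  have ev0 : 0 < e / (`|v| + 1) by rewrite divr_gt0// ltr_wpDl.
  have := near_infty_natSinv_lt (PosNum ev0); apply: filterS => k /= hk.
  have fy : f y = 0 by apply: He; rewrite subrr normr0.
  rewrite /q fy subr0 He ?mulr0// /tr.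
  rewrite [y + _]addrC addrK normrZ ger0_norm ?invr_ge0//.
  apply: (@le_lt_trans _ _ (k.+1%:R^-1 * (`|v| + 1))).
    by rewrite ler_wpM2l ?invr_ge0// lerDl.
  by rewrite -ltr_pdivlMr// ltr_wpDl.
- exact: iG.
- apply: aeW => y k _ /=; rewrite lee_fin.
  have [yr|yr] := ltP `|y| rv; first by rewrite G1// qL.
  by rewrite G0// q0// normr0.
rewrite (_ : [sequence _]_k = fun=> 0%E); last by apply/funext => k; exact: iq.
move=> h0; have h := cvg_unique (@ereal_hausdorff R) h0 (cvg_cst _).
rewrite /Rintegral integral_mkcond -[RHS]/(fine 0%E) -h; congr fine.
apply: eq_integral => y _; rewrite /g /patch /=; by case: ifP.
Qed.
End IntegralDerivative.

(** * Element maps and pull-backs *)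

Section CubeFunctions.
Variables (R : realType) (d : nat).
Implicit Types x y : 'rV[R]_d.

Lemma edotDl x y z : edot (x + y) z = edot x z + edot y z.
Proof. by rewrite /edot -big_split; apply: eq_bigr => i _; rewrite mxE mulrDl. Qed.
Lemma edotDr x y z : edot z (x + y) = edot z x + edot z y.
Proof. by rewrite /edot -big_split; apply: eq_bigr => i _; rewrite mxE mulrDr. Qed.
Lemma edotZl a x z : edot (a *: x) z = a * edot x z.
Proof. by rewrite /edot mulr_sumr; apply: eq_bigr => i _; rewrite mxE mulrA. Qed.
Lemma edotZr a x z : edot z (a *: x) = a * edot z x.
Proof. by rewrite /edot mulr_sumr; apply: eq_bigr => i _; rewrite mxE mulrCA. Qed.
Lemma edotNl x z : edot (- x) z = - edot x z.
Proof. by rewrite -scaleN1r edotZl mulN1r. Qed.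
Lemma edotBl x y z : edot (x - y) z = edot x z - edot y z.
Proof. by rewrite edotDl edotNl. Qed.
Lemma edot0r x : edot x 0 = 0.
Proof. by rewrite -(scale0r (0 : 'rV[R]_d)) edotZr mul0r. Qed.
Lemma edot_delta i x : edot x (delta_mx 0 i) = x 0 i.
Proof.
rewrite /edot (bigD1 i)//= big1 ?addr0; first by rewrite mxE !eqxx mulr1.
by move=> j ji; rewrite mxE (negPf ji) andbF mulr0.
Qed.

Lemma edot_le x y : `|edot x y| <= d%:R * (`|x| * `|y|).
Proof.
apply: (le_trans (ler_norm_sum _ _ _)).
apply: (@le_trans _ _ (\sum_(i < d) `|x| * `|y|)).
  by apply: ler_sum => i _; rewrite normrM ler_pM ?coord_le_norm.
by rewrite sumr_const card_ord mulr_natl.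
Qed.

(* The C^{1,1} functions on the closed reference cube, D being the gradient; K bounds
   everything, which makes the class stable under sums and products. *)
Definition smooth_cube (F : 'rV[R]_d -> R) (D : 'rV[R]_d -> 'rV[R]_d) (K : R) : Prop :=
  [/\ 0 <= K,
      (forall x, ccube x -> `|F x| <= K /\ `|D x| <= K),
      (forall x y, ccube x -> ccube y -> `|F x - F y| <= K * `|x - y| /\ `|D x - D y| <= K * `|x - y|) &
      (forall x y, ccube x -> ccube y -> `|F x - F y - edot (x - y) (D y)| <= K * `|x - y| ^+ 2)].

Lemma smooth_cube_le F D K K' : K <= K' -> smooth_cube F D K -> smooth_cube F D K'.
Proof.
move=> KK' [K0 h1 h2 h3]; split; first exact: le_trans KK'.
- by move=> x cx; have [a b] := h1 x cx; split; apply: le_trans KK'.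
- move=> x y cx cy; have [a b] := h2 x y cx cy.
  by split; [apply: (le_trans a)|apply: (le_trans b)]; rewrite ler_wpM2r.
- move=> x y cx cy; apply: (le_trans (h3 x y cx cy)); rewrite ler_wpM2r// sqr_ge0.
Qed.

Lemma smooth_cst c : smooth_cube (fun=> c) (fun=> 0) `|c|.
Proof.
split => //.
- by move=> x _; rewrite normr0.
- by move=> x y _ _; rewrite !subrr !normr0 mulr_ge0.
- by move=> x y _ _; rewrite subrr edot0r subrr normr0 mulr_ge0// sqr_ge0.
Qed.

Lemma smooth_coord i : smooth_cube (fun x => x 0 i) (fun=> delta_mx 0 i) 1.
Proof.
split => //.
- move=> x cx; have /andP[h1 h2] := cx i; split; first by rewrite ger0_norm.
  apply: rV_norm_le => // j; rewrite mxE; case: (_ && _); rewrite ?normr1 ?normr0//.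
- move=> x y _ _; rewrite subrr normr0 !mul1r; split => //.
  by have := coord_le_norm (x - y) i; rewrite !mxE.
- by move=> x y _ _; rewrite edot_delta !mxE subrr normr0 mulr_ge0// sqr_ge0.
Qed.

Lemma smoothD F D K F' D' K' : smooth_cube F D K -> smooth_cube F' D' K' ->
  smooth_cube (fun x => F x + F' x) (fun x => D x + D' x) (K + K').
Proof.
move=> [K0 h1 h2 h3] [K0' h1' h2' h3']; split; first exact: addr_ge0.
- move=> x cx; have [a b] := h1 x cx; have [a' b'] := h1' x cx.
  by split; apply: (le_trans (ler_normD _ _)); apply: lerD.
- move=> x y cx cy; have [a b] := h2 x y cx cy; have [a' b'] := h2' x y cx cy.
  by split; rewrite opprD addrACA mulrDl; apply: (le_trans (ler_normD _ _)); apply: lerD.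
- move=> x y cx cy; rewrite edotDr mulrDl.
  have -> : F x + F' x - (F y + F' y) - (edot (x - y) (D y) + edot (x - y) (D' y)) =
    (F x - F y - edot (x - y) (D y)) + (F' x - F' y - edot (x - y) (D' y)) by ring.
  by apply: (le_trans (ler_normD _ _)); apply: lerD; [exact: h3|exact: h3'].
Qed.

(** The factor 4 counts the terms in the difference of two gradients of the product. *)
Lemma smoothM F D K F' D' K' : smooth_cube F D K -> smooth_cube F' D' K' ->
  smooth_cube (fun x => F x * F' x) (fun x => F' x *: D x + F x *: D' x) (4 * (K * K')).
Proof.
move=> [K0 h1 h2 h3] [K0' h1' h2' h3'].
have KK : 0 <= K * K' by exact: mulr_ge0.
have k2 (a b : R) : `|a| <= K * K' -> `|b| <= K * K' -> `|a + b| <= 4 * (K * K').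
  by move=> h h'; apply: (le_trans (ler_normD _ _)); lra.
split; first by rewrite mulr_ge0.
- move=> x cx; have [a b] := h1 x cx; have [a' b'] := h1' x cx; split.
    by rewrite normrM; apply: (@le_trans _ _ (K * K')); [exact: ler_pM|lra].
  apply: (le_trans (ler_normD _ _)); rewrite !normrZ.
  have : `|F' x| * `|D x| <= K' * K by exact: ler_pM.
  have : `|F x| * `|D' x| <= K * K' by exact: ler_pM.
  by rewrite [K' * K]mulrC; lra.
- move=> x y cx cy; have [a b] := h2 x y cx cy; have [a' b'] := h2' x y cx cy.
  have [c e] := h1 x cx; have [c' e'] := h1' x cx.
  have [f g] := h1 y cy; have [f' g'] := h1' y cy.
  have n0 : 0 <= `|x - y| by [].
  have m1 : `|F x - F y| * `|F' x| <= K * `|x - y| * K' by exact: ler_pM.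
  have m2 : `|F y| * `|F' x - F' y| <= K * (K' * `|x - y|) by exact: ler_pM.
  have kk : 0 <= K * K' * `|x - y| by rewrite mulr_ge0.
  split.
    have -> : F x * F' x - F y * F' y = (F x - F y) * F' x + F y * (F' x - F' y) by ring.
    by apply: (le_trans (ler_normD _ _)); rewrite !normrM; lra.
  have -> : F' x *: D x + F x *: D' x - (F' y *: D y + F y *: D' y) =
    (F' x *: (D x - D y) + (F' x - F' y) *: D y) + (F x *: (D' x - D' y) + (F x - F y) *: D' y).
    by apply/rowP => i; rewrite !mxE; ring.
  have m3 : `|F' x| * `|D x - D y| <= K' * (K * `|x - y|) by exact: ler_pM.
  have m4 : `|F' x - F' y| * `|D y| <= K' * `|x - y| * K by exact: ler_pM.
  have m5 : `|F x| * `|D' x - D' y| <= K * (K' * `|x - y|) by exact: ler_pM.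
  have m6 : `|F x - F y| * `|D' y| <= K * `|x - y| * K' by exact: ler_pM.
  apply: (le_trans (ler_normD _ _)).
  have := ler_normD (F' x *: (D x - D y)) ((F' x - F' y) *: D y).
  have := ler_normD (F x *: (D' x - D' y)) ((F x - F y) *: D' y).
  by rewrite !normrZ; lra.
- move=> x y cx cy; have [a b] := h2 x y cx cy; have [a' b'] := h2' x y cx cy.
  have [f g] := h1 y cy; have [f' g'] := h1' y cy.
  have t := h3 x y cx cy; have t' := h3' x y cx cy.
  have n0 : 0 <= `|x - y| ^+ 2 by exact: sqr_ge0.
  have kk : 0 <= K * K' * `|x - y| ^+ 2 by rewrite mulr_ge0.
  rewrite edotDr !edotZr.
  have -> : F x * F' x - F y * F' y - (F' y * edot (x - y) (D y) + F y * edot (x - y) (D' y)) =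
    (F x - F y) * (F' x - F' y) + (F' y * (F x - F y - edot (x - y) (D y)) +
    F y * (F' x - F' y - edot (x - y) (D' y))) by ring.
  apply: (le_trans (ler_normD _ _)).
  have := ler_normD (F' y * (F x - F y - edot (x - y) (D y))) (F y * (F' x - F' y - edot (x - y) (D' y))).
  rewrite !normrM.
  have m1 : `|F x - F y| * `|F' x - F' y| <= (K * `|x - y|) * (K' * `|x - y|) by exact: ler_pM.
  have m2 : `|F' y| * `|F x - F y - edot (x - y) (D y)| <= K' * (K * `|x - y| ^+ 2) by exact: ler_pM.
  have m3 : `|F y| * `|F' x - F' y - edot (x - y) (D' y)| <= K * (K' * `|x - y| ^+ 2) by exact: ler_pM.
  by move: m1; rewrite mulrACA -expr2; lra.
Qed.

Definition is_smooth (F : 'rV[R]_d -> R) := exists D K, smooth_cube F D K.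

Lemma is_smooth_sum I (r : seq I) (P : pred I) (F : I -> 'rV[R]_d -> R) :
  (forall i, P i -> is_smooth (F i)) -> is_smooth (fun x => \sum_(i <- r | P i) F i x).
Proof.
move=> sF; elim: r => [|i r [D [K IH]]].
  rewrite (_ : (fun _ => _) = fun=> 0); last by apply/funext => x; rewrite big_nil.
  by exists (fun=> 0), `|(0 : R)|; exact: smooth_cst.
case Pi : (P i).
  have [D' [K' h]] := sF i Pi.
  rewrite (_ : (fun _ => _) = fun x => F i x + \sum_(j <- r | P j) F j x).
    by eexists; eexists; exact: smoothD h IH.
  by apply/funext => x; rewrite big_cons Pi.
rewrite (_ : (fun _ => _) = fun x => \sum_(j <- r | P j) F j x); first by exists D, K.
by apply/funext => x; rewrite big_cons Pi.
Qed.

Lemma is_smoothM F F' : is_smooth F -> is_smooth F' -> is_smooth (fun x => F x * F' x).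
Proof. by move=> [D [K h]] [D' [K' h']]; eexists; eexists; exact: smoothM h h'. Qed.

Lemma is_smooth_cst c : is_smooth (fun=> c).
Proof. by eexists; eexists; exact: smooth_cst. Qed.

Lemma is_smooth_prod I (r : seq I) (P : pred I) (F : I -> 'rV[R]_d -> R) :
  (forall i, P i -> is_smooth (F i)) -> is_smooth (fun x => \prod_(i <- r | P i) F i x).
Proof.
move=> sF; elim: r => [|i r IH].
  rewrite (_ : (fun _ => _) = fun=> 1); last by apply/funext => x; rewrite big_nil.
  exact: is_smooth_cst.
case Pi : (P i).
  rewrite (_ : (fun _ => _) = fun x => F i x * \prod_(j <- r | P j) F j x).
    by apply: is_smoothM => //; exact: sF.
  by apply/funext => x; rewrite big_cons Pi.
rewrite (_ : (fun _ => _) = fun x => \prod_(j <- r | P j) F j x)//.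
by apply/funext => x; rewrite big_cons Pi.
Qed.

Lemma is_smooth_horner (p : {poly R}) i : is_smooth (fun x => p.[x 0 i]).
Proof.
rewrite (_ : (fun _ => _) = fun x => \sum_(j < size p) p`_j * \prod_(k < j) x 0 i).
  apply: is_smooth_sum => j _; apply: is_smoothM; first exact: is_smooth_cst.
  by apply: is_smooth_prod => k _; exists (fun=> delta_mx 0 i), 1; exact: smooth_coord.
by apply/funext => x; rewrite horner_coef; apply: eq_bigr => j _; rewrite prodr_const card_ord.
Qed.
End CubeFunctions.

(* The exact secant matrices of an element map: [T x - T y = (x - y) J(x, y)], with [J(y, y)] the
   Jacobian at [y].  For bilinear [T], [J(x, y)] is the Jacobian at the point [(y_0, x_1)]. *)
Record secant_map (R : realType) (d : nat) (T : 'rV[R]_d -> 'rV[R]_d)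
    (J : 'rV[R]_d -> 'rV[R]_d -> 'M[R]_d) (kap Lam : R) : Prop := SecantMap {
  sm_kap : 0 < kap;
  sm_Lam : 0 < Lam;
  sm_cont : continuous T;
  sm_secant : forall x y, T x - T y = (x - y) *m J x y;
  sm_face : forall (x y : 'rV[R]_d) i, x 0 i = y 0 i -> T x - T y = (x - y) *m J y y;
  sm_unit : forall x y : 'rV[R]_d, ccube x -> ccube y -> J x y \in unitmx;
  sm_inv : forall (x y w : 'rV[R]_d), ccube x -> ccube y -> `|w *m invmx (J x y)| <= kap * `|w|;
  sm_J : forall (x y w : 'rV[R]_d), ccube x -> ccube y -> `|w *m J x y| <= Lam * `|w|;
  sm_lip : forall (x y w : 'rV[R]_d), ccube x -> ccube y ->
    `|w *m (J x y - J y y)| <= Lam * (`|x - y| * `|w|);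
  sm_cross : forall (x : 'rV[R]_d) (rho : R) (u : 'rV[R]_d),
    (forall i t, `|t| <= rho -> cube R d (x + t *: delta_mx 0 i)) ->
    (forall i, `|u 0 i| <= rho / 2) -> (T @` cube R d) (T x + u *m J x x) }.

Section SecantMap.
Variables (R : realType) (d : nat) (T : 'rV[R]_d -> 'rV[R]_d).
Variables (J : 'rV[R]_d -> 'rV[R]_d -> 'M[R]_d) (kap Lam : R).
Hypothesis sm : secant_map T J kap Lam.
Let cel := T @` cube R d.

Lemma cube_ccube (x : 'rV[R]_d) : cube R d x -> ccube x.
Proof. by move=> cx i; have /andP[h1 h2] := cx i; rewrite !ltW. Qed.

Lemma sm_inverse_lip x y : ccube x -> ccube y -> `|x - y| <= kap * `|T x - T y|.
Proof.
move=> cx cy.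
have -> : x - y = (T x - T y) *m invmx (J x y).
  by rewrite (sm_secant sm) mulmxK// (sm_unit sm).
exact: (sm_inv sm).
Qed.

Lemma sm_inj x y : ccube x -> ccube y -> T x = T y -> x = y.
Proof.
move=> cx cy h; have := sm_inverse_lip cx cy; rewrite h subrr normr0 mulr0.
by rewrite normr_le0 subr_eq0 => /eqP.
Qed.

Lemma sm_lipschitz x y : ccube x -> ccube y -> `|T x - T y| <= Lam * `|x - y|.
Proof. by move=> cx cy; rewrite (sm_secant sm); exact: (sm_J sm). Qed.

Lemma cube_room (x : 'rV[R]_d) : cube R d x -> exists2 rho : R, 0 < rho &
  forall i t, `|t| <= rho -> cube R d (x + t *: delta_mx 0 i).
Proof.
move=> cx; pose m := \big[Order.min/1]_i Order.min (x 0 i) (1 - x 0 i).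
have m0 : 0 < m.
  by apply: lt_bigmin => // i _; have := cx i; rewrite lt_min subr_gt0.
exists (m / 2); first by rewrite divr_gt0.
move=> i t ht j; rewrite !mxE eqxx /=.
have mi : m <= Order.min (x 0 j) (1 - x 0 j) by exact: bigmin_le_cond.
move: mi; rewrite le_min => /andP[h1 h2]; have := cx j.
by case: (j == i); rewrite ?mulr0 ?addr0// mulr1; move: ht; rewrite ler_norml; lra.
Qed.

(** Openness of the image comes from [sm_cross]: T x + u J(x, x) lies in the element as soon as the
    coordinates of u are at most half the room around x. This field is verified by affinity or, for
    bilinear maps, by convexity of the element. *)
Lemma sm_cell_nbhd x : cube R d x ->
  exists2 e : R, 0 < e & forall y, `|y - T x| < e -> cel y.
Proof.
move=> cx; have [rho rho0 hrho] := cube_room cx.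
have k0 := sm_kap sm.
exists (rho / 2 / kap); first by rewrite !divr_gt0.
move=> y hy; have cc := cube_ccube cx.
pose u := (y - T x) *m invmx (J x x).
have -> : y = T x + u *m J x x by rewrite /u mulmxKV ?(sm_unit sm)// addrC subrK.
apply: (sm_cross sm hrho) => i; apply: (le_trans (coord_le_norm _ _)).
apply: (le_trans (sm_inv sm _ cc cc)).
by rewrite mulrC -ler_pdivlMr// ltW.
Qed.

Lemma sm_open : open cel.
Proof. by apply/rV_openP => _ [x cx <-]; exact: sm_cell_nbhd. Qed.

Lemma sm_measurable : measurable cel.
Proof. by apply: rV_open_measurable; exact: sm_open. Qed.

Definition center : 'rV[R]_d := const_mx (1 / 2).

Lemma cube_center : cube R d center.
Proof. by move=> i; rewrite mxE; lra. Qed.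

(** Around the centre of the cube the room 1/4 is available along the axes, so u may have size 1/8,
    and u is at most kap times the distance of y from the image of the centre. *)
Lemma sm_contains_ball y : `|y - T center| < (8 * kap)^-1 -> cel y.
Proof.
move=> hy; have cc := cube_ccube cube_center; have k0 := sm_kap sm.
pose u := (y - T center) *m invmx (J center center).
have -> : y = T center + u *m J center center by rewrite /u mulmxKV ?(sm_unit sm)// addrC subrK.
apply: (@sm_cross _ _ _ _ _ _ sm _ (1 / 4)) => i.
  move=> t ht j; rewrite !mxE eqxx /=; move: ht; rewrite ler_norml.
  by case: (j == i); rewrite ?mulr0 ?addr0// ?mulr1; lra.
apply: (le_trans (coord_le_norm _ _)); apply: (le_trans (sm_inv sm _ cc cc)).
have -> : 1 / 4 / 2 = kap * (8 * kap)^-1 :> R by field; lra.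
by rewrite ler_pM2l// ltW.
Qed.

Lemma ccube_dist (x y : 'rV[R]_d) : ccube x -> ccube y -> `|x - y| <= 1.
Proof.
move=> cx cy; apply: rV_norm_le => // i; rewrite !mxE ler_norml.
by have := cx i; have := cy i; lra.
Qed.

Lemma sm_diameter x y : ccube x -> ccube y -> `|T x - T y| <= Lam.
Proof.
move=> cx cy; apply: (le_trans (sm_lipschitz cx cy)).
by rewrite ler_piMr ?(ltW (sm_Lam sm))// ccube_dist.
Qed.

Lemma ccube_compact : compact (@ccube R d).
Proof.
have -> : @ccube R d = [set v : 'rV[R]_d | forall i, `[0, 1]%classic (v 0 i)].
  by apply/seteqP; split => x /= h i; have := h i; rewrite /= in_itv.
by apply: (@rV_compact R d (fun=> `[0, 1]%classic)) => i; exact: segment_compact.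
Qed.

(** One inclusion is compactness of the closed cube; for the other, a point of the closed cube is
    moved slightly towards the centre. *)
Lemma sm_closure : closure cel = T @` @ccube R d.
Proof.
have k0 := sm_kap sm; have L0 := sm_Lam sm.
apply/seteqP; split.
  have cl : closed (T @` @ccube R d).
    apply: compact_closed; first exact: norm_hausdorff.
    apply: continuous_compact ccube_compact.
    exact: continuous_subspaceT (sm_cont sm).
  rewrite [X in _ `<=` X](closure_id _).1//; apply: closure_subset => _ [x cx <-].
  by exists x => //; exact: cube_ccube.
move=> _ [x cx <-] B /rV_nbhsP[e e0 He].
pose t := Order.min (1 / 2) (e / (2 * Lam)).
have t0 : 0 < t by rewrite lt_min !divr_gt0 ?mulr_gt0.
have t1 : t <= 1 / 2 by rewrite ge_min lexx.
have t2 : t <= e / (2 * Lam) by rewrite ge_min lexx orbT.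
pose z : 'rV[R]_d := x + t *: (center - x).
have cz : cube R d z.
  by move=> i; rewrite !mxE; have := cx i => /andP[h1 h2]; apply/andP; split; nra.
exists (T z); split; first by exists z.
apply: He; apply: le_lt_trans (sm_lipschitz (cube_ccube cz) cx) _.
rewrite /z [x + _]addrC addrK normrZ gtr0_norm//.
apply: (@le_lt_trans _ _ (Lam * t)).
  rewrite ler_pM2l// ler_piMr ?(ltW t0)// ccube_dist//; exact: cube_ccube cube_center.
apply: (@le_lt_trans _ _ (Lam * (e / (2 * Lam)))); first by rewrite ler_pM2l.
have -> : Lam * (e / (2 * Lam)) = e / 2 by field; lra.
lra.
Qed.

(** By [sm_face], the image of a facet x_i = b lies in the hyperplane through the image of the facet
    midpoint [y i b] whose normal [w i b] is the i-th column of the inverse Jacobian there. *)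
Lemma sm_skeleton_negligible : exists N, [/\ measurable N, leb R d N = 0%E &
  (T @` @ccube R d) `\` cel `<=` N].
Proof.
pose y (i : 'I_d) (b : bool) : 'rV[R]_d := \row_j (if j == i then b%:R else 1 / 2).
have cy i b : ccube (y i b).
  by move=> j; rewrite mxE; case: (j == i); case: b => /=; lra.
pose w i b : 'rV[R]_d := \row_j (invmx (J (y i b) (y i b))) j i.
have wE i b (z : 'rV[R]_d) : edot z (w i b) = (z *m invmx (J (y i b) (y i b))) 0 i.
  by rewrite /edot mxE; apply: eq_bigr => j _; rewrite mxE.
have w0 i b : w i b != 0.
  apply/eqP => h.
  have := wE i b (row i (J (y i b) (y i b))).
  rewrite h edot0r -row_mul mulmxV ?(sm_unit sm)// !mxE eqxx => /eqP.
  by rewrite eq_sym oner_eq0.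
pose H (p : 'I_d * bool) := [set z : 'rV[R]_d | edot z (w p.1 p.2) = edot (T (y p.1 p.2)) (w p.1 p.2)].
have [mN N0] : measurable (\big[setU/set0]_p H p) /\ leb R d (\big[setU/set0]_p H p) = 0%E.
  elim/big_ind : _ => [|A B [mA A0] [mB B0]|p _].
  - by split; [exact: measurable0|exact: measure0].
  - by split; [exact: measurableU|rewrite null_set_setU].
  - by split; [exact: measurable_hyperplane|exact: leb_hyperplane].
exists (\big[setU/set0]_p H p); split => //.
move=> _ [[x cx <-] nx].
have [i [b xib]] : exists i (b : bool), x 0 i = b%:R.
  apply: contrapT => h; apply: nx; exists x => // i.
  have /andP[h1 h2] := cx i; rewrite !lt_neqAle h1 h2 !andbT.
  apply/andP; split; apply/eqP => h3; apply: h; exists i.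
    by exists false.
  by exists true.
rewrite -bigcup_seq /=; exists (i, b) => /=; first by rewrite mem_index_enum.
apply/eqP; rewrite -subr_eq0 -edotBl wE.
rewrite (@sm_face _ _ _ _ _ _ sm _ _ i) ?mulmxK ?(sm_unit sm)//.
  by rewrite !mxE eqxx xib subrr.
by rewrite mxE eqxx.
Qed.
End SecantMap.

Lemma cvg_dnbhs_linear (R : realType) (q : R -> R) (l C h0 : R) : 0 <= C -> 0 < h0 ->
  (forall h, h != 0 -> `|h| < h0 -> `|q h - l| <= C * `|h|) -> q @ (0 : R)^' --> l.
Proof.
move=> C0 h00 H; apply/cvgrPdist_lt => e e0.
exists (Order.min h0 (e / (C + 1))) => /=.
  by rewrite lt_min h00 divr_gt0// ltr_wpDl.
move=> h /=; rewrite sub0r normrN lt_min => /andP[h1 h2] hn0.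
rewrite distrC; apply: (le_lt_trans (H h hn0 h1)).
apply: (@le_lt_trans _ _ ((C + 1) * `|h|)); first by rewrite ler_wpM2r// lerDl.
by rewrite mulrC -ltr_pdivlMr// ltr_wpDl.
Qed.

Lemma continuous_on_open_measurable (R : realType) d (A : set 'rV[R]_d) (f : 'rV[R]_d -> R) :
  open A ->
  (forall x e, A x -> 0 < e -> exists2 del : R, 0 < del &
     forall y, `|y - x| < del -> A y -> `|f y - f x| < e) -> measurable_fun A f.
Proof.
move=> oA cf; apply: (measurability _ (RGenOInfty.measurableE R)).
move=> _ [_ [a ->] <-]; apply: rV_open_measurable; apply/rV_openP => x [Ax].
rewrite /= in_itv /= andbT => fx.
have [e1 e10 H1] := (rV_openP A).1 oA x Ax.
have fxa : 0 < f x - a by rewrite subr_gt0.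
have [e2 e20 H2] := cf x _ Ax fxa.
exists (Order.min e1 e2); first by rewrite lt_min e10.
move=> y; rewrite lt_min => /andP[y1 y2]; split; first exact: H1.
by have := H2 y y2 (H1 y y1); rewrite /= in_itv /= andbT ltr_norml; lra.
Qed.

(** * Chain rule and extension by zero on one element *)

Section PullBack.
Variables (R : realType) (d : nat) (T : 'rV[R]_d -> 'rV[R]_d).
Variables (J : 'rV[R]_d -> 'rV[R]_d -> 'M[R]_d) (kap Lam : R).
Hypothesis sm : secant_map T J kap Lam.
Let cel := T @` cube R d.
Variables (F : 'rV[R]_d -> R) (D : 'rV[R]_d -> 'rV[R]_d) (K : R).
Hypothesis sF : smooth_cube F D K.
Variable (f : 'rV[R]_d -> R).
Hypothesis fT : forall x, cube R d x -> f (T x) = F x.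

Let K0 : 0 <= K. Proof. by case: sF. Qed.

(** Let z be the preimage of T x + h v. The secant identity h v = (z - x) J(z, x) gives z - x = h u
    up to an error E quadratic in z - x, and |z - x| = O(h) by the inverse Lipschitz bound. *)
Lemma pullback_derivative x v : cube R d x ->
  derivable f (T x) v /\ 'D_v f (T x) = edot (v *m invmx (J x x)) (D x).
Proof.
move=> cx; have cc := cube_ccube cx.
have [e e0 He] := sm_cell_nbhd sm cx.
have k0 := sm_kap sm; have L0 := sm_Lam sm.
set u := v *m invmx (J x x).
pose c := d%:R * (kap * (Lam * K)) + K.
have c0 : 0 <= c.
  by rewrite addr_ge0// !mulr_ge0 ?(ltW k0) ?(ltW L0).
suff lim : (fun h : R => h^-1 *: ((f \o shift (T x)) (h *: v) - f (T x))) @ (0 : R)^' --> edot u (D x).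
  split; first by apply/cvg_ex; exists (edot u (D x)).
  exact/cvg_lim.
apply: (@cvg_dnbhs_linear _ _ _ (c * (kap * `|v|) ^+ 2) (e / (`|v| + 1))).
- by rewrite mulr_ge0// sqr_ge0.
- by rewrite divr_gt0// ltr_wpDl.
move=> h hn0 hh.
have hve : `|h *: v| < e.
  rewrite normrZ; apply: (@le_lt_trans _ _ (`|h| * (`|v| + 1))).
    by rewrite ler_wpM2l// lerDl.
  by rewrite -ltr_pdivlMr// ltr_wpDl.
have [z cz Tz] : cel (h *: v + T x) by apply: He; rewrite addrK.
have ccz := cube_ccube cz.
have zx : `|z - x| <= kap * (`|h| * `|v|).
  by have := sm_inverse_lip sm ccz cc; rewrite Tz addrK normrZ.
rewrite /= -Tz !fT// .
(* The cost of replacing the secant matrix J(z, x) by the Jacobian J(x, x). *)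
pose E := (z - x) *m (J z x - J x x) *m invmx (J x x).
have zE : z - x = h *: u - E.
  have hv : h *: v = (z - x) *m J z x by rewrite -(sm_secant sm) Tz addrK.
  rewrite /E /u scalemxAl hv -mulmxBl mulmxBr subKr.
  by rewrite mulmxK ?(sm_unit sm).
have Eb : `|E| <= kap * (Lam * (`|z - x| * `|z - x|)).
  apply: (le_trans (sm_inv sm _ cc cc)); rewrite ler_pM2l//.
  exact: (sm_lip sm).
have [_ Fb _ Fq] := sF.
have [_ Db] := Fb _ cc.
have q := Fq _ _ ccz cc.
have main : `|F z - F x - h * edot u (D x)| <= c * `|z - x| ^+ 2.
  have -> : F z - F x - h * edot u (D x) = (F z - F x - edot (z - x) (D x)) - edot E (D x).
    by rewrite [in edot (z - x)]zE edotBl edotZl; ring.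
  apply: (le_trans (ler_normB _ _)); rewrite /c mulrDl addrC; apply: lerD => //.
  apply: (le_trans (edot_le _ _)); rewrite -!mulrA ler_wpM2l//.
  apply: (@le_trans _ _ (kap * (Lam * (`|z - x| * `|z - x|)) * K)); first exact: ler_pM.
  by rewrite expr2 le_eqVlt; apply/orP; left; apply/eqP; ring.
have -> : h^-1 *: (F z - F x) - edot u (D x) = h^-1 * (F z - F x - h * edot u (D x)).
  by rewrite -[h^-1 *: _]/(h^-1 * _) [RHS]mulrBr mulKf.
rewrite normrM normfV mulrC ler_pdivrMr ?normr_gt0//.
apply: (le_trans main).
have -> : c * (kap * `|v|) ^+ 2 * `|h| * `|h| = c * (kap * (`|h| * `|v|)) ^+ 2 by ring.
apply: ler_wpM2l => //; rewrite lerXn2r// nnegrE// mulr_ge0 ?(ltW k0)// mulr_ge0.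
Qed.

Lemma pullback_derivative_bound x v : cube R d x -> `|'D_v f (T x)| <= d%:R * (kap * `|v| * K).
Proof.
move=> cx; have cc := cube_ccube cx; have [_ ->] := pullback_derivative v cx.
have [_ Fb _ _] := sF; have [_ Db] := Fb _ cc.
apply: (le_trans (edot_le _ _)); rewrite ler_wpM2l//; apply: ler_pM => //.
exact: (sm_inv sm).
Qed.

Lemma pullback_lip x y : cube R d x -> cube R d y -> `|f (T x) - f (T y)| <= K * kap * `|T x - T y|.
Proof.
move=> cx cy; rewrite !fT//; have [_ _ Fl _] := sF.
have [h _] := Fl _ _ (cube_ccube cx) (cube_ccube cy).
apply: (le_trans h); rewrite -mulrA ler_wpM2l//.
exact: (sm_inverse_lip sm (cube_ccube cx) (cube_ccube cy)).
Qed.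

Lemma pullback_bound x : cube R d x -> `|f (T x)| <= K.
Proof. by move=> cx; rewrite fT//; have [_ h _ _] := sF; have [] := h _ (cube_ccube cx). Qed.

Lemma pullback_measurable : measurable_fun cel f.
Proof.
apply: continuous_on_open_measurable; first exact: (sm_open sm).
move=> _ e [x cx <-] e0.
have k0 : 0 <= K * kap by rewrite mulr_ge0// ltW// (sm_kap sm).
exists (e / (K * kap + 1)); first by rewrite divr_gt0// ltr_wpDl.
move=> w h [y cy Ty]; rewrite -Ty in h *.
apply: (le_lt_trans (pullback_lip cy cx)).
apply: (@le_lt_trans _ _ ((K * kap + 1) * `|T y - T x|)).
  by rewrite ler_wpM2r// lerDl.
by rewrite mulrC -ltr_pdivlMr// ltr_wpDl.
Qed.
End PullBack.

Section PullBackExtension.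
Variables (R : realType) (d : nat) (T : 'rV[R]_d -> 'rV[R]_d).
Variables (J : 'rV[R]_d -> 'rV[R]_d -> 'M[R]_d) (kap Lam : R).
Hypothesis sm : secant_map T J kap Lam.
Let cel := T @` cube R d.
Variables (F : 'rV[R]_d -> R) (D : 'rV[R]_d -> 'rV[R]_d) (K : R).
Hypothesis sF : smooth_cube F D K.
Variable (f : 'rV[R]_d -> R).
Hypothesis fT : forall x, cube R d x -> f (T x) = F x.
Let g := f \_ cel.

Let K0 : 0 <= K. Proof. by case: sF. Qed.

Lemma patch_cell x : cube R d x -> g (T x) = F x.
Proof. by move=> cx; rewrite /g /patch mem_set ?fT//; exists x. Qed.

Lemma patch_derivative y v : cel y -> derivable g y v /\ 'D_v g y = 'D_v f y.
Proof.
move=> [x cx <-]; have [h1 h2] := pullback_derivative sm sF patch_cell v cx.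
by have [_ h3] := pullback_derivative sm sF fT v cx; rewrite h2 h3.
Qed.

Lemma patch_measurable : measurable_fun setT g.
Proof.
apply/measurable_restrict => //; first exact: (sm_measurable sm).
by rewrite setTI; exact: (pullback_measurable sm sF fT).
Qed.

(** The derivative is a limit of difference quotients of the extension g, which is measurable on the
    whole space; nothing is known about f off the element. *)
Lemma pullback_derivative_measurable v : measurable_fun cel ('D_v f).
Proof.
have mg := patch_measurable.
pose q k (y : 'rV[R]_d) : R := k.+1%:R * ((g (y + k.+1%:R^-1 *: v)) - g y).
have mq k : measurable_fun cel (q k).
 apply: measurable_funM; first exact: measurable_cst.
  apply: measurable_funB; last exact: measurable_funS mg.
  have h : measurable_fun setT (g \o (fun y : 'rV[R]_d => y + k.+1%:R^-1 *: v)).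
    by apply: measurableT_comp mg _; exact: measurable_addr.
  exact: measurable_funS h.
apply: (@measurable_fun_cvg _ _ _ cel q) => // y cy.
by have [h <-] := patch_derivative v cy; exact: derivable_quotients h.
Qed.

(** The supremum of the parameters at which the segment from y to z is in the open element gives a
    point of the closure outside the element, i.e. the image of a boundary point of the cube. It
    serves to compare g on the two sides of the boundary. *)
Lemma exit_point (y z : 'rV[R]_d) : cel y -> ~ cel z ->
  exists2 x, ccube x /\ ~ cube R d x & `|y - T x| <= `|y - z|.
Proof.
move=> cy cz; pose p (s : R) := y + s *: (z - y).
have pd s t : `|p s - p t| = `|s - t| * `|z - y|.
  by rewrite /p opprD addrACA subrr add0r -scalerBl normrZ.
pose S : set R := [set s | 0 <= s <= 1 /\ cel (p s)].
have S0 : S 0 by split; rewrite ?lexx ?ler01// /p scale0r addr0.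
have hS : has_sup S.
  by split; [exists 0|exists 1 => s [/andP[]]].
pose s := sup S.
have s0 : 0 <= s by exact: (ub_le_sup hS.2 S0).
have s1 : s <= 1 by apply: ge_sup; [exists 0|move=> t [/andP[]]].
have nz : 0 < `|z - y| + 1 by rewrite ltr_wpDl.
have clp : closure cel (p s).
  move=> B /rV_nbhsP[e e0 He].
  have e' : 0 < e / (`|z - y| + 1) by rewrite divr_gt0.
  have [t [t01 ct] ts] := sup_adherent e' hS.
  have tle : t <= s by apply: ub_le_sup => //; exact: hS.2.
  exists (p t); split => //; apply: He; rewrite pd.
  apply: (@le_lt_trans _ _ (`|t - s| * (`|z - y| + 1))); first by rewrite ler_wpM2l// lerDl.
  by rewrite -ltr_pdivlMr// ltr_norml; move: ts tle e'; rewrite -/s; lra.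
have ncp : ~ cel (p s).
  move=> cps.
  have s1' : s < 1.
    rewrite lt_neqAle s1 andbT; apply/eqP => s1'; apply: cz.
    by move: cps; rewrite s1' /p scale1r addrC subrK.
  have [e e0 He] := (rV_openP cel).1 (sm_open sm) _ cps.
  have e' : 0 < e / (`|z - y| + 1) by rewrite divr_gt0.
  pose t := s + Order.min (1 - s) (e / (`|z - y| + 1) / 2).
  have m0 : 0 < Order.min (1 - s) (e / (`|z - y| + 1) / 2).
    by rewrite lt_min subr_gt0 s1' divr_gt0.
  have m1 : Order.min (1 - s) (e / (`|z - y| + 1) / 2) <= 1 - s by rewrite ge_min lexx.
  have m2 : Order.min (1 - s) (e / (`|z - y| + 1) / 2) <= e / (`|z - y| + 1) / 2.
    by rewrite ge_min lexx orbT.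
  have : t <= s.
    apply: ub_le_sup; first exact: hS.2.
    split; first by apply/andP; rewrite /t; split; lra.
    apply: He; rewrite pd /t addrC addKr gtr0_norm//.
    apply: (@le_lt_trans _ _ (e / (`|z - y| + 1) / 2 * (`|z - y| + 1))).
      by apply: ler_pM => //; [exact: ltW|rewrite lerDl].
    by rewrite mulrAC divfK ?gt_eqF//; lra.
  by rewrite /t; lra.
move: clp; rewrite (sm_closure sm) => -[x cx Tx].
exists x; first by split => // cx'; apply: ncp; exists x.
rewrite Tx; have := pd 0 s; rewrite {1}/p scale0r addr0 sub0r normrN => ->.
by rewrite (ger0_norm s0) [`|y - z|]distrC ler_piMl.
Qed.

Hypothesis F0 : forall x, ccube x -> ~ cube R d x -> F x = 0.

Lemma patch_lip y z : `|g y - g z| <= K * kap * `|y - z|.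
Proof.
have k0 := sm_kap sm.
have out a b : cel a -> ~ cel b -> `|g a - g b| <= K * kap * `|a - b|.
  move=> ca cb; have [x [cx ncx] hx] := exit_point ca cb.
  rewrite {2}/g /patch memNset// subr0.
  case: ca hx => w cw <- hx; rewrite patch_cell// -[F w]subr0 -(F0 cx ncx).
  have [_ _ Fl _] := sF; have [h _] := Fl _ _ (cube_ccube cw) cx.
  apply: (le_trans h); rewrite -mulrA ler_wpM2l//.
  apply: (le_trans (sm_inverse_lip sm (cube_ccube cw) cx)).
  by rewrite ler_pM2l.
have [ca|ca] := pselect (cel y); have [cb|cb] := pselect (cel z).
- case: ca cb => a ca <- [b cb <-]; exact: (pullback_lip sm sF patch_cell ca cb).
- exact: out.
- by rewrite distrC [`|y - z|]distrC; exact: out.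
- by rewrite /g /patch !memNset// subrr normr0 !mulr_ge0// ltW.
Qed.

(** The divergence theorem on one element for functions vanishing on its boundary: the extension by
    zero is Lipschitz on the whole space and locally zero off the closed element. *)
Lemma bubble_integral v : \int[leb R d]_(y in cel) 'D_v f y = 0.
Proof.
have k0 := sm_kap sm; have L0 := sm_Lam sm.
have [N [mN N0 sN]] := sm_skeleton_negligible sm.
have -> : \int[leb R d]_(y in cel) 'D_v f y = \int[leb R d]_(y in cel) 'D_v g y.
  by apply: eq_Rintegral => y; rewrite inE => cy; have [_ ->] := patch_derivative v cy.
pose r := `|T (center R d)| + Lam + 1.
apply: (@Rintegral_derivative_eq0 _ _ _ v (K * kap) K r cel N) => //.
- exact: patch_measurable.
- exact: patch_lip.
- move=> y; have [[x cx <-]|cy] := pselect (cel y).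
    exact: (pullback_bound sF patch_cell cx).
  by rewrite /g /patch memNset// normr0.
- by rewrite /r ltr_wpDl// addr_ge0// ltW.
- move=> y hy; rewrite /g /patch memNset// => -[x cx Tx].
  have := sm_diameter sm (cube_ccube cx) (cube_ccube (@cube_center R d)).
  have := ler_normB (T x) (T x - T (center R d)); rewrite subKr Tx.
  have := ler_normD (y - T (center R d)) (T (center R d)); rewrite subrK.
  by move: hy; rewrite /r; lra.
- exact: (sm_measurable sm).
- by move=> y cy; have [] := patch_derivative v cy.
- move=> y cy Ny.
  have ncl : ~ (T @` @ccube R d) y by move=> h; apply: Ny; apply: sN.
  have : open (~` (T @` @ccube R d)).
    by rewrite openC -(sm_closure sm); exact: closed_closure.
  move=> /rV_openP/(_ y ncl)[e e0 He].
  apply/rV_nbhsP; exists e => // z /He zc.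
  rewrite /g /patch memNset// => -[x cx Tx]; apply: zc; exists x => //; exact: cube_ccube.
Qed.
End PullBackExtension.

Section Density.
Variables (R : realType) (d : nat) (T : 'rV[R]_d -> 'rV[R]_d).
Variables (J : 'rV[R]_d -> 'rV[R]_d -> 'M[R]_d) (kap Lam : R).
Hypothesis sm : secant_map T J kap Lam.

(* A Lipschitz function on the cube vanishes if it vanishes off the preimage of a null set:
   the image of a nonempty open subset of the cube contains a ball. *)
Lemma eq0_off_negligible (N : set 'rV[R]_d) (H : 'rV[R]_d -> R) (K : R) :
  measurable N -> leb R d N = 0%E ->
  (forall x y, ccube x -> ccube y -> `|H x - H y| <= K * `|x - y|) ->
  (forall x, cube R d x -> ~ N (T x) -> H x = 0) -> forall x, cube R d x -> H x = 0.
Proof.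
move=> mN N0 HK HN x cx; apply: contrapT => /eqP Hx.
have cc := cube_ccube cx.
have [e e0 He] := sm_cell_nbhd sm cx.
have k0 := sm_kap sm.
have K1 : 0 < `|K| + 1 by rewrite ltr_wpDl.
pose r := Order.min e (`|H x| / ((`|K| + 1) * kap)).
have r0 : 0 < r by rewrite lt_min e0 divr_gt0 ?normr_gt0// mulr_gt0.
have : [set y | `|y - T x| < r] `<=` N.
  move=> y /= yr; apply: contrapT => Ny.
  have [z cz Tz] : (T @` cube R d) y.
    by apply: He; apply: (lt_le_trans yr); rewrite /r ge_min lexx.
  have Hz : H z = 0 by apply: HN => //; rewrite Tz.
  have cz' := cube_ccube cz.
  have h1 := HK _ _ cc cz'; rewrite Hz subr0 in h1.
  have h2 := sm_inverse_lip sm cc cz'.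
  have h3 : `|T x - T z| < `|H x| / ((`|K| + 1) * kap).
    rewrite distrC Tz; apply: (lt_le_trans yr); by rewrite /r ge_min lexx orbT.
  have : `|H x| < `|H x|.
    apply: (le_lt_trans h1).
    apply: (@le_lt_trans _ _ ((`|K| + 1) * (kap * `|T x - T z|))).
      apply: (@le_trans _ _ ((`|K| + 1) * `|x - z|)).
        by apply: ler_wpM2r => //; rewrite ler_wpDr// ler_norm.
      by apply: ler_wpM2l => //; exact: ltW.
    by rewrite mulrA mulrC -ltr_pdivlMr// mulr_gt0.
  by rewrite ltxx.
move=> sub; have := leb_ball (T x) r0 => hb.
have mb : measurable [set y : 'rV[R]_d | `|y - T x| < r].
  have -> : [set y : 'rV[R]_d | `|y - T x| < r] = ball (T x) r.
    by apply/seteqP; split => y; rewrite mx_norm_ball /ball_ /= distrC.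
  by apply: rV_open_measurable; exact: ball_open.
have : (leb R d [set y : 'rV[R]_d | (`|y - T x| < r)%R] <= leb R d N)%E by apply: le_measure; rewrite ?inE.
rewrite hb N0 lee_fin leNgt exprn_gt0// mulr_gt0//.
Qed.
End Density.

(** * Affine and bilinear element maps *)

Section MatrixBounds.
Variable R : realType.

Lemma det_le n (A : 'M[R]_n) (a : R) : (forall i j, `|A i j| <= a) -> 0 <= a ->
  `|\det A| <= n`!%:R * a ^+ n.
Proof.
move=> Aa a0; rewrite /determinant; apply: (le_trans (ler_norm_sum _ _ _)).
apply: (@le_trans _ _ (\sum_(s : 'S_n) a ^+ n)).
  apply: ler_sum => s _; rewrite normrM normrX normrN1 expr1n mul1r normr_prod.
  rewrite -[X in a ^+ X]card_ord -prodr_const; apply: ler_prod => i _.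
  by rewrite normr_ge0 Aa.
by rewrite sumr_const card_Sn mulr_natl.
Qed.

(** Cofactor formula: the minors are sums of n! products of n entries of size at most a, and the
    determinant is at least s. *)
Lemma invmx_row_bound n (A : 'M[R]_n.+1) (a s : R) (w : 'rV[R]_n.+1) :
  (forall i j, `|A i j| <= a) -> 0 <= a -> 0 < s -> s <= `|\det A| ->
  `|w *m invmx A| <= n.+1%:R * (n`!%:R * a ^+ n) / s * `|w|.
Proof.
move=> Aa a0 s0 sA.
have dA : \det A != 0 by rewrite -normr_gt0 (lt_le_trans s0).
have uA : A \in unitmx by rewrite unitmxE unitfE.
have ent i j : `|invmx A i j| <= n`!%:R * a ^+ n / s.
  rewrite /invmx uA !mxE /cofactor normrM normfV normrM normrX normrN1 expr1n mul1r.
  rewrite mulrC; apply: ler_pM => //; first by rewrite det_le// => p q; rewrite !mxE.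
  by rewrite lef_pV2 ?posrE// normr_gt0.
apply: rV_norm_le => [|i].
  by rewrite mulr_ge0// divr_ge0 ?(ltW s0)// mulr_ge0// mulr_ge0 ?ler0n ?exprn_ge0.
rewrite mxE; apply: (le_trans (ler_norm_sum _ _ _)).
apply: (@le_trans _ _ (\sum_(j < n.+1) `|w| * (n`!%:R * a ^+ n / s))).
  by apply: ler_sum => j _; rewrite normrM ler_pM ?coord_le_norm.
by rewrite sumr_const card_ord -mulr_natl le_eqVlt; apply/orP; left; apply/eqP; ring.
Qed.

Lemma mul_row_bound n (A : 'M[R]_n) (a : R) (w : 'rV[R]_n) :
  (forall i j, `|A i j| <= a) -> 0 <= a -> `|w *m A| <= n%:R * a * `|w|.
Proof.
move=> Aa a0; apply: rV_norm_le => [|i]; first by rewrite !mulr_ge0.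
rewrite mxE; apply: (le_trans (ler_norm_sum _ _ _)).
apply: (@le_trans _ _ (\sum_(j < n) `|w| * a)).
  by apply: ler_sum => j _; rewrite normrM ler_pM ?coord_le_norm.
by rewrite sumr_const card_ord -mulr_natl le_eqVlt; apply/orP; left; apply/eqP; ring.
Qed.

Lemma coord_le_enorm d (x : 'rV[R]_d) i : `|x 0 i| <= enorm x.
Proof.
rewrite -sqrtr_sqr /enorm; apply: ler_wsqrtr.
rewrite big_ord1 (bigD1 i)//= lerDl sumr_ge0// => j _; exact: sqr_ge0.
Qed.

Lemma norm_le_enorm d (x : 'rV[R]_d) : `|x| <= enorm x.
Proof. by apply: rV_norm_le; [exact: sqrtr_ge0|move=> i; exact: coord_le_enorm]. Qed.

Lemma enorm_le_norm d (x : 'rV[R]_d) : enorm x <= d%:R * `|x|.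
Proof.
rewrite -[leRHS]ger0_norm ?mulr_ge0// -sqrtr_sqr /enorm; apply: ler_wsqrtr.
rewrite big_ord1; apply: (@le_trans _ _ (\sum_(i < d) `|x| ^+ 2)).
  by apply: ler_sum => i _; rewrite -real_normK ?num_real// lerXn2r ?nnegrE// coord_le_norm.
rewrite sumr_const card_ord exprMn -[leLHS]mulr_natl; apply: ler_wpM2r; first exact: sqr_ge0.
case: d {x} => [|n]; first by rewrite expr0n.
by rewrite -natrX ler_nat expnS expn1 leq_pmulr.
Qed.

Lemma diam_ge d (A : set 'rV[R]_d) (r : R) x y :
  (forall z, A z -> `|z| <= r) -> A x -> A y -> enorm (x - y) <= diam A.
Proof.
move=> Ar Ax Ay; apply: ub_le_sup; last by exists (x, y).
exists (d%:R * (r + r)) => _ [[a b] /= [Aa Ab] <-].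
apply: (le_trans (enorm_le_norm _)); rewrite ler_wpM2l//.
by apply: (le_trans (ler_normB _ _)); rewrite lerD ?Ar.
Qed.

Lemma diam_norm_ge d (A : set 'rV[R]_d) (r : R) x y :
  (forall z, A z -> `|z| <= r) -> A x -> A y -> `|x - y| <= diam A.
Proof. by move=> Ar Ax Ay; apply: (le_trans (norm_le_enorm _)); exact: diam_ge Ar _ _. Qed.

Lemma jacobian_row d (T : 'rV[R]_d -> 'rV[R]_d) (M : 'M[R]_d) x :
  differentiable T x ->
  (forall i t, T (x + t *: delta_mx 0 i) - T x = t *: row i M) -> jacobian T x = M.
Proof.
move=> dT H; apply/row_matrixP => i; rewrite [LHS]rowE -deriveEjacobian// /derive.
apply: cvg_lim; first exact: norm_hausdorff.
apply: cvg_near_cst; exists 1 => //= t _ t0.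
by rewrite /= [_ + x]addrC H scalerA mulVf// scale1r.
Qed.
End MatrixBounds.

Section ElementMaps.
Variable R : realType.

(** The derivative at x in direction u of the product of the factors 1 - x_i for [c i] and x_i
    otherwise. *)
Definition gradient_xi d (c : 'I_d -> bool) (x u : 'rV[R]_d) : R :=
  \sum_i u 0 i * ((if c i then -1 else 1) *
    \prod_(j | j != i) (if c j then 1 - x 0 j else x 0 j)).

(** A scaled [secant_map] together with, for every vertex c of the cube, one physical direction w in
    which the product behind [gradient_xi], transported to the element, increases at every point. *)
Definition element_map d (T : 'rV[R]_d -> 'rV[R]_d) (delta K : R) : Prop :=
  exists J, secant_map T J (K / delta) (K * delta) /\
    forall c : 'I_d -> bool, exists w : 'rV[R]_d, forall x, cube R d x ->
      0 < gradient_xi c x (w *m invmx (J x x)).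

(* The constants: entries of the secant matrices are at most 12 delta, determinants at least sigma delta^d. *)
Definition map_const (n : nat) (sigma : R) : R :=
  n.+1%:R * 12 + n.+1%:R * (n`!%:R * 12 ^+ n) / sigma.

Lemma map_const_gt0 n sigma : 0 < sigma -> 0 < map_const n sigma.
Proof.
move=> s0; rewrite /map_const ltr_pwDl// ?mulr_gt0//.
by rewrite divr_ge0 ?(ltW s0)// mulr_ge0// mulr_ge0.
Qed.

Lemma secant_bounds n (sigma delta : R) (M : 'M[R]_n.+1) (w : 'rV[R]_n.+1) :
  0 < sigma -> 0 < delta -> (forall i j, `|M i j| <= 12 * delta) ->
  sigma * delta ^+ n.+1 <= `|\det M| ->
  [/\ M \in unitmx, `|w *m invmx M| <= map_const n sigma / delta * `|w| &
      `|w *m M| <= map_const n sigma * delta * `|w|].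
Proof.
move=> s0 d0 Me Md; have a0 : 0 <= 12 * delta by rewrite mulr_ge0 ?(ltW d0).
have sd : 0 < sigma * delta ^+ n.+1 by rewrite mulr_gt0 ?exprn_gt0.
have k1 : 0 <= n.+1%:R * (n`!%:R * 12 ^+ n) / sigma :> R.
  by rewrite divr_ge0 ?(ltW s0)// mulr_ge0// mulr_ge0.
split.
- by rewrite unitmxE unitfE -normr_gt0 (lt_le_trans sd).
- apply: (le_trans (invmx_row_bound w Me a0 sd Md)); apply: ler_wpM2r => //.
  have -> : n.+1%:R * (n`!%:R * (12 * delta) ^+ n) / (sigma * delta ^+ n.+1) =
     n.+1%:R * (n`!%:R * 12 ^+ n) / sigma / delta.
    by rewrite exprMn exprS; field; rewrite ?gt_eqF ?exprn_gt0.
  by rewrite ler_wpM2r ?invr_ge0 ?(ltW d0)// /map_const lerDr.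
- apply: (le_trans (mul_row_bound w Me a0)); apply: ler_wpM2r => //.
  by rewrite mulrA ler_wpM2r ?(ltW d0)// /map_const lerDl.
Qed.

Lemma affine_element_map n (T : 'rV[R]_n.+2 -> 'rV[R]_n.+2) (M : 'M[R]_n.+2) b (sigma : R) :
  (forall x, T x = x *m M + b) -> 0 < sigma -> 0 < diam (T @` cube R n.+2) ->
  (forall x, ccube x -> sigma * diam (T @` cube R n.+2) ^+ n.+2 <= `|\det (jacobian T x)|) ->
  element_map T (diam (T @` cube R n.+2)) (map_const n.+1 sigma).
Proof.
move=> TE s0; set delta := diam _ => d0 jac.
have Tsec x y : T x - T y = (x - y) *m M by rewrite !TE mulmxBl opprD addrACA subrr addr0.
have TMrow x i t : T (x + t *: delta_mx 0 i) - T x = t *: row i M.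
  by rewrite Tsec addrC addKr -scalemxAl -rowE.
have Mc : forall w : 'rV[R]_n.+2, `|w *m M| <= n.+2%:R * (\sum_i \sum_j `|M i j|) * `|w|.
  move=> w; apply: mul_row_bound; last by do 2!(rewrite sumr_ge0// => ? _).
  move=> i j; rewrite (bigD1 i)//= (bigD1 j)//= -addrA lerDl addr_ge0//.
    by rewrite sumr_ge0.
  by do 2!(rewrite sumr_ge0// => ? _).
have bd z : (T @` cube R n.+2) z -> `|z| <= n.+2%:R * (\sum_i \sum_j `|M i j|) + `|b|.
  move=> [x cx <-]; rewrite TE; apply: (le_trans (ler_normD _ _)); rewrite lerD2r.
  apply: (le_trans (Mc x)); rewrite ler_piMr//.
    by rewrite mulr_ge0//; do 2!(rewrite sumr_ge0// => ? _).
  apply: rV_norm_le => // i; have := cx i; rewrite ler_norml; lra.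
have dT x : differentiable T x.
  have -> : T = (\sum_(i < n.+2) (fun z : 'rV[R]_n.+2 => z 0 i *: row i M)) + cst b.
    by apply/funext => z; rewrite TE mulmx_sum_row fctE /= fct_sumE.
  apply: differentiableD; last exact: differentiable_cst.
  apply: differentiable_sum => i; apply: differentiableZl; exact: differentiable_coord.
(* The diameter is that of the open element, so two interior points at distance 1/2 along an axis
   are compared. *)
have Me i j : `|M i j| <= 12 * delta.
  pose p (t : R) := center R n.+2 + t *: delta_mx 0 i : 'rV[R]_n.+2.
  have cp t : `|t| <= 1 / 4 -> cube R n.+2 (p t).
    rewrite ler_norml => ht k; rewrite !mxE eqxx /=.
    by case: (k == i); rewrite ?mulr0 ?addr0 ?mulr1; lra.
  have h4 : `|1 / 4 : R| <= 1 / 4 by rewrite ger0_norm.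
  have h4' : `|- (1 / 4) : R| <= 1 / 4 by rewrite normrN ger0_norm.
  have Cp t : `|t| <= 1 / 4 -> (T @` cube R n.+2) (T (p t)) by move=> h; exists (p t) => //; exact: cp.
  have := diam_norm_ge bd (Cp _ h4) (Cp _ h4').
  rewrite Tsec /p opprD addrACA subrr add0r -scalerBl -scalemxAl -rowE => h.
  have := le_trans (coord_le_norm _ j) h; rewrite !mxE -/delta.
  have -> : 1 / 4 - - (1 / 4) = 1 / 2 :> R by field.
  by rewrite normrM ger0_norm//; move: d0; rewrite -/delta; lra.
have Md : sigma * delta ^+ n.+2 <= `|\det M|.
  have := jac (center R n.+2) (cube_ccube (@cube_center R n.+2)).
  by rewrite (jacobian_row (dT _) (TMrow _)).
have MB w := secant_bounds w s0 d0 Me Md.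
have k0 := map_const_gt0 n.+1 s0.
have uM : M \in unitmx by have [] := MB 0.
exists (fun _ _ => M); split; first split => //.
- by rewrite divr_gt0.
- by rewrite mulr_gt0.
- by move=> x; exact: differentiable_continuous (dT x).
- by move=> x y w _ _; have [] := MB w.
- by move=> x y w _ _; have [] := MB w.
- move=> x y w _ _; rewrite subrr mulmx0 normr0 !mulr_ge0 ?(ltW k0) ?(ltW d0)//.
- move=> x rho u room hu; exists (x + u); last first.
    by rewrite !TE mulmxDl addrAC.
  move=> i; have hi := hu i.
  have hr : `|u 0 i| <= rho by apply: (le_trans hi); have := le_trans (normr_ge0 _) hi; lra.
  by have := room i _ hr i; rewrite !mxE !eqxx mulr1.
(* With w M as physical direction, the reference direction is the sign vector w, which makes every
   term of [gradient_xi] positive. *)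
move=> c; pose w : 'rV[R]_n.+2 := \row_i (if c i then -1 else 1).
exists (w *m M) => x cx; rewrite mulmxK// /gradient_xi.
have pp i : 0 < \prod_(j | j != i) (if c j then 1 - x 0 j else x 0 j).
  apply: prodr_gt0 => j _; have := cx j; case: (c j); lra.
rewrite (bigD1 ord0)//= ltr_pwDl//.
  by rewrite mxE mulrA; case: (c ord0); rewrite ?mulrNN ?mul1r ?mulr1// pp.
apply: sumr_ge0 => i _; rewrite mxE mulrA.
by case: (c i); rewrite ?mulrNN ?mul1r ltW.
Qed.
End ElementMaps.

Section Bilinear.
Variable R : realType.

Definition upd d (x : 'rV[R]_d) (i : 'I_d) (t : R) : 'rV[R]_d :=
  \row_j (if j == i then t else x 0 j).

Lemma Qpoly1_affine d (f : 'rV[R]_d -> R) x i : Qpoly 1 f ->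
  f x = (1 - x 0 i) * f (upd x i 0) + x 0 i * f (upd x i 1).
Proof.
case=> c fE; rewrite !fE !mulr_sumr -big_split /=; apply: eq_bigr => a _.
rewrite !(bigD1 i (P := xpredT))//= !mxE eqxx.
have E t : \prod_(j < d | j != i) upd x i t 0 j ^+ a j = \prod_(j < d | j != i) x 0 j ^+ a j.
  by apply: eq_bigr => j ji; rewrite mxE (negPf ji).
rewrite !E; set p := \prod_(j < d | _) _.
by case: (a i) => -[|[|//]] h /=; rewrite ?expr0 ?expr1; ring.
Qed.

Let o1 : 'I_2 := lift ord0 ord0.
Let mk (a b : R) : 'rV[R]_2 := \row_j (if j == ord0 then a else b).

Let rV2P (x y : 'rV[R]_2) : x 0 ord0 = y 0 ord0 -> x 0 o1 = y 0 o1 -> x = y.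
Proof.
move=> h0 h1; apply/rowP => j; case: (unliftP ord0 j) => [k|] -> //.
by rewrite [k]ord1.
Qed.

Let sum2 (F : 'I_2 -> R) : \sum_i F i = F ord0 + F o1.
Proof. by rewrite !big_ord_recl big_ord0 addr0. Qed.

Lemma Qpoly1_bilinear (f : 'rV[R]_2 -> R) x : Qpoly 1 f ->
  f x = f (mk 0 0) + x 0 ord0 * (f (mk 1 0) - f (mk 0 0)) + x 0 o1 * (f (mk 0 1) - f (mk 0 0))
    + (x 0 ord0 * x 0 o1) * (f (mk 1 1) - f (mk 1 0) - f (mk 0 1) + f (mk 0 0)).
Proof.
move=> Qf; rewrite (Qpoly1_affine x ord0 Qf).
have E a b : upd (upd x ord0 a) o1 b = mk a b by apply: rV2P; rewrite !mxE.
rewrite (Qpoly1_affine (upd x ord0 0) o1 Qf) (Qpoly1_affine (upd x ord0 1) o1 Qf) !E.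
by rewrite !mxE /=; ring.
Qed.

Lemma Qpoly1_map (T : 'rV[R]_2 -> 'rV[R]_2) : (forall i, Qpoly 1 (vcomp T i)) ->
  exists b w0 w1 e : 'rV[R]_2, forall x,
    T x = b + x 0 ord0 *: w0 + x 0 o1 *: w1 + (x 0 ord0 * x 0 o1) *: e.
Proof.
move=> QT; exists (T (mk 0 0)), (T (mk 1 0) - T (mk 0 0)), (T (mk 0 1) - T (mk 0 0)),
  (T (mk 1 1) - T (mk 1 0) - T (mk 0 1) + T (mk 0 0)) => x.
apply/rowP => i; have := Qpoly1_bilinear x (QT i); rewrite /vcomp => ->.
by rewrite !mxE.
Qed.

Lemma det_mx22 (M : 'M[R]_2) : \det M = M ord0 ord0 * M o1 o1 - M ord0 o1 * M o1 ord0.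
Proof.
rewrite (expand_det_row _ ord0) sum2 /cofactor !det_mx11 !mxE /=.
have -> : lift o1 (0 : 'I_1) = ord0 :> 'I_2 by apply/val_inj.
have -> : lift ord0 (0 : 'I_1) = o1 :> 'I_2 by apply/val_inj.
by rewrite expr0 expr1; ring.
Qed.

Variables (T : 'rV[R]_2 -> 'rV[R]_2) (b w0 w1 e : 'rV[R]_2).
Hypothesis TE : forall x, T x = b + x 0 ord0 *: w0 + x 0 o1 *: w1 + (x 0 ord0 * x 0 o1) *: e.

Let J (x y : 'rV[R]_2) : 'M[R]_2 :=
  \matrix_(i, j) (if i == ord0 then w0 0 j + x 0 o1 * e 0 j else w1 0 j + y 0 ord0 * e 0 j).

Let mulJ (u x y : 'rV[R]_2) j : (u *m J x y) 0 j =
  u 0 ord0 * (w0 0 j + x 0 o1 * e 0 j) + u 0 o1 * (w1 0 j + y 0 ord0 * e 0 j).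
Proof. by rewrite mxE sum2 !mxE. Qed.

Let Tsec (x y : 'rV[R]_2) : T x - T y = (x - y) *m J x y.
Proof. by apply/rowP => j; rewrite mulJ !TE !mxE; ring. Qed.

Let Tface (x y : 'rV[R]_2) i : x 0 i = y 0 i -> T x - T y = (x - y) *m J y y.
Proof.
case: (unliftP ord0 i) => [k|] -> h; apply/rowP => j; rewrite mulJ !TE !mxE.
  by move: h; rewrite [k]ord1 -/o1 => ->; ring.
by rewrite h; ring.
Qed.

Let Trow (x : 'rV[R]_2) i t : T (x + t *: delta_mx 0 i) - T x = t *: row i (J x x).
Proof.
have ne : exists k : 'I_2, k != i.
  by case: (unliftP ord0 i) => [k|] ->; [exists ord0|exists o1].
case: ne => k ki; rewrite (@Tface _ _ k).
  by rewrite addrC addKr -scalemxAl -rowE.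
by rewrite !mxE (negPf ki) andbF mulr0 addr0.
Qed.

Let dT (x : 'rV[R]_2) : differentiable T x.
Proof.
have -> : T = (cst b + (fun z : 'rV[R]_2 => z 0 ord0 *: w0)) + (fun z : 'rV[R]_2 => z 0 o1 *: w1)
   + (fun z : 'rV[R]_2 => (z 0 ord0 * z 0 o1) *: e).
  by apply/funext => z; rewrite TE.
have c i := @differentiable_coord R 1 2 x 0 i.
apply: differentiableD; first apply: differentiableD; first apply: differentiableD.
- exact: differentiable_cst.
- by apply: differentiableZl; exact: c.
- by apply: differentiableZl; exact: c.
- apply: differentiableZl.
  exact: (differentiableM (c ord0) (c o1)).
Qed.

Let detJ x y : \det (J x y) =
  (w0 0 ord0 + x 0 o1 * e 0 ord0) * (w1 0 o1 + y 0 ord0 * e 0 o1) -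
  (w0 0 o1 + x 0 o1 * e 0 o1) * (w1 0 ord0 + y 0 ord0 * e 0 ord0).
Proof.
by rewrite det_mx22 !mxE /=.
Qed.

(** J(x, y) is the Jacobian at (y_0, x_1), again a point of the closed cube, so shape regularity
    bounds its determinant from below. Convexity of the element gives [sm_cross], and the positive
    direction w rests on the determinant having a constant sign. *)
Lemma bilinear_element_map (sigma : R) :
  convex_set (T @` cube R 2 : set (convex_lmodType 'rV[R]_2)) ->
  0 < sigma -> 0 < diam (T @` cube R 2) ->
  (forall x, ccube x -> sigma * diam (T @` cube R 2) ^+ 2 <= `|\det (jacobian T x)|) ->
  element_map T (diam (T @` cube R 2)) (map_const 1 sigma).
Proof.
move=> cvx s0; set delta := diam _ => d0 jac.
have bd z : (T @` cube R 2) z -> `|z| <= `|b| + `|w0| + `|w1| + `|e|.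
  move=> [x cx <-]; rewrite TE.
  have /andP[p0 q0] := cx ord0; have /andP[p1 q1] := cx o1.
  have l (t : R) (v : 'rV[R]_2) : 0 <= t -> t <= 1 -> `|t *: v| <= `|v|.
    by move=> t0 t1; rewrite normrZ ger0_norm// ler_piMl.
  apply: (le_trans (ler_normD _ _)); apply: lerD; last first.
    by apply: l; [rewrite mulr_ge0 ?ltW|rewrite mulr_ile1 ?ltW].
  apply: (le_trans (ler_normD _ _)); apply: lerD; last by apply: l; exact: ltW.
  by apply: (le_trans (ler_normD _ _)); apply: lerD => //; apply: l; exact: ltW.
have dist x y j : cube R 2 x -> cube R 2 y -> `|T x 0 j - T y 0 j| <= delta.
  move=> cx cy; have Cx : (T @` cube R 2) (T x) by exists x.
  have Cy : (T @` cube R 2) (T y) by exists y.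
  by have := le_trans (coord_le_norm (T x - T y) j) (diam_norm_ge bd Cx Cy); rewrite !mxE.
have cmk p q : 0 < p < 1 -> 0 < q < 1 -> cube R 2 (mk p q).
  by move=> hp hq i; rewrite mxE; case: (i == ord0).
have q14 : 0 < (1 / 4 : R) < 1 by lra.
have q34 : 0 < (3 / 4 : R) < 1 by lra.
(* e is four times the mixed second difference over the points with coordinates 1/4 and 3/4, and w0,
   w1 then follow from first differences. The bounds 4 delta and 8 delta add up to the 12 delta of
   the entries of J. *)
have eb j : `|e 0 j| <= 8 * delta /\ `|w0 0 j| <= 4 * delta /\ `|w1 0 j| <= 4 * delta.
  have A := dist (mk (3 / 4) (3 / 4)) (mk (3 / 4) (1 / 4)) j (cmk _ _ q34 q34) (cmk _ _ q34 q14).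
  have B := dist (mk (1 / 4) (3 / 4)) (mk (1 / 4) (1 / 4)) j (cmk _ _ q14 q34) (cmk _ _ q14 q14).
  have C := dist (mk (3 / 4) (1 / 4)) (mk (1 / 4) (1 / 4)) j (cmk _ _ q34 q14) (cmk _ _ q14 q14).
  move: A B C; rewrite !TE !mxE /= !ler_norml => /andP[A1 A2] /andP[B1 B2] /andP[C1 C2].
  by split; [apply/andP|split; apply/andP]; split; lra.
have ccmk (x y : 'rV[R]_2) : ccube x -> ccube y -> ccube (mk (y 0 ord0) (x 0 o1)).
  by move=> cx cy i; rewrite mxE; case: (i == ord0); [exact: cy|exact: cx].
have Me x y : ccube x -> ccube y -> forall i j, `|J x y i j| <= 12 * delta.
  move=> cx cy i j; rewrite mxE; have [h1 [h2 h3]] := eb j.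
  have /andP[p0 q0] := cy ord0; have /andP[p1 q1] := cx o1.
  have l (t u : R) : 0 <= t -> t <= 1 -> `|t * u| <= `|u|.
    by move=> t0 t1; rewrite normrM ger0_norm// ler_piMl.
  case: (i == ord0); apply: (le_trans (ler_normD _ _)).
    by have := l _ (e 0 j) p1 q1; lra.
  by have := l _ (e 0 j) p0 q0; lra.
have Md x y : ccube x -> ccube y -> sigma * delta ^+ 2 <= `|\det (J x y)|.
  move=> cx cy; have cz := ccmk _ _ cx cy.
  have := jac _ cz; rewrite (jacobian_row (dT _) (@Trow _)).
  suff -> : J (mk (y 0 ord0) (x 0 o1)) (mk (y 0 ord0) (x 0 o1)) = J x y by [].
  by apply/matrixP => i j; rewrite !mxE.
have MB x y w (cx : ccube x) (cy : ccube y) := secant_bounds w s0 d0 (Me x y cx cy) (Md x y cx cy).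
have k0 := map_const_gt0 1 s0.
exists J; split; first split.
- by rewrite divr_gt0.
- by rewrite mulr_gt0.
- by move=> x; exact: differentiable_continuous (dT x).
- exact: Tsec.
- exact: Tface.
- by move=> x y cx cy; have [] := MB x y 0 cx cy.
- by move=> x y w cx cy; have [] := MB x y w cx cy.
- by move=> x y w cx cy; have [] := MB x y w cx cy.
- move=> x y w cx cy; apply: rV_norm_le => [|j]; first by rewrite !mulr_ge0 ?(ltW k0) ?(ltW d0).
  have -> : (w *m (J x y - J y y)) 0 j = w 0 ord0 * ((x - y) 0 o1 * e 0 j).
    by rewrite mxE sum2 !mxE /=; ring.
  have [h1 _] := eb j; rewrite !normrM.
  have a1 := coord_le_norm w ord0; have a2 := coord_le_norm (x - y) o1.
  apply: (@le_trans _ _ (`|w| * (`|x - y| * (8 * delta)))).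
    by apply: ler_pM => //; apply: ler_pM.
  have -> : `|w| * (`|x - y| * (8 * delta)) = (8 * delta) * (`|x - y| * `|w|) by ring.
  rewrite ler_wpM2r ?mulr_ge0// ler_wpM2r ?(ltW d0)//.
  rewrite /map_const; have : 0 <= 2%:R * (1`!%:R * 12 ^+ 1) / sigma :> R.
    by rewrite divr_ge0 ?(ltW s0)// mulr_ge0// mulr_ge0.
  by lra.
- move=> x rho u room hu.
  (* T x + u J(x, x) is the midpoint of the two points p i, each reached along a coordinate axis, on
     which T is affine. *)
  pose p i := T (x + (2 * u 0 i) *: delta_mx 0 i).
  have Cp i : p i \in (T @` cube R 2 : set (convex_lmodType 'rV[R]_2)).
    rewrite inE; exists (x + (2 * u 0 i) *: delta_mx 0 i) => //; apply: room.
    by rewrite normrM ger0_norm//; have := hu i; lra.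
  have h0 : (0 : R) <= 2^-1 by rewrite invr_ge0.
  have h1 : (2^-1 : R) <= 1 by rewrite invf_le1// ler1n.
  pose l2 : {i01 R} := Itv01 h0 h1.
  have /set_mem := cvx (p ord0) (p o1) l2 (Cp ord0) (Cp o1).
  rewrite (_ : conv _ _ _ = (T x + u *m J x x : convex_lmodType 'rV[R]_2))//.
  have pE i : p i = T x + (2 * u 0 i) *: row i (J x x) by rewrite -Trow addrC subrK.
  rewrite -[LHS]/(2^-1 *: p ord0 + (1 - 2^-1) *: p o1) !pE; apply/rowP => j.
  by rewrite !mxE sum2 !mxE; field.
move=> c; pose sg i : R := if c i then -1 else 1.
pose cc : 'rV[R]_2 := \row_i (c i)%:R.
have ccc : ccube cc by move=> i; rewrite mxE; case: (c i); rewrite ?lexx ?ler01.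
(* The sum of the two edge vectors issuing from the vertex T cc. *)
pose w := sg ord0 *: row ord0 (J cc cc) + sg o1 *: row o1 (J cc cc).
exists w => x cx; have cx' := cube_ccube cx.
have dn y (cy : ccube y) : \det (J y y) != 0.
  rewrite -normr_gt0; apply: lt_le_trans (Md _ _ cy cy).
  by rewrite mulr_gt0 ?exprn_gt0.
(* The determinant is affine in the point, since the term with e in both rows cancels; having no
   zero in the closed cube, it keeps its sign. *)
have pos : 0 < \det (J cc cc) * \det (J x x).
  have aff (t : R) (z := cc + t *: (x - cc)) :
      \det (J z z) = \det (J cc cc) + t * (\det (J x x) - \det (J cc cc)).
    by rewrite !detJ /z !mxE; ring.
  rewrite ltNge; apply/negP => hle.
  have D0 := dn _ ccc; have D1 := dn _ cx'.
  have nz : \det (J cc cc) - \det (J x x) != 0.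
    apply/eqP => h; have h2 : \det (J x x) = \det (J cc cc) by lra.
    by move: hle; rewrite h2 leNgt -expr2 exprn_even_gt0//= D0.
  pose t := \det (J cc cc) / (\det (J cc cc) - \det (J x x)).
  have t01 : 0 <= t <= 1.
    have : 0 < (\det (J cc cc) - \det (J x x)) ^+ 2 by rewrite exprn_even_gt0.
    move=> h2.
    have -> : t = (\det (J cc cc) * (\det (J cc cc) - \det (J x x))) / (\det (J cc cc) - \det (J x x)) ^+ 2.
      by rewrite /t expr2 invfM mulrA mulfK.
    rewrite ler_pdivrMr// mul1r ler_pdivlMr// mul0r.
    have s1 := sqr_ge0 (\det (J cc cc)); have s2 := sqr_ge0 (\det (J x x)).
    by apply/andP; split; nra.
  have cz : ccube (cc + t *: (x - cc)).
    move=> i; rewrite !mxE; have /andP[a1 a2] := cx' i; have /andP[a3 a4] := t01.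
    by case: (c i) => /=; apply/andP; split; nra.
  have := dn _ cz; rewrite aff /t => /eqP; apply.
  by field; move: nz; rewrite subr_eq0 => nz; apply/eqP => h; move: nz; rewrite -subr_eq0 => /eqP; apply; lra.
set u := w *m invmx (J x x).
have uJ : u *m J x x = w.
  by rewrite /u mulmxKV//; have [] := MB x x 0 cx' cx'.
have e0 : (u *m J x x) 0 ord0 = w 0 ord0 by rewrite uJ.
have e1 : (u *m J x x) 0 o1 = w 0 o1 by rewrite uJ.
pose z0 := if c ord0 then 1 - x 0 ord0 else x 0 ord0.
pose z1 := if c o1 then 1 - x 0 o1 else x 0 o1.
have z0p : 0 < z0 by rewrite /z0; have := cx ord0; case: (c ord0); lra.
have z1p : 0 < z1 by rewrite /z1; have := cx o1; case: (c o1); lra.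
have gE : gradient_xi c x u = u 0 ord0 * (sg ord0 * z1) + u 0 o1 * (sg o1 * z0).
  rewrite /gradient_xi sum2; congr (_ * (_ * _) + _ * (_ * _)).
    by rewrite big_mkcond !big_ord_recl big_ord0 /= mul1r mulr1.
  by rewrite big_mkcond !big_ord_recl big_ord0 /= !mulr1.
(* Cramer's rule: multiplied by the determinant at x, the derivative collapses to a positive
   multiple of the determinant at the vertex. *)
suff key : gradient_xi c x u * \det (J x x) = (z0 + z1) * \det (J cc cc).
  have d2 : 0 < \det (J x x) ^+ 2 by rewrite exprn_even_gt0//= dn.
  rewrite -(pmulr_lgt0 _ d2) expr2 mulrA key -mulrA.
  by rewrite mulr_gt0// addr_gt0.
have k0' : u 0 ord0 * \det (J x x) = w 0 ord0 * (J x x) o1 o1 - w 0 o1 * (J x x) o1 ord0.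
  by rewrite -e0 -e1 !mulJ detJ !mxE /=; ring.
have k1' : u 0 o1 * \det (J x x) = w 0 o1 * (J x x) ord0 ord0 - w 0 ord0 * (J x x) ord0 o1.
  by rewrite -e0 -e1 !mulJ detJ !mxE /=; ring.
have -> : gradient_xi c x u * \det (J x x) =
    (u 0 ord0 * \det (J x x)) * (sg ord0 * z1) + (u 0 o1 * \det (J x x)) * (sg o1 * z0).
  by rewrite gE; ring.
rewrite k0' k1' detJ /w /z0 /z1 /sg !mxE /=.
by case: (c ord0); case: (c o1) => /=; ring.
Qed.
End Bilinear.

Lemma admissible_element_map (R : realType) d (T : 'rV[R]_d -> 'rV[R]_d) (sigma : R) :
  d = 2%N \/ d = 3%N -> admissible_map T -> 0 < sigma -> 0 < diam (T @` cube R d) ->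
  (forall x, ccube x -> sigma * diam (T @` cube R d) ^+ d <= `|\det (jacobian T x)|) ->
  element_map T (diam (T @` cube R d)) (map_const d.-1 sigma).
Proof.
case=> d23 [_ h2 h3] s0 d0 jac; subst d.
  have [QT cvx] := h2 erefl; have [b [w0 [w1 [e TE]]]] := Qpoly1_map QT.
  exact: (bilinear_element_map TE cvx s0 d0 jac).
have [M [b TE]] := h3 erefl.
exact: (affine_element_map TE s0 d0 jac).
Qed.

(** * Lagrange shape functions *)

Section Lagrange.
Variables (R : realType) (n : nat) (s : 'I_n.+1 -> R).
Hypothesis sI : injective s.

Definition lag1 (j : 'I_n.+1) : {poly R} :=
  \prod_(i | i != j) ((s j - s i)^-1 *: ('X - (s i)%:P)).

Lemma lag1_node i j : (lag1 j).[s i] = (i == j)%:R.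
Proof.
rewrite /lag1 horner_prod; have [->|ij] := eqVneq i j.
  rewrite big1// => k kj; rewrite !hornerE mulVf// subr_eq0.
  by apply: contra kj => /eqP /sI ->.
by rewrite (bigD1 i)//= !hornerE subrr mulr0 mul0r.
Qed.

Lemma size_lag1 j : (size (lag1 j) <= n.+1)%N.
Proof.
rewrite /lag1; apply: (leq_trans (size_poly_prod_leq _ _)).
set S := (\sum_(i | _) _)%N; set N := #|_|.
have NE : N = n.
  by have := cardC1 j; rewrite card_ord /= => E; apply: (etrans _ E); apply: eq_card.
have SN : (S <= N * 2)%N.
  rewrite /S /N -sum_nat_const; apply: leq_sum => i _.
  by apply: (leq_trans (size_scale_leq _ _)); rewrite size_XsubC.
by move: SN; rewrite NE; lia.
Qed.

Lemma lag1_interp (p : {poly R}) x : (size p <= n.+1)%N ->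
  p.[x] = \sum_j p.[s j] * (lag1 j).[x].
Proof.
move=> sp; pose q := p - \sum_j p.[s j] *: lag1 j.
have q0 : q = 0.
  apply: (@roots_geq_poly_eq0 _ _ [seq s i | i <- enum 'I_n.+1]).
  - apply/allP => _ /mapP[i _ ->]; rewrite rootE /q hornerD hornerN horner_sum.
    rewrite (bigD1 i)//= big1 => [|j ji]; rewrite hornerZ lag1_node.
      by rewrite eqxx mulr1 addr0 subrr.
    by rewrite eq_sym (negPf ji) mulr0.
  - by rewrite map_inj_uniq ?enum_uniq.
  - rewrite size_map size_enum_ord; apply: (leq_trans (size_polyD _ _)).
    rewrite size_polyN geq_max sp; apply: (leq_trans (size_sum _ _ _)).
    by apply/bigmax_leqP => j _; apply: (leq_trans (size_scale_leq _ _)); exact: size_lag1.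
have := congr1 (horner^~ x) q0; rewrite /q hornerD hornerN horner_sum horner0 => /eqP.
by rewrite subr_eq0 => /eqP ->; apply: eq_bigr => j _; rewrite hornerZ.
Qed.

Variable d : nat.
Notation idx := {ffun 'I_d -> 'I_n.+1}.

Definition lnode (a : idx) : 'rV[R]_d := \row_i s (a i).
Definition lagd (a : idx) (x : 'rV[R]_d) : R := \prod_m (lag1 (a m)).[x 0 m].

Lemma lagd_node a b : lagd a (lnode b) = (b == a)%:R.
Proof.
rewrite /lagd; have [->|ab] := eqVneq b a.
  by rewrite big1// => m _; rewrite mxE lag1_node eqxx.
have [m mP] : exists m, b m != a m.
  apply/existsP; rewrite -negb_forall; apply: contra ab => /forallP h.
  by apply/eqP/ffunP => m; apply/eqP.
by rewrite (bigD1 m)//= mxE lag1_node (negPf mP) mul0r.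
Qed.

Lemma is_smooth_lagd a : is_smooth (lagd a).
Proof. by apply: is_smooth_prod => m _; exact: is_smooth_horner. Qed.

(** There are finitely many shape functions and they live on the reference cube, so one constant
    serves all elements of all levels. *)
Lemma lagd_smooth_uniform : exists (DL : idx -> 'rV[R]_d -> 'rV[R]_d) (K : R),
  0 < K /\ forall a, smooth_cube (lagd a) (DL a) K.
Proof.
have /fin_all_exists[DL] : forall a : idx, exists DL, exists K, smooth_cube (lagd a) DL K.
  exact: is_smooth_lagd.
move=> /fin_all_exists[K hK]; exists DL, (1 + \sum_a K a).
have K0 a : 0 <= K a by case: (hK a).
split; first by rewrite ltr_pwDl// sumr_ge0.
move=> a; apply: smooth_cube_le (hK a).
by rewrite (bigD1 a)//= addrCA lerDl addr_ge0// sumr_ge0.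
Qed.

End Lagrange.

(** The same functions as in [Qpoly], as sums of products of arbitrary univariate polynomials of
    degree at most n: products of shape functions stay in this form without expansion into
    monomials. *)
Definition tensor_poly (R : realType) (d n : nat) (F : 'rV[R]_d -> R) : Prop :=
  exists (I : finType) (c : I -> R) (f : I -> 'I_d -> {poly R}),
    (forall i m, (size (f i m) <= n.+1)%N) /\ forall x, F x = \sum_i c i * \prod_m (f i m).[x 0 m].

Lemma Qpoly_tensor (R : realType) (d n : nat) (F : 'rV[R]_d -> R) : Qpoly n F -> tensor_poly n F.
Proof.
case=> c FE; exists {ffun 'I_d -> 'I_n.+1}, c, (fun (a : {ffun 'I_d -> 'I_n.+1}) m => 'X^(a m)); split.
  by move=> a m; rewrite size_polyXn ltn_ord.
by move=> x; rewrite FE; apply: eq_bigr => a _; congr (_ * _); apply: eq_bigr => m _; rewrite hornerXn.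
Qed.

Lemma tensor_prod (R : realType) (d n : nat) (g : 'I_d -> {poly R}) :
  (forall m, (size (g m) <= n.+1)%N) -> tensor_poly n (fun x => \prod_m (g m).[x 0 m]).
Proof.
move=> sg; exists unit, (fun=> 1), (fun=> g); split => // x.
by rewrite (big_pred1 tt) ?mul1r// => -[].
Qed.

Lemma tensor_interp (R : realType) (d n : nat) (s : 'I_n.+1 -> R) (F : 'rV[R]_d -> R) x :
  injective s -> tensor_poly n F -> F x = \sum_a F (lnode s a) * lagd s a x.
Proof.
move=> sI [I [c [f [sf FE]]]].
transitivity (\sum_i c i * \sum_(a : {ffun 'I_d -> 'I_n.+1}) \prod_m ((f i m).[s (a m)] * (lag1 s (a m)).[x 0 m])).
  rewrite FE; apply: eq_bigr => i _; congr (_ * _); rewrite -(bigA_distr_bigA (fun m j =>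
    (f i m).[s j] * (lag1 s j).[x 0 m])).
  by apply: eq_bigr => m _; exact: lag1_interp.
under eq_bigr do rewrite mulr_sumr.
rewrite exchange_big; apply: eq_bigr => a _ /=; rewrite FE mulr_suml; apply: eq_bigr => i _.
by rewrite big_split /= mulrA; congr (_ * _ * _); apply: eq_bigr => m _; rewrite mxE.
Qed.

Lemma is_smooth_tensor (R : realType) (d n : nat) (F : 'rV[R]_d -> R) : tensor_poly n F -> is_smooth F.
Proof.
move=> [I [c [f [_ FE]]]].
have -> : F = fun x => \sum_i c i * \prod_m (f i m).[x 0 m] by apply/funext.
apply: is_smooth_sum => i _; apply: is_smoothM; first exact: is_smooth_cst.
by apply: is_smooth_prod => m _; exact: is_smooth_horner.
Qed.

(** * Gradients on the reference cube *)

Section Gradient.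
Variables (R : realType) (d : nat).

Lemma smooth_partial (F : 'rV[R]_d -> R) D K x i g C : smooth_cube F D K -> cube R d x -> 0 <= C ->
  (forall t, `|t| <= 1 -> ccube (x + t *: delta_mx 0 i) -> `|F (x + t *: delta_mx 0 i) - F x - t * g| <= C * t ^+ 2) ->
  D x 0 i = g.
Proof.
move=> [K0 _ _ hD] cx C0 hg; have [rho rho0 room] := cube_room cx.
have cx' := cube_ccube cx.
have nd : `|delta_mx 0 i : 'rV[R]_d| <= 1.
  by apply: rV_norm_le => // j; rewrite mxE; case: (_ && _); rewrite ?normr1 ?normr0.
apply/eqP; rewrite -subr_eq0 -normr_le0; apply/ler_addgt0Pr => e e0; rewrite add0r.
pose t := Num.min rho (Num.min 1 (e / (K + C + 1))).
have KC : 0 < K + C + 1 by lra.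
have t0 : 0 < t by rewrite !lt_min rho0 ltr01 divr_gt0.
have [tr [t1 te]] : t <= rho /\ t <= 1 /\ t <= e / (K + C + 1).
  by split; [rewrite ge_min lexx|split; rewrite !ge_min lexx !orbT].
have nt : `|t| = t by rewrite gtr0_norm.
have cy := cube_ccube (room i t (eq_ind_r (fun z => z <= rho) tr nt)).
have h1 := hD _ _ cy cx'; have := hg t; rewrite nt => /(_ t1 cy) h2.
move: h1; rewrite (addrC x) addrK edotZl; set y := _ + x in h2 *.
have -> : edot (delta_mx 0 i) (D x) = D x 0 i.
  by rewrite /edot (bigD1 i)//= big1 ?addr0 ?mxE ?eqxx ?mul1r// => j ji; rewrite mxE (negPf ji) andbF mul0r.
move=> h1; have h3 : K * `|t *: delta_mx 0 i : 'rV[R]_d| ^+ 2 <= K * t ^+ 2.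
  by rewrite ler_wpM2l// lerXn2r ?nnegrE// ?(ltW t0)// normrZ nt ler_piMr// ltW.
have h4 : t * `|D x 0 i - g| <= t * (t * (K + C)).
  rewrite -{1}nt -normrM.
  have -> : t * (D x 0 i - g) = (F y - F x - t * g) - (F y - F x - t * D x 0 i) by ring.
  apply: (le_trans (ler_normB _ _)); rewrite /y (addrC _ x) in h1 h2 h3 *.
  by apply: (le_trans (lerD h2 (le_trans h1 h3))); rewrite le_eqVlt; apply/orP; left; apply/eqP; ring.
move: h4; rewrite (ler_pM2l t0) => h4; apply: (le_trans h4).
apply: (@le_trans _ _ (t * (K + C + 1))); first by rewrite ler_wpM2l ?(ltW t0)//; lra.
by rewrite -ler_pdivlMr.
Qed.

(** The quadratic remainder bound determines D on the open cube, so two representations of one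
    function, as a product and as a combination of shape functions, have the same gradient. *)
Lemma smooth_grad_uniq (F F' : 'rV[R]_d -> R) D D' K K' x : smooth_cube F D K -> smooth_cube F' D' K' ->
  (forall y, F y = F' y) -> cube R d x -> D x = D' x.
Proof.
move=> sF sF' E cx; apply/rowP => i; apply: (@smooth_partial F D K x i (D' x 0 i) K' sF cx).
  by case: sF'.
move=> t t1 cy; rewrite !E; have [K0 _ _ h] := sF'.
have := h _ _ cy (cube_ccube cx); rewrite (addrC x) addrK edotZl (addrC _ x).
have -> : edot (delta_mx 0 i) (D' x) = D' x 0 i.
  by rewrite /edot (bigD1 i)//= big1 ?addr0 ?mxE ?eqxx ?mul1r// => j ji; rewrite mxE (negPf ji) andbF mul0r.
move=> H; apply: (le_trans H); rewrite ler_wpM2l// -[leRHS]ger0_norm ?sqr_ge0// normrX lerXn2r ?nnegrE//.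
rewrite normrZ ler_piMr//.
by apply: rV_norm_le => // j; rewrite mxE; case: (_ && _); rewrite ?normr1 ?normr0.
Qed.

Lemma smooth_cube_sum (I : finType) (c : I -> R) (F : I -> 'rV[R]_d -> R) D K :
  (forall i, smooth_cube (F i) (D i) K) ->
  exists K', smooth_cube (fun x => \sum_i c i * F i x) (fun x => \sum_i c i *: D i x) K'.
Proof.
move=> sF; suff H (r : seq I) : exists K', smooth_cube (fun x => \sum_(i <- r) c i * F i x)
    (fun x => \sum_(i <- r) c i *: D i x) K' by exact: H.
elim: r => [|i r [K1 IH]].
  exists `|(0 : R)|; have := @smooth_cst R d 0; congr smooth_cube.
    by apply/funext => x; rewrite big_nil.
  by apply/funext => x; rewrite big_nil.
eexists; have := smoothD (smoothM (smooth_cst d (c i)) (sF i)) IH; congr smooth_cube.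
  by apply/funext => x; rewrite big_cons.
by apply/funext => x; rewrite big_cons scaler0 add0r.
Qed.

(** A segment cut into N + 1 pieces gives an increment of at most (N + 1) K / (N + 1)^2, which tends
    to 0; points of the closed cube are moved towards the centre. *)
Lemma smooth_grad0_cst (F : 'rV[R]_d -> R) D K x y : smooth_cube F D K -> (forall z, cube R d z -> D z = 0) ->
  ccube x -> ccube y -> F x = F y.
Proof.
move=> [K0 _ lipF hD] D0.
have in_cube u v : cube R d u -> cube R d v -> forall t : R, 0 <= t -> t <= 1 -> cube R d (u + t *: (v - u)).
  move=> cu cv t t0 t1 i; rewrite !mxE; have /andP[a1 a2] := cu i; have /andP[b1 b2] := cv i.
  by have [h|h] := leP (u 0 i) (v 0 i); apply/andP; split; nra.
have const u v : cube R d u -> cube R d v -> F u = F v.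
  move=> cu cv; apply/eqP; rewrite -subr_eq0 -normr_le0; apply/ler_addgt0Pr => e e0; rewrite add0r.
  pose p N (j : nat) := u + (j%:R / N.+1%:R) *: (v - u).
  have pc N j : (j <= N.+1)%N -> cube R d (p N j).
    move=> jN; apply: in_cube => //.
    by rewrite ler_pdivrMr ?ltr0n// mul1r ler_nat.
  have st N j : (j <= N.+1)%N -> `|F u - F (p N j)| <= j%:R * (K / N.+1%:R ^+ 2).
    elim: j => [|j IH] jN.
      by rewrite /p mul0r scale0r addr0 subrr normr0 mul0r.
    have -> : F u - F (p N j.+1) = (F u - F (p N j)) + (F (p N j) - F (p N j.+1)) by ring.
    apply: (le_trans (ler_normD _ _)); rewrite -natr1 mulrDl mul1r; apply: lerD; first exact: IH (ltnW jN).
    have := hD _ _ (cube_ccube (pc N j (ltnW jN))) (cube_ccube (pc N j.+1 jN)).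
    rewrite (D0 _ (pc N j.+1 jN)) edot0r subr0 => /le_trans; apply.
    rewrite ler_wpM2l// -exprVn lerXn2r ?nnegrE ?invr_ge0//.
    have -> : p N j - p N j.+1 = (- N.+1%:R^-1) *: (v - u).
      by rewrite /p opprD addrACA subrr add0r -scalerBl -mulrBl -natr1 opprD addNKr mulN1r.
    rewrite normrZ normrN ger0_norm ?invr_ge0// ler_piMr ?invr_ge0//.
    by apply: ccube_dist; apply: cube_ccube.
  have fin N : `|F u - F v| <= K / N.+1%:R.
    have := st N N.+1 (leqnn _); rewrite /p divff ?pnatr_eq0// scale1r addrCA subrr addr0.
    move=> /le_trans; apply; have : N.+1%:R != 0 :> R by rewrite pnatr_eq0.
    by move: (N.+1%:R) => z z0; rewrite le_eqVlt; apply/orP; left; apply/eqP; field.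
  have [N _ hN] : exists2 N : nat, True & K / N.+1%:R <= e.
    exists (Num.bound (K / e)) => //; rewrite ler_pdivrMr ?ltr0n// mulrC -ler_pdivrMr//.
    have := archi_boundP (divr_ge0 K0 (ltW e0)) => /ltW /le_trans; apply.
    by rewrite ler_nat.
  exact: le_trans (fin N) hN.
have near u : ccube u -> F u = F (center R d).
  move=> cu; apply/eqP; rewrite -subr_eq0 -normr_le0; apply/ler_addgt0Pr => e e0; rewrite add0r.
  pose t := Num.min 1 (e / (K + 1)).
  have K1 : 0 < K + 1 by lra.
  have t0 : 0 < t by rewrite lt_min ltr01 divr_gt0.
  have t1 : t <= 1 by rewrite ge_min lexx.
  have te : t <= e / (K + 1) by rewrite ge_min lexx orbT.
  pose z := u + t *: (center R d - u).
  have cz : cube R d z.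
    move=> i; rewrite !mxE; have /andP[a1 a2] := cu i.
    by apply/andP; split; nra.
  rewrite -(const z _ cz (@cube_center R d)).
  have [+ _] := lipF _ _ cu (cube_ccube cz); move/le_trans; apply.
  have -> : u - z = (- t) *: (center R d - u) by rewrite /z opprD addrA subrr add0r scaleNr.
  rewrite normrZ normrN gtr0_norm//.
  apply: (@le_trans _ _ (K * (t * 1))).
    rewrite ler_wpM2l// ler_wpM2l ?(ltW t0)//.
    exact: ccube_dist (cube_ccube (@cube_center R d)) cu.
  rewrite mulr1 mulrC; apply: (@le_trans _ _ (t * (K + 1))); first by rewrite ler_wpM2l ?(ltW t0)//; lra.
  by rewrite -ler_pdivlMr.
by move=> cx cy; rewrite (near x cx) (near y cy).
Qed.

End Gradient.

(** * Cells of a mesh *)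

Lemma secant_map_le (R : realType) d (T : 'rV[R]_d -> 'rV[R]_d) J kap Lam kap' Lam' :
  kap <= kap' -> Lam <= Lam' -> secant_map T J kap Lam -> secant_map T J kap' Lam'.
Proof.
move=> kk LL [k0 L0 ? ? ? ? hi hJ hl ?]; split => //.
- exact: lt_le_trans kk.
- exact: lt_le_trans LL.
- by move=> x y w cx cy; apply: (le_trans (hi x y w cx cy)); rewrite ler_wpM2r.
- by move=> x y w cx cy; apply: (le_trans (hJ x y w cx cy)); rewrite ler_wpM2r.
- by move=> x y w cx cy; apply: (le_trans (hl x y w cx cy)); rewrite ler_wpM2r// mulr_ge0.
Qed.

Lemma element_map_le (R : realType) d (T : 'rV[R]_d -> 'rV[R]_d) (delta h K kappa : R) :
  0 < delta -> 0 < h -> 0 < K -> h <= kappa * delta -> delta <= kappa * h ->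
  element_map T delta K -> element_map T h (K * kappa).
Proof.
move=> d0 h0 K0 hd dh [J [sm pos]]; exists J; split => //.
apply: secant_map_le sm.
  by rewrite -mulrA ler_pM2l// ler_pdivlMr// mulrC ler_pdivrMr.
by rewrite -mulrA ler_pM2l.
Qed.

Section Cells.
Variables (R : realType) (d : nat) (Omega : set 'rV[R]_d) (Th : mesh R d) (h K : R).
Hypothesis h0 : 0 < h.
Hypothesis K0 : 0 < K.
Hypothesis EM : forall t : 'I_(ncell Th), element_map (cell_map t) h K.
Hypothesis CM : conforming_mesh Omega Th.
Implicit Types t : 'I_(ncell Th).
Let mu := leb R d.

Lemma element_secant t : exists J, secant_map (cell_map t) J (K / h) (K * h).
Proof. by have [J []] := EM t; exists J. Qed.

Lemma cell_open t : open (cell t).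
Proof. by have [J sm] := element_secant t; exact: (sm_open sm). Qed.

Lemma cell_measurable t : measurable (cell t).
Proof. by apply: rV_open_measurable; exact: cell_open. Qed.

Lemma cell_closure t : closure (cell t) = cell_map t @` @ccube R d.
Proof. by have [J sm] := element_secant t; exact: (sm_closure sm). Qed.

Lemma cell_disjoint t t' : t != t' -> cell t `&` cell t' = set0.
Proof. by case: CM => _ _ _ dis _; exact: dis. Qed.

Lemma cell_trivIset (D : set 'I_(ncell Th)) : trivIset D (@cell R d Th).
Proof. by apply/trivIsetP => t t' _ _; exact: cell_disjoint. Qed.

Lemma cell_sub t : cell t `<=` Omega.
Proof. by case: CM => _ + _ _ _; exact. Qed.

Lemma cell_closure_sub t : closure (cell t) `<=` closure Omega.
Proof. exact: (closureS (@cell_sub t)). Qed.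

Lemma cell_closure_disjoint t t' y : cell t y -> closure (cell t') y -> t' = t.
Proof.
move=> cy cly; apply/eqP/negPn/negP => tt'; have := cell_disjoint tt'.
have [z [zt' zt]] := cly (cell t) (open_nbhs_nbhs (conj (@cell_open t) cy)).
by apply/eqP/set0P; exists z.
Qed.

Lemma leb_cell_le t : (mu (cell t) <= ((4 * (K * h)) ^+ d)%:E)%E.
Proof.
have [J sm] := element_secant t; have Kh : 0 < K * h by rewrite mulr_gt0.
have Kh2 : 0 < 2 * (K * h) by rewrite mulr_gt0.
rewrite (_ : 4 * (K * h) = 2 * (2 * (K * h))); last by ring.
rewrite -(leb_ball (cell_map t (center R d)) Kh2).
apply: le_measure; rewrite ?inE; first exact: cell_measurable.
  apply: rV_open_measurable; apply/rV_openP => y hy.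
  exists (2 * (K * h) - `|y - cell_map t (center R d)|); first by rewrite subr_gt0.
  move=> z hz /=; have -> : z - cell_map t (center R d) = (z - y) + (y - cell_map t (center R d)).
    by rewrite addrA subrK.
  by apply: (le_lt_trans (ler_normD _ _)); rewrite -ltrBrDr.
move=> _ [x cx <-] /=.
apply: (le_lt_trans (sm_diameter sm (cube_ccube cx) (cube_ccube (@cube_center R d)))).
by rewrite ltr_pMl// ltr1n.
Qed.

Lemma cell_fin t : (mu (cell t) < +oo)%E.
Proof. by apply: le_lt_trans (leb_cell_le t) _; rewrite ltry. Qed.

Lemma fine_leb_cell_le t : fine (mu (cell t)) <= (4 * (K * h)) ^+ d.
Proof.
rewrite -lee_fin fineK ?leb_cell_le// ge0_fin_numE ?measure_ge0//; exact: cell_fin.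
Qed.

Lemma bigcup_cellE : \bigcup_(t : 'I_(ncell Th)) cell t = \big[setU/set0]_(t < ncell Th) @cell R d Th t.
Proof.
rewrite -bigcup_seq; apply/seteqP; split => [y [t _ ty]|y [t _ ty]]; exists t => //=.
by rewrite mem_index_enum.
Qed.

(** f is controlled on the open elements only. Omega and their union differ by points of element
    boundaries, a null set, which [integral_setD_negligible] discards although f may fail to be
    measurable there. *)
Lemma Rint_cells (f : 'rV[R]_d -> R) : (forall t : 'I_(ncell Th), bmf (cell t) f) ->
  \int[mu]_(x in Omega) f x = \sum_(t < ncell Th) \int[mu]_(x in cell t) f x.
Proof.
move=> bf.
have /choice[N hN] : forall t, exists N, [/\ measurable N, mu N = 0%E &
    (cell_map t @` @ccube R d) `\` cell t `<=` N].
  by move=> t; have [J sm] := element_secant t; exact: (sm_skeleton_negligible sm).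
pose NN := \big[setU/set0]_(t < ncell Th) N t.
have [mNN NN0] : measurable NN /\ mu NN = 0%E.
  apply: (big_ind (fun A => measurable A /\ mu A = 0%E)) => [|A B [mA A0] [mB B0]|t _].
  - by split => //; exact: measure0.
  - by split; [exact: measurableU|rewrite measureU0].
  - by have [] := hN t.
have mf : measurable_fun (\big[setU/set0]_(t < ncell Th) @cell R d Th t) f.
  suff [] : measurable (\big[setU/set0]_(t < ncell Th) @cell R d Th t) /\
    measurable_fun (\big[setU/set0]_(t < ncell Th) @cell R d Th t) f by [].
  apply: (big_ind (fun A => measurable A /\ measurable_fun A f)) => [|A B [mA fA] [mB fB]|t _].
  - by split => //; exact: measurable_fun_set0.
  - by split; [exact: measurableU|apply/measurable_funU].
  - by split; [exact: cell_measurable|case: (bf t)].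
transitivity (fine (\int[mu]_(x in \bigcup_(t : 'I_(ncell Th)) cell t) (f x)%:E)).
  rewrite /Rintegral; congr fine.
  rewrite (integral_setD_negligible Omega _ mNN NN0) [RHS](integral_setD_negligible _ _ mNN NN0).
  congr (integral _ _ _); apply/seteqP; split => y [Oy Ny]; split => //; last first.
    by case: Oy => t _; exact: cell_sub.
  apply: contrapT => nc; apply: Ny.
  have : closure Omega y by exact: subset_closure.
  case: (CM) => _ _ -> _ _ [t _]; rewrite cell_closure => ty.
  rewrite /NN -bigcup_seq; exists t; first by rewrite /= mem_index_enum.
  by have [_ _] := hN t; apply; split => // cty; apply: nc; exists t.
rewrite bigcup_cellE integral_bigsetU_EFin//.
- rewrite /Rintegral (eq_bigr (fun t => (\int[mu]_(x in cell t) f x)%:E)).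
    by rewrite sumEFin.
  move=> t _; rewrite /Rintegral fineK//.
  apply: integrable_fin_num; first exact: cell_measurable.
  exact: (bmf_integrable (@cell_measurable t) (cell_fin t) (bf t)).
- exact: cell_measurable.
- exact: index_enum_uniq.
- exact: cell_trivIset.
- exact/measurable_EFinP.
Qed.

(** Volume count: the elements whose closures contain y contain disjoint balls of radius h / (8 K),
    all inside the ball of radius 2 K h about y, and the ratio of the radii is 16 K^2. *)
Lemma card_cells_at (y : 'rV[R]_d) :
  #|[set t : 'I_(ncell Th) | `[< closure (cell t) y >]]%SET|%:R <= (16 * K ^+ 2) ^+ d.
Proof.
set S := [set t | _]%SET.
have Kh : 0 < K * h by rewrite mulr_gt0.
have r0 : 0 < (8 * (K / h))^-1 by rewrite invr_gt0 mulr_gt0// divr_gt0.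
pose B t := [set z : 'rV[R]_d | `|z - cell_map t (center R d)| < (8 * (K / h))^-1].
have mball (c : 'rV[R]_d) (r : R) : measurable [set z : 'rV[R]_d | `|z - c| < r].
  apply: rV_open_measurable; apply/rV_openP => z /= hz.
  exists (r - `|z - c|); first by rewrite subr_gt0.
  move=> w hw /=; have -> : w - c = (w - z) + (z - c) by rewrite addrA subrK.
  by apply: (le_lt_trans (ler_normD _ _)); rewrite -ltrBrDr.
have Bc t : B t `<=` cell t.
  by have [J sm] := element_secant t => z; exact: (sm_contains_ball sm).
have tB : trivIset setT B.
  apply/trivIsetP => t t' _ _ tt'; apply/seteqP; split => // z [/Bc zt /Bc zt'].
  by rewrite -(cell_disjoint tt').
have sub : \big[setU/set0]_(t < ncell Th | t \in S) B t `<=` [set z | `|z - y| < 2 * (K * h)].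
  rewrite -bigcup_seq_cond => z [t /= /andP[_]]; rewrite inE => /asboolP clt /Bc zt.
  move: clt; rewrite cell_closure => -[x cx <-].
  have [J sm] := element_secant t; case: zt => x' cx' <-.
  by apply: (le_lt_trans (sm_diameter sm (cube_ccube cx') cx)); rewrite ltr_pMl// ltr1n.
have mU : measurable (\big[setU/set0]_(t < ncell Th | t \in S) B t).
  by apply: bigsetU_measurable => t _; exact: mball.
have := le_measure mu (mem_set mU) (mem_set (mball y (2 * (K * h)))) sub.
rewrite (measure_bigsetU_ord mu _ (fun t => mball _ _) tB).
pose Bb : set 'rV[R]_d := [set z | `|z - y| < 2 * (K * h)].
have E2 : (mu Bb <= ((2 * (2 * (K * h))) ^+ d)%:E)%E.
  by rewrite /mu leb_ball// mulr_gt0.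
move=> /le_trans /(_ E2).
rewrite (eq_bigr (fun=> ((2 * (8 * (K / h))^-1) ^+ d)%:E)); last by move=> t _; exact: leb_ball.
rewrite sumEFin lee_fin sumr_const -[leLHS]mulr_natr mulrC => H.
have -> : 16 * K ^+ 2 = (2 * (2 * (K * h))) / (2 * (8 * (K / h))^-1).
  by field; rewrite !gt_eqF.
by rewrite expr_div_n ler_pdivlMr// exprn_gt0// mulr_gt0.
Qed.

End Cells.

Section Extension.
Variables (R : realType) (d : nat).

Lemma cube_segment (x : 'rV[R]_d) (t : R) : ccube x -> 0 < t -> t <= 1 ->
  cube R d (x + t *: (center R d - x)).
Proof.
by move=> cx t0 t1 i; rewrite !mxE; have /andP[a1 a2] := cx i; apply/andP; split; nra.
Qed.

(** The polynomial form is given on open elements, whereas nodes may lie on their boundaries;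
    continuity of f carries the identity to the closed cube. *)
Lemma continuous_extension (T : 'rV[R]_d -> 'rV[R]_d) J kap Lam (A : set 'rV[R]_d) (f F : 'rV[R]_d -> R) D K :
  secant_map T J kap Lam -> T @` @ccube R d `<=` A -> {within A, continuous f} ->
  smooth_cube F D K -> (forall x, cube R d x -> f (T x) = F x) -> forall x, ccube x -> f (T x) = F x.
Proof.
move=> sm TA /subspace_continuousP cf [K0 _ lipF _] fF x cx.
have ATx y : ccube y -> A (T y) by move=> cy; apply: TA; exists y.
have /(_ _ (ATx _ cx)) /cvgrPdist_lt cfx := cf.
apply/eqP; rewrite -subr_eq0 -normr_le0; apply/ler_addgt0Pr => e e0; rewrite add0r.
have e2 : 0 < e / 2 by rewrite divr_gt0.
have : nbhs (T x) [set y | A y -> `|f (T x) - f y| < e / 2] by exact: (cfx _ e2).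
move=> /rV_nbhsP[del del0 hdel].
have L0 := sm_Lam sm.
pose t := Num.min 1 (Num.min (del / (2 * Lam)) (e / (2 * (K + 1)))).
have K1 : 0 < K + 1 by lra.
have t0 : 0 < t by rewrite !lt_min ltr01 !divr_gt0// mulr_gt0.
have t1 : t <= 1 by rewrite ge_min lexx.
have td : t <= del / (2 * Lam) by rewrite !ge_min lexx orbT.
have te : t <= e / (2 * (K + 1)) by rewrite !ge_min lexx !orbT.
pose z := x + t *: (center R d - x).
have cz : cube R d z by exact: cube_segment.
have cz' := cube_ccube cz.
have zx : `|z - x| <= t.
  rewrite /z addrC addKr normrZ gtr0_norm// ler_piMr ?(ltW t0)//.
  exact: ccube_dist (cube_ccube (@cube_center R d)) cx.
have zx' : `|x - z| <= t by rewrite distrC.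
have h1 : `|f (T x) - f (T z)| < e / 2.
  apply: hdel; last exact: ATx.
  apply: (le_lt_trans (sm_lipschitz sm cz' cx)).
  apply: (@le_lt_trans _ _ (Lam * t)); first by rewrite ler_wpM2l// ltW.
  apply: (@le_lt_trans _ _ (Lam * (del / (2 * Lam)))); first by rewrite ler_wpM2l// ltW.
  have -> : Lam * (del / (2 * Lam)) = del / 2 by field; rewrite gt_eqF.
  lra.
have [h2 _] := lipF _ _ cz' cx.
have h3 : K * `|z - x| <= e / 2.
  apply: (@le_trans _ _ ((K + 1) * (e / (2 * (K + 1))))).
    by apply: ler_pM => //; [lra|exact: le_trans te].
  have -> : (K + 1) * (e / (2 * (K + 1))) = e / 2 by field; rewrite gt_eqF.
  by [].
have -> : f (T x) - F x = (f (T x) - f (T z)) + (F z - F x) by rewrite (fF z cz); ring.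
apply: (le_trans (ler_normD _ _)).
have h4 := le_trans h2 h3; move: h1 h4; move: `|_| `|_| => a b; lra.
Qed.

End Extension.

(** * Nodal functions restricted to an element *)

Section Nodes.
Variables (R : realType) (n : nat) (s : 'I_n.+1 -> R).
Hypothesis ns : nodes1D s.

Lemma nodes_inj : injective s.
Proof.
move=> i j ij; case: ns => _ _ inc _; apply/val_inj/eqP; rewrite eqn_leq.
by apply/andP; split; rewrite leqNgt; apply/negP => /inc; rewrite ij ltxx.
Qed.

Lemma nodes_le (i j : 'I_n.+1) : (i <= j)%N -> s i <= s j.
Proof.
case: ns => _ _ inc _; rewrite leq_eqVlt => /orP[/eqP/val_inj ->//|/inc /ltW//].
Qed.

Variable d : nat.
Notation idx := {ffun 'I_d -> 'I_n.+1}.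
Implicit Types a b : idx.

Lemma lnode_ccube a : ccube (lnode s a).
Proof.
move=> i; rewrite mxE; case: ns => s0 s1 _ _.
by rewrite -{1}s0 -s1 !nodes_le// -ltnS.
Qed.

Definition interior_idx b := [forall m, (b m != ord0) && (b m != ord_max)].

Lemma lnode_cube b : interior_idx b -> cube R d (lnode s b).
Proof.
move=> /forallP ib i; rewrite mxE; case: ns => s0 s1 inc _; have /andP[h0 h1] := ib i.
rewrite -{1}s0 -s1; apply/andP; split; apply: inc.
  by rewrite lt0n; apply: contra h0 => /eqP h; apply/eqP/val_inj.
by rewrite ltn_neqAle -ltnS ltn_ord andbT; apply: contra h1 => /eqP h; apply/eqP/val_inj.
Qed.

Lemma cube_bdry (x : 'rV[R]_d) : ccube x -> ~ cube R d x -> exists m, x 0 m = 0 \/ x 0 m = 1.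
Proof.
move=> cx nc; apply: contrapT => h; apply: nc => i; have /andP[a1 a2] := cx i.
rewrite !lt_neqAle a1 a2 !andbT; apply/andP; split; apply/eqP => e; apply: h; exists i.
  by left.
by right.
Qed.

Lemma lagd_bdry b x : interior_idx b -> ccube x -> ~ cube R d x -> lagd s b x = 0.
Proof.
move=> /forallP ib cx nc; case: ns => s0 s1 _ _; have [m hm] := cube_bdry cx nc.
have /andP[h0 h1] := ib m; rewrite /lagd (bigD1 m)//=.
case: hm => ->; [rewrite -s0|rewrite -s1]; rewrite lag1_node ?mul0r//; try exact: nodes_inj.
  by rewrite eq_sym (negPf h0) mul0r.
by rewrite eq_sym (negPf h1) mul0r.
Qed.

Variables (Omega : set 'rV[R]_d) (Th : mesh R d) (h K : R).
Hypothesis EM : forall t : 'I_(ncell Th), element_map (cell_map t) h K.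
Hypothesis CM : conforming_mesh Omega Th.
Implicit Types t : 'I_(ncell Th).

Lemma piecewise_interp (f : 'rV[R]_d -> R) t x :
  {within closure Omega, continuous f} -> piecewise_Q n Th f -> ccube x ->
  f (cell_map t x) = \sum_a f (cell_map t (lnode s a)) * lagd s a x.
Proof.
move=> cf pf cx; have [P QP fP] := pf t; have tP := Qpoly_tensor QP.
have [D [KD sP]] := is_smooth_tensor tP.
have [J sm] := element_secant EM t.
have sub : cell_map t @` @ccube R d `<=` closure Omega.
  by rewrite -(cell_closure EM t); exact: (cell_closure_sub CM).
have ext := continuous_extension sm sub cf sP fP.
rewrite ext// (tensor_interp x nodes_inj tP); apply: eq_bigr => a _.
by rewrite ext//; exact: lnode_ccube.
Qed.

Lemma lnode_lagrange t a : lagrange_points s Th (cell_map t (lnode s a)).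
Proof. by exists t, a. Qed.

Lemma lnode_cell_inj t a b : cell_map t (lnode s a) = cell_map t (lnode s b) -> a = b.
Proof.
have [J sm] := element_secant EM t.
move=> /(sm_inj sm (lnode_ccube a) (lnode_ccube b)) E; apply/ffunP => m; apply: nodes_inj.
by have := congr1 (fun v : 'rV[R]_d => v 0 m) E; rewrite !mxE.
Qed.

Lemma lagrange_closure y : lagrange_points s Th y -> exists t, closure (cell t) y.
Proof.
move=> [t [a ->]]; exists t; rewrite (cell_closure EM); exists (lnode s a) => //.
exact: lnode_ccube.
Qed.

(** If y0 is no node of t, then f vanishes at all nodes of t, hence on its closure, and f y0 = 1
    shows that y0 is outside this closure. Thus a Lagrange point in the closure of an element is one
    of its nodes. *)
Lemma nodal_shape (f : 'rV[R]_d -> R) y0 t :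
  {within closure Omega, continuous f} -> piecewise_Q n Th f -> lagrange_points s Th y0 ->
  (forall y, lagrange_points s Th y -> f y = (y == y0)%:R) ->
  (exists a, y0 = cell_map t (lnode s a) /\ forall x, ccube x -> f (cell_map t x) = lagd s a x) \/
  (~ closure (cell t) y0 /\ forall x, ccube x -> f (cell_map t x) = 0).
Proof.
move=> cf pf ly0 nod; have [[a ya]|no] := pselect (exists a, y0 = cell_map t (lnode s a)).
  left; exists a; split => // x cx; rewrite (piecewise_interp t cf pf cx) (bigD1 a)//= big1 => [|b ba].
    by rewrite addr0 nod; [rewrite ya eqxx mul1r|exact: lnode_lagrange].
  rewrite nod; last exact: lnode_lagrange.
  case: eqP => [|_]; rewrite ?mul0r// => e; move: ba; rewrite ya in e.
  by rewrite (lnode_cell_inj e) eqxx.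
have z x : ccube x -> f (cell_map t x) = 0.
  move=> cx; rewrite (piecewise_interp t cf pf cx) big1// => b _; rewrite nod; last exact: lnode_lagrange.
  by case: eqP => [e|]; rewrite ?mul0r//; case: no; exists b.
right; split => // cl; move: cl; rewrite (cell_closure EM) => -[x cx xE].
by have := nod _ ly0; rewrite eqxx -{1}xE z// => /eqP; rewrite eq_sym oner_eq0.
Qed.

Lemma nodal_zero (f : 'rV[R]_d -> R) t :
  {within closure Omega, continuous f} -> piecewise_Q n Th f ->
  (forall y, lagrange_points s Th y -> f y = 0) -> forall x, ccube x -> f (cell_map t x) = 0.
Proof.
move=> cf pf nod x cx; rewrite (piecewise_interp t cf pf cx) big1// => b _.
by rewrite nod ?mul0r//; exact: lnode_lagrange.
Qed.

End Nodes.

Section BasisShapes.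
Variables (R : realType) (d k p : nat) (sv : 'I_k.+1 -> R) (sp : 'I_p.+1 -> R).
Hypothesis nsv : nodes1D sv.
Hypothesis nsp : nodes1D sp.
Variables (Omega : set 'rV[R]_d) (Th : mesh R d) (h K : R).
Hypothesis EM : forall t : 'I_(ncell Th), element_map (cell_map t) h K.
Hypothesis CM : conforming_mesh Omega Th.
Variables (Vb : velocity_basis sv Omega Th) (Pb : pressure_basis sp Omega Th).
Implicit Types t : 'I_(ncell Th).

Lemma velocity_shape (j : 'I_(vdim Vb)) t :
  (j \in vdof Vb t /\ exists a, vnode j = cell_map t (lnode sv a) /\
     forall i x, ccube x -> vcomp (vfun j) i (cell_map t x) = lagd sv a x * (i == vdir j)%:R) \/
  (j \notin vdof Vb t /\ forall i x, ccube x -> vcomp (vfun j) i (cell_map t x) = 0).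
Proof.
have cf i : {within closure Omega, continuous (vcomp (vfun j) i)}.
  apply: continuous_subspaceT => y.
  apply: (@continuous_comp _ _ _ (vfun j) (fun z : 'rV[R]_d => z 0 i) y).
    exact: vfun_continuous.
  exact: coord_continuous.
have pf i : piecewise_Q k Th (vcomp (vfun j) i) by have [] := vfun_V j i.
have [ly0 nb] : lagrange_points sv Th (vnode j) /\ ~ bdry Omega (vnode j).
  by apply/(vnode_range Vb (vnode j) (vdir j)); exists j.
have nod i y : lagrange_points sv Th y ->
    vcomp (vfun j) i y = (y == vnode j)%:R * (i == vdir j)%:R.
  move=> ly; rewrite /vcomp (vfun_nodal j ly); case: (y == vnode j); rewrite !mxE ?mul0r//.
  by rewrite eqxx mul1r.
have zer i t' x : i != vdir j -> ccube x -> vcomp (vfun j) i (cell_map t' x) = 0.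
  move=> ij; apply: (nodal_zero nsv EM CM t' (cf i) (pf i)) => // y ly.
  by rewrite nod// (negPf ij) mulr0.
have nod1 y : lagrange_points sv Th y -> vcomp (vfun j) (vdir j) y = (y == vnode j)%:R.
  by move=> ly; rewrite nod// eqxx mulr1.
have [[a [ya E]]|[ncl E]] := nodal_shape nsv EM CM t (cf (vdir j)) (pf (vdir j)) ly0 nod1.
  left; split.
    rewrite inE; apply/asboolP; rewrite (cell_closure EM); exists (lnode sv a) => //.
    exact: lnode_ccube.
  exists a; split => // i x cx; have [->|ij] := eqVneq i (vdir j); first by rewrite E// mulr1.
  by rewrite zer// mulr0.
right; split; first by rewrite inE; apply/asboolP.
move=> i x cx; have [->|ij] := eqVneq i (vdir j); first exact: E.
exact: zer.
Qed.

Lemma pressure_shape (i : 'I_(pdim Pb)) t :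
  (i \in pdof Pb t /\ exists a, pnode i = cell_map t (lnode sp a) /\
     forall x, ccube x -> pfun i (cell_map t x) = lagd sp a x) \/
  (i \notin pdof Pb t /\ forall x, ccube x -> pfun i (cell_map t x) = 0).
Proof.
have [cf pf] := pfun_Q i.
have ly0 : lagrange_points sp Th (pnode i) by apply/(pnode_range Pb); exists i.
have [[a [ya E]]|[ncl E]] := nodal_shape nsp EM CM t cf pf ly0 (@pfun_nodal _ _ _ _ _ _ Pb i).
  left; split; last by exists a.
  rewrite inE; apply/asboolP; rewrite (cell_closure EM); exists (lnode sp a) => //.
  exact: lnode_ccube.
by right; split => //; rewrite inE; apply/asboolP.
Qed.

Lemma card_vdof t : (#|vdof Vb t| <= k.+1 ^ d * d)%N.
Proof.
have /choice[a ha] : forall j : 'I_(vdim Vb), exists a : {ffun 'I_d -> 'I_k.+1}, j \in vdof Vb t ->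
    vnode j = cell_map t (lnode sv a).
  move=> j; have [[jt [a [ya _]]]|[jt _]] := velocity_shape j t; first by exists a.
  by exists [ffun=> ord0] => jt'; rewrite jt' in jt.
have inj : {in vdof Vb t &, injective (fun j => (a j, vdir j))}.
  move=> i j it jt [aij dij]; apply: (@vnode_inj _ _ _ _ _ _ Vb); congr pair => //.
  by rewrite (ha i it) (ha j jt) aij.
rewrite -(card_in_imset inj); apply: (leq_trans (max_card _)).
by rewrite card_prod card_ffun !card_ord.
Qed.

Lemma card_pdof t : (#|pdof Pb t| <= p.+1 ^ d)%N.
Proof.
have /choice[a ha] : forall i : 'I_(pdim Pb), exists a : {ffun 'I_d -> 'I_p.+1}, i \in pdof Pb t ->
    pnode i = cell_map t (lnode sp a).
  move=> i; have [[it [a [ya _]]]|[it _]] := pressure_shape i t; first by exists a.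
  by exists [ffun=> ord0] => it'; rewrite it' in it.
have inj : {in pdof Pb t &, injective a}.
  by move=> i j it jt aij; apply: (@pnode_inj _ _ _ _ _ _ Pb); rewrite (ha i it) (ha j jt) aij.
rewrite -(card_in_imset inj); apply: (leq_trans (max_card _)).
by rewrite card_ffun !card_ord.
Qed.

Lemma vdof_cover (j : 'I_(vdim Vb)) : exists t, j \in vdof Vb t.
Proof.
have [ly0 _] : lagrange_points sv Th (vnode j) /\ ~ bdry Omega (vnode j).
  by apply/(vnode_range Vb (vnode j) (vdir j)); exists j.
have [t ht] := lagrange_closure nsv EM ly0.
by exists t; rewrite inE; apply/asboolP.
Qed.

End BasisShapes.

(** * Element matrices *)

Lemma sqr_sum_le (R : realFieldType) n (a : 'I_n -> R) :
  (\sum_i a i) ^+ 2 <= n%:R * \sum_i a i ^+ 2.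
Proof.
have := @weighted_CS R _ (index_enum 'I_n) xpredT a (fun=> 1) (fun _ _ => ltr01).
by rewrite sumr_const card_ord; under [X in _ <= _ * X]eq_bigr do rewrite divr1.
Qed.

Lemma psdD (R : realFieldType) n (M N : 'M[R]_n) : psd M -> psd N -> psd (M + N).
Proof. by move=> hM hN x; rewrite qfD addr_ge0. Qed.

Lemma psdZ (R : realFieldType) n c (M : 'M[R]_n) : 0 <= c -> psd M -> psd (c *: M).
Proof. by move=> c0 hM x; rewrite qfZ mulr_ge0. Qed.

Lemma psd_sum (R : realFieldType) n I (r : seq I) (P : pred I) (M : I -> 'M[R]_n) :
  (forall i, P i -> psd (M i)) -> psd (\sum_(i <- r | P i) M i).
Proof. by move=> hM x; rewrite qf_sum sumr_ge0// => i Pi; exact: hM. Qed.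

Section LocalCalculus.
Variables (R : realType) (d : nat) (Th : mesh R d) (h K KL : R).
Hypothesis h0 : 0 < h.
Hypothesis K0 : 0 < K.
Hypothesis EM : forall t : 'I_(ncell Th), element_map (cell_map t) h K.
Implicit Types (t : 'I_(ncell Th)) (f g : 'rV[R]_d -> R).

(** On the closed element, f is the transport of a function on the reference cube with the bound KL,
    the same for all elements. *)
Definition loc t f := exists F D, smooth_cube F D KL /\
  forall x, ccube x -> f (cell_map t x) = F x.

Lemma loc_bound t f y : loc t f -> cell t y -> `|f y| <= KL.
Proof.
move=> [F [D [sF fF]]] [x cx <-]; apply: (pullback_bound sF _ cx) => z /cube_ccube; exact: fF.
Qed.

Lemma loc_bmf t f : loc t f -> bmf (cell t) f.
Proof.
move=> lf; split; last by exists KL => y; exact: loc_bound.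
have [F [D [sF fF]]] := lf; have [J sm] := element_secant EM t.
by apply: (pullback_measurable sm sF) => z /cube_ccube; exact: fF.
Qed.

(** The inverse estimate: one derivative costs a factor K / h. *)
Definition grad_bound := d%:R * (K / h * KL).

Lemma loc_partial_bound t f i y : 0 <= KL -> loc t f -> cell t y -> `|partial i f y| <= grad_bound.
Proof.
move=> KL0 [F [D [sF fF]]] [x cx <-]; have [J sm] := element_secant EM t.
have fF' z : cube R d z -> f (cell_map t z) = F z by move=> /cube_ccube; exact: fF.
apply: (le_trans (pullback_derivative_bound sm sF fF' (delta_mx 0 i) cx)).
have kh : 0 <= K / h by rewrite divr_ge0 ?ltW.
rewrite /grad_bound ler_wpM2l// ler_wpM2r// ler_piMr//.
by apply: rV_norm_le => // j; rewrite mxE; case: (_ && _); rewrite ?normr1 ?normr0.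
Qed.

Lemma loc_partial_bmf t f i : 0 <= KL -> loc t f -> bmf (cell t) (partial i f).
Proof.
move=> KL0 lf; split; last by exists grad_bound => y; exact: loc_partial_bound.
have [F [D [sF fF]]] := lf; have [J sm] := element_secant EM t.
by apply: (pullback_derivative_measurable sm sF) => z /cube_ccube; exact: fF.
Qed.

Lemma loc0 t f y : (forall x, ccube x -> f (cell_map t x) = 0) -> cell t y ->
  f y = 0 /\ forall i, partial i f y = 0.
Proof.
move=> f0 [x cx <-]; have [J sm] := element_secant EM t; split; first exact/f0/cube_ccube.
move=> i; have f0' z : cube R d z -> f (cell_map t z) = (fun=> 0) z by move=> /cube_ccube; exact: f0.
rewrite /partial; have [_ ->] := pullback_derivative sm (smooth_cst d 0) f0' (delta_mx 0 i) cx.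
by rewrite edot0r.
Qed.

Lemma Rint_eq0 t g : (forall y, cell t y -> g y = 0) -> \int[leb R d]_(y in cell t) g y = 0.
Proof.
move=> g0; transitivity (\int[leb R d]_(y in cell t) (0 : R)).
  by apply: eq_Rintegral => y; rewrite inE => /g0.
by rewrite Rint0//; exact: (cell_measurable EM).
Qed.

Lemma gram_psd n t (g : 'I_n -> 'rV[R]_d -> R) : (forall i, bmf (cell t) (g i)) ->
  psd (\matrix_(i, j) \int[leb R d]_(y in cell t) (g j y * g i y)).
Proof.
move=> bg x; have mc := @cell_measurable _ _ _ _ _ EM t; have fc := cell_fin h0 K0 EM t.
rewrite qfE.
have -> : \sum_i \sum_j x i 0 * (\matrix_(i, j) \int[leb R d]_(y in cell t) (g j y * g i y)) i j * x j 0
    = \int[leb R d]_(y in cell t) ((\sum_i x i 0 * g i y) ^+ 2).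
  rewrite (@eq_Rintegral _ _ _ (leb R d) _ (fun y => \sum_i \sum_j (x i 0 * x j 0) * (g j y * g i y))).
    rewrite Rint_sum//; last first.
      by move=> i _; apply: bmf_sum => // j _; apply: bmfZ => //; exact: bmfM.
    apply: eq_bigr => i _; rewrite Rint_sum//; last by move=> j _; apply: bmfZ => //; exact: bmfM.
    apply: eq_bigr => j _; rewrite RintZ//; last exact: bmfM.
    by rewrite mxE mulrAC.
  move=> y _; rewrite expr2 mulr_suml; apply: eq_bigr => i _; rewrite mulr_sumr.
  by apply: eq_bigr => j _; ring.
by apply: Rint_ge0 => // y _; exact: sqr_ge0.
Qed.

End LocalCalculus.

Section LocalMatrices.
Variables (R : realType) (d k p : nat) (sv : 'I_k.+1 -> R) (sp : 'I_p.+1 -> R).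
Hypothesis nsv : nodes1D sv.
Hypothesis nsp : nodes1D sp.
Variables (Omega : set 'rV[R]_d) (Th : mesh R d) (h K KL : R).
Hypothesis h0 : 0 < h.
Hypothesis K0 : 0 < K.
Hypothesis KL0 : 0 < KL.
Hypothesis EM : forall t : 'I_(ncell Th), element_map (cell_map t) h K.
Hypothesis CM : conforming_mesh Omega Th.
Variables (Vb : velocity_basis sv Omega Th) (Pb : pressure_basis sp Omega Th).
Variables (DLv : {ffun 'I_d -> 'I_k.+1} -> 'rV[R]_d -> 'rV[R]_d).
Variables (DLp : {ffun 'I_d -> 'I_p.+1} -> 'rV[R]_d -> 'rV[R]_d).
Hypothesis sLv : forall a, smooth_cube (lagd sv a) (DLv a) KL.
Hypothesis sLp : forall a, smooth_cube (lagd sp a) (DLp a) KL.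
Variables (mu rho gamma : R).
Hypothesis mu0 : 0 < mu.
Hypothesis gr0 : 0 <= gamma * rho.
Implicit Types t : 'I_(ncell Th).

Let mc t : measurable (cell t). Proof. exact: (cell_measurable EM). Qed.
Let fc t : (leb R d (cell t) < +oo)%E. Proof. exact: (cell_fin h0 K0 EM t). Qed.
Let KL0' : 0 <= KL := ltW KL0.

Lemma smooth_cube0 : smooth_cube (fun=> 0) (fun=> 0 : 'rV[R]_d) KL.
Proof. by apply: smooth_cube_le (smooth_cst d 0); rewrite normr0. Qed.

Lemma loc_velocity t (j : 'I_(vdim Vb)) i : loc KL t (vcomp (vfun j) i).
Proof.
have [[_ [a [_ E]]]|[_ E]] := velocity_shape nsv EM CM j t; last first.
  by exists (fun=> 0), (fun=> 0); split; [exact: smooth_cube0|move=> x; exact: E].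
case ij : (i == vdir j).
  by exists (lagd sv a), (DLv a); split => // x cx; rewrite E// ij mulr1.
exists (fun=> 0), (fun=> 0); split; first exact: smooth_cube0.
by move=> x cx; rewrite E// ij mulr0.
Qed.

Lemma loc_pressure t (i : 'I_(pdim Pb)) : loc KL t (pfun i).
Proof.
have [[_ [a [_ E]]]|[_ E]] := pressure_shape nsp EM CM i t; last first.
  by exists (fun=> 0), (fun=> 0); split; [exact: smooth_cube0|move=> x; exact: E].
by exists (lagd sp a), (DLp a); split.
Qed.

Let bv t (j : 'I_(vdim Vb)) i : bmf (cell t) (vcomp (vfun j) i).
Proof. exact: (loc_bmf EM (loc_velocity t j i)). Qed.
Let bdv t (j : 'I_(vdim Vb)) i q : bmf (cell t) (partial q (vcomp (vfun j) i)).
Proof. exact: (loc_partial_bmf h0 K0 EM q KL0' (loc_velocity t j i)). Qed.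
Let bp t (i : 'I_(pdim Pb)) : bmf (cell t) (pfun i).
Proof. exact: (loc_bmf EM (loc_pressure t i)). Qed.

(** Element matrices in the global numbering, zero off the degrees of freedom of t; [elt_a] and
    [elt_b] are their restrictions to these. *)
Definition loc_a t : 'M[R]_(vdim Vb) :=
  \matrix_(i, j) form_a mu rho gamma (cell t) (vfun j) (vfun i).
Definition loc_b t : 'M[R]_(pdim Pb, vdim Vb) :=
  \matrix_(i, j) form_b (cell t) (vfun j) (pfun i).
Definition loc_m t (i : 'I_(pdim Pb)) : R := \int[leb R d]_(y in cell t) (pfun i y * pfun i y).

Lemma bmf_div t (j : 'I_(vdim Vb)) : bmf (cell t) (fun y => \sum_i partial i (vcomp (vfun j) i) y).
Proof. by apply: bmf_sum => // i _; exact: bdv. Qed.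

Lemma bmf_form_a t (i j : 'I_(vdim Vb)) : bmf (cell t) (fun y =>
  mu * (\sum_p \sum_q partial q (vcomp (vfun j) p) y * partial q (vcomp (vfun i) p) y)
     + gamma * rho * edot (vfun j y) (vfun i y)).
Proof.
apply: bmfD => //; apply: bmfZ => //.
  by apply: bmf_sum => // r _; apply: bmf_sum => // q _; apply: bmfM => //; exact: bdv.
apply: (@bmf_sum _ _ _ (cell t) _ (index_enum _) xpredT (fun r y => vcomp (vfun j) r y * vcomp (vfun i) r y)) => // r _.
by apply: bmfM => //; exact: bv.
Qed.

Let gram t (g : 'I_(vdim Vb) -> 'rV[R]_d -> R) : 'M[R]_(vdim Vb) :=
  \matrix_(i, j) \int[leb R d]_(y in cell t) (g j y * g i y).

Lemma loc_a_gram t : loc_a t =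
  mu *: (\sum_r \sum_q gram t (fun j => partial q (vcomp (vfun j) r))) +
  (gamma * rho) *: \sum_r gram t (fun j => vcomp (vfun j) r).
Proof.
apply/matrixP => i j; rewrite mxE /form_a (RintD (mc t) (fc t))//; last 2 first.
- apply: bmfZ => //; apply: bmf_sum => // r _; apply: bmf_sum => // q _; apply: bmfM => //; exact: bdv.
- apply: bmfZ => //.
  apply: (@bmf_sum _ _ _ (cell t) _ (index_enum _) xpredT (fun r y => vcomp (vfun j) r y * vcomp (vfun i) r y)) => // r _.
  by apply: bmfM => //; exact: bv.
rewrite [RHS]mxE; congr (_ + _); rewrite (RintZ (mc t) (fc t))//.
- rewrite mxE summxE; congr (_ * _); rewrite (Rint_sum (mc t) (fc t))//.
    apply: eq_bigr => r _; rewrite summxE (Rint_sum (mc t) (fc t))//; first by apply: eq_bigr => q _; rewrite mxE.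
    by move=> q _; apply: bmfM => //; exact: bdv.
  by move=> r _; apply: bmf_sum => // q _; apply: bmfM => //; exact: bdv.
- by apply: bmf_sum => // r _; apply: bmf_sum => // q _; apply: bmfM => //; exact: bdv.
- rewrite mxE summxE; congr (_ * _).
  rewrite (@Rint_sum _ _ _ (leb R d) (cell t) (mc t) (fc t) _ (index_enum _) xpredT (fun r y => vcomp (vfun j) r y * vcomp (vfun i) r y)).
    by apply: eq_bigr => r _; rewrite mxE.
  by move=> r _; apply: bmfM => //; exact: bv.
- apply: (@bmf_sum _ _ _ (cell t) _ (index_enum _) xpredT (fun r y => vcomp (vfun j) r y * vcomp (vfun i) r y)) => // r _.
  by apply: bmfM => //; exact: bv.
Qed.

Lemma loc_a_sym t : (loc_a t)^T = loc_a t.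
Proof.
apply/matrixP => i j; rewrite !mxE; apply: eq_Rintegral => y _; congr (mu * _ + _ * _).
  by apply: eq_bigr => r _; apply: eq_bigr => q _; rewrite mulrC.
by apply: eq_bigr => r _; rewrite mulrC.
Qed.

Lemma loc_a_psd t : psd (loc_a t).
Proof.
rewrite loc_a_gram; apply: psdD; apply: psdZ => //; first exact: ltW.
  apply: psd_sum => r _; apply: psd_sum => q _; apply: (gram_psd h0 K0 EM) => j; exact: bdv.
by apply: psd_sum => r _; apply: (gram_psd h0 K0 EM) => j; exact: bv.
Qed.

Lemma loc_a_energy t j :
  mu * \sum_r \sum_q \int[leb R d]_(y in cell t) (partial q (vcomp (vfun j) r) y ^+ 2) <= loc_a t j j.
Proof.
rewrite loc_a_gram !mxE !summxE; apply: (@le_trans _ _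
  (mu * \sum_r (\sum_q gram t (fun j => partial q (vcomp (vfun j) r))) j j)).
  rewrite ler_wpM2l ?(ltW mu0)// le_eqVlt; apply/orP; left; apply/eqP.
  by apply: eq_bigr => r _; rewrite summxE; apply: eq_bigr => q _; rewrite mxE.
rewrite lerDl mulr_ge0// sumr_ge0// => r _; rewrite mxE; apply: Rint_ge0 => // y _.
by rewrite -expr2 sqr_ge0.
Qed.

Lemma mat_a_sum : mat_a mu rho gamma Vb = \sum_t loc_a t.
Proof.
apply/matrixP => i j; rewrite mxE summxE /form_a (Rint_cells h0 K0 EM CM).
  by apply: eq_bigr => t _; rewrite mxE.
by move=> t; exact: bmf_form_a.
Qed.

Lemma mat_b_sum : mat_b Vb Pb = \sum_t loc_b t.
Proof.
apply/matrixP => i j; rewrite mxE summxE /form_b (Rint_cells h0 K0 EM CM).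
  by apply: eq_bigr => t _; rewrite mxE.
by move=> t; apply: bmfM => //; exact: bmf_div.
Qed.

Lemma mass_sum i : mass_p Pb i i = \sum_t loc_m t i.
Proof.
by rewrite mxE (Rint_cells h0 K0 EM CM)// => t; apply: bmfM.
Qed.

Lemma loc_a_supp t i j : i \notin vdof Vb t -> loc_a t i j = 0.
Proof.
move=> it; have [[it' _]|[_ E]] := velocity_shape nsv EM CM i t; first by rewrite it' in it.
rewrite mxE; apply: (Rint_eq0 EM) => y cy.
rewrite big1 => [|r _]; last first.
  by rewrite big1// => q _; have [_ ->] := loc0 EM (E r) cy; rewrite mulr0.
rewrite mulr0 add0r /edot big1 ?mulr0// => r _.
by have [+ _] := loc0 EM (E r) cy; rewrite /vcomp => ->; rewrite mulr0.
Qed.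

Lemma loc_b_suppv t i j : j \notin vdof Vb t -> loc_b t i j = 0.
Proof.
move=> jt; have [[jt' _]|[_ E]] := velocity_shape nsv EM CM j t; first by rewrite jt' in jt.
rewrite mxE; apply: (Rint_eq0 EM) => y cy.
by rewrite big1 ?mulr0// => r _; have [_ ->] := loc0 EM (E r) cy.
Qed.

Lemma loc_b_suppp t i j : i \notin pdof Pb t -> loc_b t i j = 0.
Proof.
move=> it; have [[it' _]|[_ E]] := pressure_shape nsp EM CM i t; first by rewrite it' in it.
rewrite mxE; apply: (Rint_eq0 EM) => y cy.
by have [-> _] := loc0 EM E cy; rewrite mul0r.
Qed.

Lemma loc_m_ge0 t i : 0 <= loc_m t i.
Proof. by apply: Rint_ge0 => // y _; rewrite -expr2 sqr_ge0. Qed.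

(** After Cauchy-Schwarz for the integral, the square of the divergence is at most d times the sum
    of the squares of its d terms, which are part of the energy. *)
Lemma loc_b_bound t i j : loc_b t i j ^+ 2 <= d%:R / mu * loc_a t j j * loc_m t i.
Proof.
rewrite mxE /form_b; apply: (le_trans (Rint_CS (mc t) (fc t) (bp t i) (bmf_div t j))).
have -> : \int[leb R d]_(y in cell t) (pfun i y ^+ 2) = loc_m t i.
  by apply: eq_Rintegral => y _; rewrite expr2.
rewrite mulrC; apply: ler_wpM2r; first exact: loc_m_ge0.
have b2 r q : bmf (cell t) (fun y => partial q (vcomp (vfun j) r) y ^+ 2) by apply: bmfX => //; exact: bdv.
apply: (@le_trans _ _ (\int[leb R d]_(y in cell t) (d%:R * \sum_r partial r (vcomp (vfun j) r) y ^+ 2))).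
  apply: (Rint_le (mc t) (fc t)) => //.
  - by apply: bmfX => //; exact: bmf_div.
  - by apply: bmfZ => //; apply: bmf_sum => // r _; exact: b2.
  - by move=> y _; exact: sqr_sum_le.
rewrite (RintZ (mc t) (fc t))//; last by apply: bmf_sum => // r _; exact: b2.
rewrite (Rint_sum (mc t) (fc t))//.
rewrite -mulrA ler_wpM2l// ler_pdivlMl//; apply: le_trans (loc_a_energy t j).
rewrite ler_wpM2l ?(ltW mu0)//; apply: ler_sum => r _; rewrite (bigD1 r)//= lerDl.
by apply: sumr_ge0 => q _; apply: Rint_ge0 => // y _; exact: sqr_ge0.
Qed.

Lemma loc_m_le t i : loc_m t i <= KL ^+ 2 * (4 * (K * h)) ^+ d.
Proof.
apply: (@le_trans _ _ (KL ^+ 2 * fine (leb R d (cell t)))).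
  apply: (Rint_le_bound (mc t) (fc t)) => //; first exact: bmfM.
  move=> y cy; apply: le_trans (ler_norm _) _; rewrite normrM -expr2.
  by rewrite lerXn2r ?nnegrE// (loc_bound (loc_pressure t i) cy).
by rewrite ler_wpM2l ?sqr_ge0// (fine_leb_cell_le h0 K0 EM).
Qed.

Lemma loc_a_le t j : loc_a t j j <=
  (mu * (d * d)%:R * (grad_bound d h K KL) ^+ 2 + gamma * rho * (d%:R * KL ^+ 2)) * (4 * (K * h)) ^+ d.
Proof.
set M := _ + _; apply: (@le_trans _ _ (M * fine (leb R d (cell t)))).
  rewrite mxE; apply: (Rint_le_bound (mc t) (fc t)) => //; first exact: bmf_form_a.
  move=> y cy; apply: lerD.
    rewrite -mulrA ler_wpM2l ?(ltW mu0)//.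
    apply: (@le_trans _ _ (\sum_(r < d) \sum_(q < d) (grad_bound d h K KL) ^+ 2)).
      apply: ler_sum => r _; apply: ler_sum => q _.
      apply: le_trans (ler_norm _) _; rewrite normrM -expr2 lerXn2r ?nnegrE//.
        by rewrite /grad_bound mulr_ge0// mulr_ge0// divr_ge0// ltW.
      exact: (loc_partial_bound h0 K0 EM q KL0' (loc_velocity t j r) cy).
    by rewrite !sumr_const !card_ord -mulrnA mulr_natl.
  rewrite ler_wpM2l//; apply: (@le_trans _ _ (\sum_(r < d) KL ^+ 2)).
    apply: ler_sum => r _; apply: le_trans (ler_norm _) _; rewrite normrM -expr2 lerXn2r ?nnegrE//.
    exact: (loc_bound (loc_velocity t j r) cy).
  by rewrite sumr_const card_ord mulr_natl.
apply: ler_wpM2l; last exact: (fine_leb_cell_le h0 K0 EM).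
have m0 := ltW mu0; rewrite /M; apply: addr_ge0.
  by rewrite mulr_ge0 ?sqr_ge0// mulr_ge0.
by rewrite mulr_ge0// mulr_ge0// sqr_ge0.
Qed.

Lemma gradient_eq0 (J : 'M[R]_d) (v : 'rV[R]_d) : J \in unitmx ->
  (forall q, edot (delta_mx 0 q *m invmx J) v = 0) -> v = 0.
Proof.
move=> uJ hq; have E : invmx J *m v^T = 0.
  apply/matrixP => q z; rewrite ord1 [RHS]mxE -(hq q) -rowE /edot mxE.
  by apply: eq_bigr => i _; rewrite !mxE.
by have := congr1 (fun w => (J *m w)^T) E; rewrite mulKVmx// trmxK mulmx0 trmx0.
Qed.

Hypothesis k1 : (0 < k)%N.
Hypothesis d1 : (0 < d)%N.

(** If the energy vanishes, the gradient vanishes almost everywhere, hence on the whole open cube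
    because it is Lipschitz. The shape function would be constant, but it is 1 at its own node and 0
    at another. *)
Lemma loc_a_pos t j : j \in vdof Vb t -> 0 < loc_a t j j.
Proof.
move=> jt; have [[_ [a [_ E]]]|[jt' _]] := velocity_shape nsv EM CM j t; last by rewrite jt in jt'.
set f := vcomp (vfun j) (vdir j).
have fL x : ccube x -> f (cell_map t x) = lagd sv a x by move=> cx; rewrite /f E// eqxx mulr1.
have fL' x : cube R d x -> f (cell_map t x) = lagd sv a x by move=> /cube_ccube; exact: fL.
rewrite ltNge; apply/negP => le0.
have I0 q : \int[leb R d]_(y in cell t) (partial q f y ^+ 2) = 0.
  apply/eqP; rewrite eq_le; apply/andP; split; last by apply: Rint_ge0 => // y _; exact: sqr_ge0.
  rewrite -(pmulr_rle0 _ mu0); apply: le_trans le0; apply: le_trans (loc_a_energy t j).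
  rewrite ler_wpM2l ?(ltW mu0)// (bigD1 (vdir j))//= (bigD1 q)//= -addrA lerDl.
  by apply: addr_ge0; apply: sumr_ge0 => r _; [|apply: sumr_ge0 => r' _]; apply: Rint_ge0 => // y _; exact: sqr_ge0.
have /choice[N hN] : forall q, exists N, [/\ measurable N, leb R d N = 0%E &
    forall y, cell t y -> ~ N y -> partial q f y ^+ 2 = 0].
  move=> q; apply: (Rint_eq0_negligible (mc t) (fc t)) => //; last by move=> y _; exact: sqr_ge0.
  by apply: bmfX => //; exact: bdv.
pose NN := \big[setU/set0]_(q < d) N q.
have [mNN NN0] : measurable NN /\ leb R d NN = 0%E.
  apply: (big_ind (fun A => measurable A /\ leb R d A = 0%E)) => [|A B [mA A0] [mB B0]|q _].
  - by split => //; exact: measure0.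
  - by split; [exact: measurableU|rewrite measureU0].
  - by have [] := hN q.
have [J sm] := element_secant EM t.
have D0 x : cube R d x -> ~ NN (cell_map t x) -> DLv a x = 0.
  move=> cx nN; apply: (gradient_eq0 (sm_unit sm (cube_ccube cx) (cube_ccube cx))) => q.
  have [_ <-] := pullback_derivative sm (sLv a) fL' (delta_mx 0 q) cx.
  apply/eqP; rewrite -sqrf_eq0; apply/eqP; have [_ _] := hN q; apply; first by exists x.
  by move=> Nq; apply: nN; rewrite /NN -bigcup_seq; exists q => //=; rewrite mem_index_enum.
have D0' x : cube R d x -> DLv a x = 0.
  move=> cx; apply/rowP => i; rewrite [RHS]mxE.
  apply: (@eq0_off_negligible _ _ _ _ _ _ sm NN (fun z => DLv a z 0 i) KL mNN NN0 _ _ x cx).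
    move=> y z cy cz; have [_ _ lip _] := sLv a; have [_ h2] := lip _ _ cy cz.
    by apply: le_trans h2; have := coord_le_norm (DLv a y - DLv a z) i; rewrite !mxE.
  by move=> z cz nz; rewrite D0// mxE.
pose m0 := Ordinal d1.
(* A node other than that of a, obtained by changing the first index to one of the two ends, which
   [k1] makes distinct. *)
pose b : {ffun 'I_d -> 'I_k.+1} := [ffun m => if m == m0 then (if a m0 == ord0 then ord_max else ord0) else a m].
have ab : a != b.
  apply/eqP => /(congr1 (fun z : {ffun _ -> _} => z m0)); rewrite ffunE eqxx.
  case: eqP => [-> /(congr1 val) /= k0|//]; by move: k1; rewrite -k0.
have := smooth_grad0_cst (sLv a) D0' (lnode_ccube nsv a) (lnode_ccube nsv b).
rewrite !(lagd_node (nodes_inj nsv)) eqxx eq_sym (negPf ab) => /eqP.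
by rewrite oner_eq0.
Qed.

End LocalMatrices.

(** * Pinning the pressure diagonals by interior velocity functions *)

(** F composed with the inverse of T on the open element; off it, [xget] returns its default 0 and
    the value is F 0. *)
Definition pull (R : realType) d (T : 'rV[R]_d -> 'rV[R]_d) (F : 'rV[R]_d -> R) (y : 'rV[R]_d) : R :=
  F (xget 0 [set x | cube R d x /\ T x = y]).

Lemma pullE (R : realType) d (T : 'rV[R]_d -> 'rV[R]_d) J kap Lam F x :
  secant_map T J kap Lam -> cube R d x -> pull T F (T x) = F x.
Proof.
move=> sm cx; rewrite /pull; case: xgetP => [x' _ [cx' Tx']|/(_ x)]; last by case.
by rewrite (sm_inj sm (cube_ccube cx') (cube_ccube cx) Tx').
Qed.

Section Bubble.
Variables (R : realType) (d p : nat) (sp : 'I_p.+1 -> R) (sv : 'I_p.+2 -> R).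
Hypothesis nsv : nodes1D sv.
Hypothesis nsp : nodes1D sp.
Hypothesis p0 : (0 < p)%N.
Variable a : {ffun 'I_d -> 'I_p.+1}.

Let c (m : 'I_d) : bool := a m == ord_max.
(** The Lagrange polynomial of index [a m] vanishes at 0 if [a m] is the last index and at 1
    otherwise; [zeta m] vanishes at the other end point. So [bubble] vanishes on the whole boundary,
    and its degree p + 1 in each coordinate is exactly the velocity degree. *)
Definition zeta (m : 'I_d) : {poly R} := if c m then 1 - 'X else 'X.
Definition xi (x : 'rV[R]_d) : R := \prod_m (zeta m).[x 0 m].
Definition bubble (x : 'rV[R]_d) : R := lagd sp a x * xi x.

Lemma zetaE m t : (zeta m).[t] = if c m then 1 - t else t.
Proof. by rewrite /zeta; case: (c m); rewrite !hornerE. Qed.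

Lemma is_smooth_xi : is_smooth xi.
Proof. by apply: is_smooth_prod => m _; exact: is_smooth_horner. Qed.

Lemma bubble_tensor : tensor_poly p.+1 bubble.
Proof.
have -> : bubble = fun x => \prod_m (lag1 sp (a m) * zeta m).[x 0 m].
  by apply/funext => x; rewrite /bubble /lagd /xi -big_split; apply: eq_bigr => m _; rewrite hornerM.
apply: tensor_prod => m; apply: (leq_trans (size_polyMleq _ _)).
have sz : (size (zeta m) <= 2)%N.
  rewrite /zeta; case: (c m); last by rewrite size_polyX.
  by apply: (leq_trans (size_polyD _ _)); rewrite size_poly1 size_polyN size_polyX.
by have := size_lag1 sp (a m); lia.
Qed.

Lemma bubble_bdry x : ccube x -> ~ cube R d x -> bubble x = 0.
Proof.
move=> cx nc; have [m hm] := cube_bdry cx nc; have [s0 s1 _ _] := nsp.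
rewrite /bubble /lagd /xi (bigD1 m)//= [X in _ * X](bigD1 m)//= zetaE.
have om : ord_max != ord0 :> 'I_p.+1 by rewrite -val_eqE /= -lt0n.
case cm : (c m); case: hm => hm; rewrite hm ?subrr ?mul0r ?mulr0//.
  rewrite -s0 (eqP cm) lag1_node ?(nodes_inj nsp)//; last exact: nodes_inj.
  by rewrite eq_sym (negPf om) !mul0r.
rewrite -{1}s1 lag1_node; last exact: nodes_inj.
by rewrite eq_sym; move: cm; rewrite /c => ->; rewrite !mul0r.
Qed.

Lemma bubble_interp x : bubble x =
  \sum_(b : {ffun 'I_d -> 'I_p.+2} | interior_idx b) bubble (lnode sv b) * lagd sv b x.
Proof.
rewrite (tensor_interp x (nodes_inj nsv) bubble_tensor) [RHS]big_mkcond; apply: eq_bigr => b _.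
case: ifPn => // nb; rewrite bubble_bdry ?mul0r//; first exact: lnode_ccube.
move=> cb; move/negP: nb; apply; apply/forallP => m; have := cb m; rewrite mxE.
have [s0 s1 _ _] := nsv; move=> /andP[b0 b1]; apply/andP; split; apply/eqP => e.
  by move: b0; rewrite e s0 ltxx.
by move: b1; rewrite e s1 ltxx.
Qed.

(** Along each coordinate axis xi is affine, so the remainder in [smooth_partial] is 0. *)
Lemma xi_gradient D K x u : smooth_cube xi D K -> cube R d x -> edot u (D x) = gradient_xi c x u.
Proof.
move=> sx cx; rewrite /edot /gradient_xi; apply: eq_bigr => i _; congr (_ * _).
apply: (smooth_partial sx cx (lexx 0)) => t _ _; rewrite mul0r normr_le0; apply/eqP.
rewrite /xi (bigD1 i)//= [X in _ - X - _](bigD1 i)//= !zetaE !mxE !eqxx /=.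
have -> : \prod_(j | j != i) (zeta j).[(x + t *: delta_mx 0 i) 0 j] = \prod_(j | j != i) (zeta j).[x 0 j].
  by apply: eq_bigr => j ji; rewrite !mxE (negPf ji) andbF mulr0 addr0.
have -> : \prod_(j | j != i) (if c j then 1 - x 0 j else x 0 j) = \prod_(j | j != i) (zeta j).[x 0 j].
  by apply: eq_bigr => j ji; rewrite zetaE.
by case: (c i); rewrite mulr1; ring.
Qed.

(* With xi vanishing on the facets where q = lagd a does not, G = q xi is a combination of interior
   velocity shape functions, and 2 int q D_w G = int D_w (q G) + int q^2 D_w xi = int q^2 D_w xi > 0. *)
Lemma bubble_pin (T : 'rV[R]_d -> 'rV[R]_d) J kap Lam (w : 'rV[R]_d) (DLv : {ffun 'I_d -> 'I_p.+2} -> 'rV[R]_d -> 'rV[R]_d)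
    (DLp : 'rV[R]_d -> 'rV[R]_d) KL (psi : 'rV[R]_d -> R) :
  secant_map T J kap Lam -> (leb R d (T @` cube R d) < +oo)%E ->
  (forall x, cube R d x -> 0 < gradient_xi c x (w *m invmx (J x x))) ->
  (forall b, smooth_cube (lagd sv b) (DLv b) KL) -> smooth_cube (lagd sp a) DLp KL ->
  (forall x, cube R d x -> psi (T x) = lagd sp a x) ->
  ~ (forall b m, interior_idx b ->
     \int[leb R d]_(y in T @` cube R d) (psi y * partial m (pull T (lagd sv b)) y) = 0).
Proof.
move=> sm fC wpos sLv sLp psiE all0; set C := T @` cube R d in fC all0.
have mC : measurable C by exact: (sm_measurable sm).
pose cb (b : {ffun 'I_d -> 'I_p.+2}) := if interior_idx b then bubble (lnode sv b) else 0.
have [KG sG] := smooth_cube_sum cb sLv.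
set G := (fun x => \sum_b _) in sG; set DG := (fun x => _) in sG.
have GE x : G x = bubble x.
  rewrite bubble_interp [RHS]big_mkcond; apply: eq_bigr => b _.
  by rewrite /cb; case: ifP => //; rewrite mul0r.
have [Dx [Kx sx]] := is_smooth_xi.
have sqx := smoothM sLp sx; have sqG := smoothM sLp sG.
set H := (fun x => lagd sp a x * G x) in sqG.
pose u x := w *m invmx (J x x).
have DGE x : cube R d x -> DG x = xi x *: DLp x + lagd sp a x *: Dx x.
  by move=> cx; apply: (smooth_grad_uniq sG sqx) => // y; exact: GE.
have pG x : cube R d x -> pull T G (T x) = G x by move=> cx; exact: (pullE _ sm cx).
have pH x : cube R d x -> pull T H (T x) = H x by move=> cx; exact: (pullE _ sm cx).
have pL b x : cube R d x -> pull T (lagd sv b) (T x) = lagd sv b x by move=> cx; exact: (pullE _ sm cx).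
have dG x : cube R d x -> 'D_w (pull T G) (T x) = edot (u x) (DG x).
  by move=> cx; have [_ ->] := pullback_derivative sm sG pG w cx.
have dH x : cube R d x -> 'D_w (pull T H) (T x) = edot (u x) (G x *: DLp x + lagd sp a x *: DG x).
  by move=> cx; have [_ ->] := pullback_derivative sm sqG pH w cx.
have dL b m x : cube R d x -> partial m (pull T (lagd sv b)) (T x) = edot (delta_mx 0 m *m invmx (J x x)) (DLv b x).
  by move=> cx; rewrite /partial; have [_ ->] := pullback_derivative sm (sLv b) (pL b) (delta_mx 0 m) cx.
have bd F D K' v : smooth_cube F D K' -> bmf C ('D_v (pull T F)).
  move=> sF; have pF x : cube R d x -> pull T F (T x) = F x by move=> cx; exact: (pullE _ sm cx).
  split; first exact: (pullback_derivative_measurable sm sF pF).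
  by eexists => _ [x cx <-]; exact: (pullback_derivative_bound sm sF pF v cx).
have bpsi : bmf C psi.
  split; first exact: (pullback_measurable sm sLp psiE).
  by exists KL => _ [x cx <-]; exact: (pullback_bound sLp psiE cx).
(* G is a combination of interior velocity shape functions and w one of coordinate directions, so
   the assumption [all0] makes this integral vanish. *)
have I1 : \int[leb R d]_(y in C) (psi y * 'D_w (pull T G) y) = 0.
  transitivity (\int[leb R d]_(y in C) \sum_b \sum_m (cb b * w 0 m) * (psi y * partial m (pull T (lagd sv b)) y)).
    apply: eq_Rintegral => _ /set_mem[x cx <-]; rewrite dG//.
    have -> : edot (u x) (DG x) = \sum_b cb b * \sum_m w 0 m * edot (delta_mx 0 m *m invmx (J x x)) (DLv b x).
      have -> : u x = \sum_m w 0 m *: (delta_mx 0 m *m invmx (J x x)).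
        rewrite /u {1}[w]row_sum_delta mulmx_suml; apply: eq_bigr => m _.
        by rewrite scalemxAl.
      have esum (I : finType) (f : I -> 'rV[R]_d) v : edot (\sum_i f i) v = \sum_i edot (f i) v.
        elim/big_ind2: _ => [|a1 a2 b1 b2 <- <-|//]; last by rewrite edotDl.
        by rewrite -(scale0r (0 : 'rV[R]_d)) edotZl mul0r.
      have esumr (I : finType) (f : I -> 'rV[R]_d) v : edot v (\sum_i f i) = \sum_i edot v (f i).
        elim/big_ind2: _ => [|a1 a2 b1 b2 <- <-|//]; last by rewrite edotDr.
        by rewrite edot0r.
      rewrite esumr; apply: eq_bigr => b _; rewrite edotZr; congr (_ * _); rewrite esum.
      by apply: eq_bigr => m _; rewrite edotZl.
    rewrite mulr_sumr; apply: eq_bigr => b _; rewrite mulrCA !mulr_sumr; apply: eq_bigr => m _.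
    by rewrite dL//; ring.
  have bb b m : bmf C (fun y => psi y * partial m (pull T (lagd sv b)) y).
    by apply: bmfM => //; exact: (bd _ _ _ _ (sLv b)).
  rewrite (Rint_sum mC fC); last by move=> b _; apply: bmf_sum => // m _; apply: bmfZ.
  rewrite big1// => b _; rewrite (Rint_sum mC fC); last by move=> m _; apply: bmfZ.
  rewrite big1// => m _; rewrite (RintZ mC fC)//.
  by rewrite /cb; case: ifPn => ib; rewrite ?mul0r// all0// mulr0.
have I2 : \int[leb R d]_(y in C) 'D_w (pull T H) y = 0.
  apply: (bubble_integral sm sqG pH) => x cx nc.
  by rewrite /H GE bubble_bdry// mulr0.
pose Q y := 2 * (psi y * 'D_w (pull T G) y) + - 'D_w (pull T H) y.
have QE x : cube R d x -> Q (T x) = lagd sp a x ^+ 2 * gradient_xi c x (u x).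
  move=> cx; rewrite /Q dG// dH// psiE// -(xi_gradient _ sx cx) (edotDr (G x *: _)) (edotZr (G x)) GE.
  by rewrite DGE// !edotZr !edotDr !edotZr /bubble; ring.
have bQ : bmf C Q.
  apply: bmfD => //; first by apply: bmfZ => //; apply: bmfM => //; exact: (bd _ _ _ _ sG).
  by apply: bmfN => //; exact: (bd _ _ _ _ sqG).
have IQ : \int[leb R d]_(y in C) Q y = 0.
  rewrite (RintD mC fC); last 2 first.
  - by apply: bmfZ => //; apply: bmfM => //; exact: (bd _ _ _ _ sG).
  - by apply: bmfN => //; exact: (bd _ _ _ _ sqG).
  rewrite (RintZ mC fC); last by apply: bmfM => //; exact: (bd _ _ _ _ sG).
  rewrite I1 mulr0 add0r.
  rewrite (@eq_Rintegral _ _ _ (leb R d) C (fun y => (-1) * 'D_w (pull T H) y)); last first.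
    by move=> y _; rewrite mulN1r.
  by rewrite (RintZ mC fC); [rewrite I2 mulr0|exact: (bd _ _ _ _ sqG)].
have Q0 y : C y -> 0 <= Q y.
  by move=> [x cx <-]; rewrite QE// mulr_ge0 ?sqr_ge0// ltW// wpos.
have [N [mN N0 hN]] := Rint_eq0_negligible mC fC bQ Q0 IQ.
have q0 x : cube R d x -> lagd sp a x = 0.
  have [KL0 _ lip _] := sLp.
  apply: (eq0_off_negligible sm mN N0 (K := KL)).
    by move=> y z cy cz; have [] := lip _ _ cy cz.
  move=> z cz nz; have /eqP := hN (T z) (imageP T cz) nz.
  by rewrite QE// mulf_eq0 sqrf_eq0 (gt_eqF (wpos _ cz)) orbF => /eqP.
(* Taking f = 0 in [continuous_extension] carries the vanishing of the pressure shape function from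
   the open cube to its own node, where it is 1. *)
have c0 : {within [set: 'rV[R]_d], continuous (fun _ : 'rV[R]_d => 0 : R)}.
  apply: continuous_subspaceT => y; apply: cst_continuous.
have := continuous_extension sm (@subsetT _ _) c0 sLp (fun x cx => esym (q0 x cx)) (lnode_ccube nsp a).
by rewrite (lagd_node (nodes_inj nsp)) eqxx => /eqP; rewrite eq_sym oner_eq0.
Qed.

End Bubble.

(** * Pressures tested with velocity functions supported in one element *)

Section Pinning.
Variables (R : realType) (d p : nat) (sv : 'I_p.+2 -> R) (sp : 'I_p.+1 -> R).
Hypothesis nsv : nodes1D sv.
Hypothesis nsp : nodes1D sp.
Hypothesis p0 : (0 < p)%N.
Variables (Omega : set 'rV[R]_d) (Th : mesh R d) (h K KL : R).
Hypothesis h0 : 0 < h.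
Hypothesis K0 : 0 < K.
Hypothesis KL0 : 0 < KL.
Hypothesis EM : forall t : 'I_(ncell Th), element_map (cell_map t) h K.
Hypothesis CM : conforming_mesh Omega Th.
Hypothesis oO : open Omega.
Variables (Vb : velocity_basis sv Omega Th) (Pb : pressure_basis sp Omega Th).
Variables (DLv : {ffun 'I_d -> 'I_p.+2} -> 'rV[R]_d -> 'rV[R]_d).
Variables (DLp : {ffun 'I_d -> 'I_p.+1} -> 'rV[R]_d -> 'rV[R]_d).
Hypothesis sLv : forall a, smooth_cube (lagd sv a) (DLv a) KL.
Hypothesis sLp : forall a, smooth_cube (lagd sp a) (DLp a) KL.
Implicit Types t : 'I_(ncell Th).

Let mc t : measurable (cell t). Proof. exact: (cell_measurable EM). Qed.
Let fc t : (leb R d (cell t) < +oo)%E. Proof. exact: (cell_fin h0 K0 EM t). Qed.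

Lemma interior_dof t b m : interior_idx b ->
  exists j : 'I_(vdim Vb), vnode j = cell_map t (lnode sv b) /\ vdir j = m.
Proof.
move=> ib; apply/vnode_range; split; first exact: lnode_lagrange.
move=> [_]; apply; have -> : interior Omega = Omega by apply/interior_id.
by apply: (cell_sub CM (t := t)); exists (lnode sv b) => //; exact: lnode_cube.
Qed.

Lemma interior_local t b (j : 'I_(vdim Vb)) : interior_idx b -> vnode j = cell_map t (lnode sv b) ->
  (forall t', t' != t -> j \notin vdof Vb t') /\
  forall i x, ccube x -> vcomp (vfun j) i (cell_map t x) = lagd sv b x * (i == vdir j)%:R.
Proof.
move=> ib jE; have cj : cell t (vnode j) by rewrite jE; exists (lnode sv b) => //; exact: lnode_cube.
split.
  move=> t' tt'; rewrite inE; apply/asboolP => cl'; move/eqP: tt'; apply.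
  exact: (cell_closure_disjoint EM CM cj cl').
have [[_ [a [ya E]]]|[nj _]] := velocity_shape nsv EM CM j t; last first.
  by move: nj; rewrite inE => /asboolP[]; exact: subset_closure.
by move: ya E; rewrite jE => /(lnode_cell_inj nsv EM) <- E i x; exact: E.
Qed.

Lemma interior_div t b (j : 'I_(vdim Vb)) y : interior_idx b -> vnode j = cell_map t (lnode sv b) ->
  cell t y ->
  \sum_i partial i (vcomp (vfun j) i) y = partial (vdir j) (pull (cell_map t) (lagd sv b)) y.
Proof.
move=> ib jE cy; have [_ E] := interior_local ib jE.
rewrite (bigD1 (vdir j))//= big1 => [|i ij]; last first.
  have E0 x : ccube x -> vcomp (vfun j) i (cell_map t x) = 0 by move=> cx; rewrite E// (negPf ij) mulr0.
  by have [_ ->] := loc0 EM E0 cy.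
rewrite addr0; case: cy => x cx <-; have [J sm] := element_secant EM t; rewrite /partial.
have E1 z : cube R d z -> vcomp (vfun j) (vdir j) (cell_map t z) = lagd sv b z.
  by move=> /cube_ccube cz; rewrite E// eqxx mulr1.
have E2 z : cube R d z -> pull (cell_map t) (lagd sv b) (cell_map t z) = lagd sv b z.
  by move=> cz; exact: (pullE _ sm cz).
have [_ ->] := pullback_derivative sm (sLv b) E1 (delta_mx 0 (vdir j)) cx.
by have [_ ->] := pullback_derivative sm (sLv b) E2 (delta_mx 0 (vdir j)) cx.
Qed.

(** Constants are invisible to interior velocity functions, by [bubble_integral]; subtracting its
    mean from a pressure thus leaves the product with them unchanged. *)
Lemma interior_div_integral t t' b (j : 'I_(vdim Vb)) : interior_idx b -> vnode j = cell_map t (lnode sv b) ->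
  \int[leb R d]_(y in cell t') (\sum_i partial i (vcomp (vfun j) i) y) = 0.
Proof.
move=> ib jE; have [out _] := interior_local ib jE.
have [tt'|tt'] := eqVneq t' t; last first.
  have [[jt _]|[_ E]] := velocity_shape nsv EM CM j t'; first by have := out _ tt'; rewrite jt.
  apply: (Rint_eq0 EM) => y cy; rewrite big1// => i _.
  by have [_ ->] := loc0 EM (E i) cy.
rewrite tt'; have [J sm] := element_secant EM t.
have E2 z : cube R d z -> pull (cell_map t) (lagd sv b) (cell_map t z) = lagd sv b z.
  by move=> cz; exact: (pullE _ sm cz).
rewrite (@eq_Rintegral _ _ _ (leb R d) (cell t) (fun y => partial (vdir j) (pull (cell_map t) (lagd sv b)) y)).
  apply: (bubble_integral sm (sLv b) E2) => x cx nc; exact: lagd_bdry.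
by move=> y /set_mem cy; rewrite (interior_div ib jE cy).
Qed.

Lemma pinning (i : 'I_(pdim Pb)) : exists t b (j : 'I_(vdim Vb)),
  [/\ interior_idx b, vnode j = cell_map t (lnode sv b) & loc_b Vb Pb t i j != 0].
Proof.
have [t [a ia]] : lagrange_points sp Th (pnode i) by apply/(pnode_range Pb); exists i.
have psiE x : ccube x -> pfun i (cell_map t x) = lagd sp a x.
  have [[_ [a' [ya E]]]|[ni _]] := pressure_shape nsp EM CM i t; last first.
    move: ni; rewrite inE => /asboolP[]; rewrite ia (cell_closure EM); exists (lnode sp a) => //.
    exact: lnode_ccube.
  by move: ya E; rewrite ia => /(lnode_cell_inj nsp EM) <- E; exact: E.
apply: contrapT => no; have [J [sm pos]] := EM t.
have [w wpos] := pos (fun m => a m == ord_max).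
apply: (bubble_pin nsv nsp p0 sm (fc t) wpos sLv (sLp a)).
  by move=> x /cube_ccube; exact: psiE.
move=> b m ib; have [j [jE jm]] := interior_dof t m ib.
have : loc_b Vb Pb t i j = 0.
  by apply/eqP/negPn/negP => ne; apply: no; exists t, b, j.
rewrite mxE /form_b => <-; apply: eq_Rintegral => y /set_mem cy.
by rewrite (interior_div ib jE cy) jm.
Qed.

Lemma pinning_total (i : 'I_(pdim Pb)) : exists t (j : 'I_(vdim Vb)),
  loc_b Vb Pb t i j != 0 /\ \sum_t' loc_b Vb Pb t' i j = loc_b Vb Pb t i j.
Proof.
have [t [b [j [ib jE ne]]]] := pinning i; exists t, j; split => //.
rewrite (bigD1 t)//= big1 ?addr0// => t' tt'; have [out _] := interior_local ib jE.
by apply: (loc_b_suppv nsv EM CM); exact: out.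
Qed.

Lemma Qpoly_subc (f : 'rV[R]_d -> R) n c : Qpoly n f -> Qpoly n (fun x => f x - c).
Proof.
move=> [e fE]; pose z : {ffun 'I_d -> 'I_n.+1} := [ffun=> ord0].
exists (fun b => e b - (b == z)%:R * c) => x; rewrite fE.
under [RHS]eq_bigr do rewrite mulrBl; rewrite sumrB; congr (_ - _).
rewrite (bigD1 z)//= [X in _ = _ + X]big1 => [|b bz]; last by rewrite (negPf bz) !mul0r.
by rewrite eqxx mul1r addr0 big1 ?mulr1// => m _; rewrite ffunE expr0.
Qed.

(** A nodal function minus its mean value lies in Q_l, so [zmx_span] gives its coordinates y. Tested
    with the interior velocity function found by [pinning], it yields the nonzero entry of the nodal
    function itself. *)
Lemma zero_mean_b_neq0 (Z : zero_mean_coords Pb) : (exists t : 'I_(ncell Th), True) ->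
  (zmx Z)^T *m mat_b Vb Pb != 0.
Proof.
case=> t0 _; have [i _] : exists i : 'I_(pdim Pb), pnode i = cell_map t0 (lnode sp [ffun=> ord0]).
  by apply/(pnode_range Pb); exact: lnode_lagrange.
have bp t (i' : 'I_(pdim Pb)) : bmf (cell t) (pfun i').
  exact: (loc_bmf EM (loc_pressure nsp KL0 EM CM sLp t i')).
have bdiv t (j' : 'I_(vdim Vb)) := bmf_div nsv h0 K0 KL0 EM CM sLv t j'.
have [t [b [j [ib jE ne]]]] := pinning i.
have [t1 [j1 [ne1 sum1]]] := pinning_total i.
have c1 t' : bmf (cell t') (fun=> 1 : R) by exact: bmf_cst.
pose vol := \sum_(t' < ncell Th) \int[leb R d]_(y in cell t') (1 : R).
have vol0 : 0 < vol.
  rewrite /vol (bigD1 t0)//= ltr_pwDl//; last first.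
    by apply: sumr_ge0 => t' _; apply: Rint_ge0 => y _; exact: ler01.
  rewrite lt_neqAle; apply/andP; split; last by apply: Rint_ge0 => y _; exact: ler01.
  apply/eqP => /esym e0; have [J sm] := element_secant EM t0.
  have [N [mN N0 hN]] := Rint_eq0_negligible (mc t0) (fc t0) (c1 t0) (fun _ _ => ler01) e0.
  have := eq0_off_negligible sm (H := fun=> 1) (K := 0) mN N0 _ _ (@cube_center R d).
  have -> : ((1 : R) = 0) = False by apply/propext; split => // /eqP; rewrite oner_eq0.
  apply; first by move=> x y _ _; rewrite subrr normr0 mul0r.
  by move=> x cx nx; have := hN _ (imageP _ cx) nx => /eqP; rewrite oner_eq0.
(* The mean value of the nodal function over Omega. *)
pose kap := (\sum_(t' < ncell Th) \int[leb R d]_(y in cell t') pfun i y) / vol.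
pose q (y : 'rV[R]_d) := pfun i y - kap.
have Qq : Q_space p Omega Th q.
  have [cf pf] := pfun_Q i; split; last first.
    rewrite (Rint_cells h0 K0 EM CM); last first.
      by move=> t'; apply: bmfD => //; exact: bmf_cst.
    rewrite (eq_bigr (fun t' => \int[leb R d]_(y in cell t') pfun i y + (- kap) * \int[leb R d]_(y in cell t') (1 : R))).
      rewrite big_split /= -mulr_sumr -/vol /kap mulNr divfK ?gt_eqF// subrr//.
    move=> t' _; rewrite -(RintZ (mc t') (fc t'))// -(RintD (mc t') (fc t'))//; last by apply: bmfZ.
    by apply: eq_Rintegral => y _; rewrite mulr1.
  split; first by move=> x; apply: continuousB; [exact: cf|exact: cst_continuous].
  move=> t'; have [P QP PE] := pf t'; exists (fun x => P x - kap); first exact: Qpoly_subc.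
  by move=> x cx; rewrite /q PE.
have [y yE] := zmx_span Z Qq.
apply/eqP => B0; have : (y^T *m ((zmx Z)^T *m mat_b Vb Pb)) 0 j = 0 by rewrite B0 mulmx0 mxE.
rewrite mulmxA -trmx_mul mxE.
have -> : \sum_i' (zmx Z *m y)^T 0 i' * mat_b Vb Pb i' j = loc_b Vb Pb t i j.
  have -> : mat_b Vb Pb = \sum_t' loc_b Vb Pb t'.
    exact: (mat_b_sum nsv nsp h0 K0 KL0 EM CM Vb Pb sLv sLp).
  under eq_bigr do rewrite summxE mulr_sumr; rewrite exchange_big /=.
  transitivity (\sum_t' loc_b Vb Pb t' i j); last first.
    rewrite (bigD1 t)//= big1 ?addr0// => t' tt'; have [out _] := interior_local ib jE.
    by apply: (loc_b_suppv nsv EM CM); exact: out.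
  apply: eq_bigr => t' _; set dv := fun z => \sum_m partial m (vcomp (vfun j) m) z.
  have bd : bmf (cell t') dv by exact: bdiv.
  transitivity (\int[leb R d]_(z in cell t') \sum_i' ((zmx Z *m y) i' 0 * (pfun i' z * dv z))).
    rewrite (Rint_sum (mc t') (fc t')); last by move=> i' _; apply: bmfZ => //; exact: bmfM.
    apply: eq_bigr => i' _; rewrite (RintZ (mc t') (fc t')); last exact: bmfM.
    by rewrite !mxE.
  transitivity (\int[leb R d]_(z in cell t') (pfun i z * dv z + (- kap) * dv z)).
    apply: eq_Rintegral => z /set_mem cz.
    have := yE z (subset_closure (cell_sub CM cz)); rewrite /q => E.
    rewrite -mulrDl E mulr_suml; apply: eq_bigr => i' _; ring.
  rewrite (RintD (mc t') (fc t')); [|exact: bmfM|exact: bmfZ].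
  rewrite (RintZ (mc t') (fc t'))// (interior_div_integral t' ib jE) mulr0 addr0.
  by rewrite mxE.
by move=> e; rewrite e eqxx in ne.
Qed.

End Pinning.

(** * Uniform bounds on all levels *)

Section SchurChoice.
Variables (R : realType) (nc nv np : nat) (at_ : 'I_nc -> 'M[R]_nv).
Variables (bt : 'I_nc -> 'M[R]_(np, nv)) (mt : 'I_nc -> 'I_np -> R).
Variables (vd : 'I_nc -> {set 'I_nv}) (pd : 'I_nc -> {set 'I_np}) (N : nat) (C1 : R).
Hypothesis H : assembly at_ bt mt vd pd N C1.

Definition schur_entry (D : schur_diag) (i : 'I_np) : R :=
  match D with
  | SchurGlobal => global_schur at_ bt i
  | SchurMass => total_mass mt i
  | SchurLocal => local_schur at_ bt vd i
  end.

(** A common majorant of the constants 1, N, N^2, N C1 and N^2 C1 that occur for the three choices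
    of D. *)
Definition schur_const : R := (1 + N%:R) ^+ 2 * (1 + C1).

Let c1 := as_C1 H.
Let n0 : 0 <= N%:R :> R := ler0n _ _.

Lemma schur_entry_gt0 D i : 0 < schur_entry D i.
Proof.
case: D => /=; [exact: (global_schur_gt0 H)|exact: (total_mass_gt0 H)|exact: (local_schur_gt0 H)].
Qed.

Lemma schur_entry_le D i : schur_entry D i <= schur_const * total_mass mt i.
Proof.
have M0 := ltW (total_mass_gt0 H i); have L := local_le_mass H i.
have E (c : R) : c <= schur_const -> c * total_mass mt i <= schur_const * total_mass mt i.
  by move=> hc; rewrite ler_wpM2r.
case: D => /=.
- apply: (le_trans (global_le_local H i)); apply: (@le_trans _ _ (N%:R * (N%:R * C1 * total_mass mt i))).
    by rewrite ler_wpM2l.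
  by rewrite !mulrA; apply: E; rewrite /schur_const; move: (N%:R : R) n0 c1 => n ? ?; nra.
- rewrite -[leLHS]mul1r; apply: E; rewrite /schur_const; move: (N%:R : R) n0 c1 => n ? ?; nra.
- apply: (le_trans L); apply: E; rewrite /schur_const; move: (N%:R : R) n0 c1 => n ? ?; nra.
Qed.

Lemma schur_entry_bound D y :
  qf ((\sum_t bt t) *m invmx (diagm (\sum_t at_ t)) *m (\sum_t bt t)^T) y y <=
  schur_const * \sum_i schur_entry D i * y i 0 ^+ 2.
Proof.
have E (c S : R) : 0 <= S -> c <= schur_const -> c * S <= schur_const * S.
  by move=> S0 hc; rewrite ler_wpM2r.
have S0 D' : 0 <= \sum_i schur_entry D' i * y i 0 ^+ 2.
  by apply: sumr_ge0 => i _; rewrite mulr_ge0 ?sqr_ge0// ltW// schur_entry_gt0.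
case: D.
- apply: (le_trans (schur_le_global H y)); apply: E; first exact: (S0 SchurGlobal).
  by rewrite natrM /schur_const; move: (N%:R : R) n0 c1 => n ? ?; nra.
- apply: (le_trans (schur_le_local H y)).
  apply: (@le_trans _ _ (N%:R * (N%:R * C1) * \sum_i total_mass mt i * y i 0 ^+ 2)).
    rewrite -mulrA ler_wpM2l// mulr_sumr; apply: ler_sum => i _.
    by rewrite mulrA ler_wpM2r ?sqr_ge0// (local_le_mass H).
  apply: E; first exact: (S0 SchurMass).
  by rewrite /schur_const; move: (N%:R : R) n0 c1 => n ? ?; nra.
- apply: (le_trans (schur_le_local H y)); apply: E; first exact: (S0 SchurLocal).
  by rewrite /schur_const; move: (N%:R : R) n0 c1 => n ? ?; nra.
Qed.

End SchurChoice.

Lemma restrict_diag (R : realType) (n : nat) (S : {set 'I_n}) (s : 'I_#|S| -> R) :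
  let P : 'M[R]_(#|S|, n) := \matrix_(a, j) (enum_val a == j)%:R in
  P^T *m diag_mx (\row_a s a) *m P = diag_mx (\row_j \sum_(a | enum_val a == j) s a).
Proof.
move=> P; apply/matrixP => i j; rewrite !mxE.
transitivity (\sum_a (enum_val a == i)%:R * s a * (enum_val a == j)%:R : R).
  by apply: eq_bigr => a _; rewrite mul_mx_diag !mxE.
have [<-|ij] := eqVneq i j; rewrite ?mulr1n ?mulr0n.
  rewrite [RHS]big_mkcond; apply: eq_bigr => a _.
  by case: eqP => _; rewrite ?mul1r ?mulr1// !mul0r.
apply: big1 => a _; case: eqP => [->|]; last by rewrite !mul0r.
by rewrite (negPf ij) mulr0.
Qed.

(** * The hypotheses of the abstract estimate on one level, with level-independent constants *)

Section Level.
Variables (R : realType) (d p : nat) (sv : 'I_p.+2 -> R) (sp : 'I_p.+1 -> R).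
Hypothesis nsv : nodes1D sv.
Hypothesis nsp : nodes1D sp.
Hypothesis p0 : (0 < p)%N.
Hypothesis d1 : (1 < d)%N.
Variables (K KL H0 : R).
Hypothesis K0 : 0 < K.
Hypothesis KL0 : 0 < KL.
Hypothesis H00 : 0 < H0.
Variables (DLv : {ffun 'I_d -> 'I_p.+2} -> 'rV[R]_d -> 'rV[R]_d).
Variables (DLp : {ffun 'I_d -> 'I_p.+1} -> 'rV[R]_d -> 'rV[R]_d).
Hypothesis sLv : forall a, smooth_cube (lagd sv a) (DLv a) KL.
Hypothesis sLp : forall a, smooth_cube (lagd sp a) (DLp a) KL.
Variables (mu rho gamma : R).
Hypothesis mu0 : 0 < mu.
Hypothesis gr0 : 0 <= gamma * rho.

(** The sum of the three counts required by [assembly]: velocity and pressure degrees of freedom per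
    element, and elements meeting at a point. *)
Definition level_N : nat := p.+2 ^ d * d + p.+1 ^ d + Num.bound ((16 * K ^+ 2) ^+ d).
(** Element volume times the squared gradient bound, divided by h^(d-2); the reaction term has two
    spare powers of h, which are replaced by powers of H0. *)
Definition level_a : R :=
  (mu * (d * d)%:R * (d%:R * (K * KL)) ^+ 2 + gamma * rho * (d%:R * KL ^+ 2) * H0 ^+ 2) * (4 * K) ^+ d.
Definition level_m : R := KL ^+ 2 * (4 * K) ^+ d.
Definition level_S : R := schur_const level_N (d%:R / mu).
Definition level_C : R :=
  1 + level_N%:R + level_N%:R * level_a + level_S * (level_N%:R * level_m) + level_S.

Variables (Omega : set 'rV[R]_d) (Th : mesh R d) (h : R).
Hypothesis h0 : 0 < h.
Hypothesis hH : h <= H0.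
Hypothesis EM : forall t : 'I_(ncell Th), element_map (cell_map t) h K.
Hypothesis CM : conforming_mesh Omega Th.
Hypothesis oO : open Omega.
Hypothesis T0 : exists t : 'I_(ncell Th), True.
Variables (Vb : velocity_basis sv Omega Th) (Pb : pressure_basis sp Omega Th).

Let la := loc_a Vb mu rho gamma.
Let lb := loc_b Vb Pb.
Let lm := @loc_m R d p sp Omega Th Pb.

Lemma level_assembly : assembly la lb lm (vdof Vb) (pdof Pb) level_N (d%:R / mu).
Proof.
split.
- by move=> t; exact: loc_a_sym.
- by move=> t; exact: (loc_a_psd nsv h0 K0 KL0 EM CM sLv mu0 gr0).
- by move=> t i j it; exact: (loc_a_supp nsv EM CM).
- by move=> t i j jt; exact: (loc_b_suppv nsv EM CM).
- by move=> t i j it; exact: (loc_b_suppp nsp EM CM).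
- move=> t j jt; apply: (loc_a_pos nsv h0 K0 KL0 EM CM sLv mu0 gr0) => //; exact: ltnW.
- by move=> t; apply: (leq_trans (card_vdof nsv EM CM Vb t)); rewrite /level_N -addnA leq_addr.
- move=> t; apply: (leq_trans (card_pdof nsp EM CM Pb t)).
  by rewrite /level_N addnAC leq_addl.
- move=> j; apply: (@leq_trans (Num.bound ((16 * K ^+ 2) ^+ d))); last by rewrite leq_addl.
  have -> : #|[set t | j \in vdof Vb t]%SET| = #|[set t : 'I_(ncell Th) | `[< closure (cell t) (vnode j) >]]%SET|.
    by apply: eq_card => t; rewrite !inE.
  rewrite -(ler_nat R); apply: (le_trans (card_cells_at h0 K0 EM CM (vnode j))).
  by apply/ltW/archi_boundP; rewrite exprn_ge0// mulr_ge0// sqr_ge0.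
- by move=> j; exact: (vdof_cover nsv EM).
- by rewrite divr_ge0// ltW.
- by move=> t i j; exact: (loc_b_bound nsv nsp h0 K0 KL0 EM CM sLv sLp mu0 gr0).
- by move=> t i; exact: loc_m_ge0.
- by move=> i; exact: (pinning_total nsv nsp p0 h0 K0 EM CM oO Vb sLv sLp).
Qed.

Let H := level_assembly.
Let AE : mat_a mu rho gamma Vb = \sum_t la t := mat_a_sum nsv h0 K0 KL0 EM CM Vb sLv mu rho gamma.
Let BE : mat_b Vb Pb = \sum_t lb t := mat_b_sum nsv nsp h0 K0 KL0 EM CM Vb Pb sLv sLp.

(** For the local choice, [elt_restr] merely renumbers: each element contributes a diagonal matrix,
    and the entries add up to [local_schur]. *)
Lemma level_mat_D D : mat_D mu rho gamma Vb Pb D = diag_mx (\row_i schur_entry la lb lm (vdof Vb) D i).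
Proof.
case: D; rewrite /mat_D /=.
- rewrite AE BE /diagm; congr diag_mx; apply/rowP => i; rewrite mxE [RHS]mxE.
  exact: (global_schurE H i).
- rewrite /diagm; congr diag_mx; apply/rowP => i; rewrite mxE [RHS]mxE.
  exact: (mass_sum nsp h0 K0 KL0 EM CM sLp).
have tE t : (elt_restr Pb t)^T *m diagm (elt_b Vb Pb t *m invmx (diagm (elt_a mu rho gamma Vb t)) *m (elt_b Vb Pb t)^T)
    *m elt_restr Pb t = diag_mx (\row_i \sum_(j in vdof Vb t) lb t i j ^+ 2 / la t j j).
  rewrite /diagm restrict_diag; congr diag_mx; apply/rowP => i; rewrite !mxE.
  have sE (a : 'I_#|pdof Pb t|) : (elt_b Vb Pb t *m invmx (diag_mx (\row_i elt_a mu rho gamma Vb t i i)) *m (elt_b Vb Pb t)^T) a a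
      = \sum_(j in vdof Vb t) lb t (enum_val a) j ^+ 2 / la t j j.
    rewrite invmx_diag_mx => [|c]; last first.
      rewrite !mxE gt_eqF//; have := as_pos H (enum_valP c); rewrite /la mxE; apply.
    rewrite mxE [RHS]big_enum_val; apply: eq_bigr => c _; rewrite mul_mx_diag !mxE expr2; ring.
  under eq_bigr do rewrite sE.
  rewrite -(big_enum_val_cond (fun z => z == i) (fun z => \sum_(j in vdof Vb t) lb t z j ^+ 2 / la t j j)) /=.
  have [it|it] := boolP (i \in pdof Pb t).
    by rewrite (big_pred1 i)// => z; rewrite /= andbC; case: eqP => // ->; rewrite it.
  rewrite big_pred0 => [|z]; last by rewrite /= andbC; case: eqP => // ->; exact: negPf.
  by rewrite big1// => j _; rewrite (as_supp_bp H)// expr0n mul0r.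
rewrite (eq_bigr _ (fun t _ => tE t)); apply/matrixP => i j; rewrite summxE !mxE.
have [<-|ij] := eqVneq i j.
  rewrite mulr1n; apply: eq_bigr => t _; rewrite !mxE eqxx mulr1n//.
by rewrite mulr0n big1// => t _; rewrite !mxE (negPf ij).
Qed.

Lemma level_sum_bound (n : nat) (f : 'I_(ncell Th) -> R) (S : {set 'I_(ncell Th)}) (M : R) :
  (forall t, t \notin S -> f t = 0) -> (forall t, f t <= M) -> 0 <= M -> (#|S| <= n)%N ->
  \sum_t f t <= n%:R * M.
Proof.
move=> f0 fM M0 Sn; apply: (@le_trans _ _ (\sum_(t in S) M)).
  rewrite [leRHS]big_mkcond; apply: ler_sum => t _; case: ifPn => [_|/f0 -> //].
  exact: fM.
by rewrite sumr_const -[leLHS]mulr_natl ler_wpM2r// ler_nat.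
Qed.

Let g0 : 0 <= gamma * rho * (d%:R * KL ^+ 2). Proof. by rewrite mulr_ge0// mulr_ge0// sqr_ge0. Qed.

Lemma level_a_ge0 : 0 <= level_a.
Proof.
rewrite /level_a mulr_ge0 ?exprn_ge0 ?mulr_ge0 ?(ltW K0)// addr_ge0// mulr_ge0 ?sqr_ge0//.
by rewrite mulr_ge0 ?(ltW mu0).
Qed.

Lemma level_m_ge0 : 0 <= level_m.
Proof. by rewrite /level_m mulr_ge0 ?sqr_ge0// exprn_ge0// mulr_ge0 ?(ltW K0). Qed.

Lemma level_S_gt0 : 0 < level_S.
Proof.
rewrite /level_S /schur_const mulr_gt0// ?exprn_gt0// ltr_pwDl//.
by rewrite divr_ge0 ?(ltW mu0).
Qed.

Lemma level_a_bound j : (\sum_t la t) j j <= level_N%:R * level_a * h ^+ (d - 2).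
Proof.
rewrite summxE -mulrA; apply: (level_sum_bound (S := [set t | j \in vdof Vb t]%SET)).
- by move=> t; rewrite inE => jt; rewrite (as_supp_a H).
- move=> t; apply: (le_trans (loc_a_le nsv h0 K0 KL0 EM CM sLv mu0 gr0 t j)).
  have hE : h ^+ d = h ^+ 2 * h ^+ (d - 2) by rewrite -exprD subnKC.
  have hd : (4 * (K * h)) ^+ d = (4 * K) ^+ d * (h ^+ 2 * h ^+ (d - 2)) by rewrite mulrA exprMn hE.
  rewrite hd /level_a /grad_bound.
  have -> : K / h * KL = (K * KL) / h by ring.
  set e := h ^+ (d - 2); set q := (4 * K) ^+ d.
  have e0 : 0 <= e by rewrite exprn_ge0// ltW.
  have q0 : 0 <= q by rewrite exprn_ge0// mulr_ge0 ?(ltW K0).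
  have -> : (mu * (d * d)%:R * (d%:R * (K * KL / h)) ^+ 2 + gamma * rho * (d%:R * KL ^+ 2)) * (q * (h ^+ 2 * e))
    = (mu * (d * d)%:R * (d%:R * (K * KL)) ^+ 2 + gamma * rho * (d%:R * KL ^+ 2) * h ^+ 2) * q * e.
    by move: ((d * d)%:R : R) (d%:R : R) => dd D; field; rewrite gt_eqF.
  rewrite ler_wpM2r// ler_wpM2r// lerD2l ler_wpM2l//.
  by rewrite lerXn2r ?nnegrE ?(ltW h0) ?(ltW H00).
- by rewrite mulr_ge0 ?level_a_ge0// exprn_ge0// ltW.
- exact: (as_card_t H j).
Qed.

Lemma level_m_bound i : total_mass lm i <= level_N%:R * level_m * h ^+ d.
Proof.
rewrite -mulrA; apply: (level_sum_bound (S := [set t | i \in pdof Pb t]%SET)).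
- move=> t; rewrite inE => it; have [[it' _]|[_ E]] := pressure_shape nsp EM CM i t; first by rewrite it' in it.
  by apply: (Rint_eq0 EM) => y cy; have [-> _] := loc0 EM E cy; rewrite mul0r.
- move=> t; apply: (le_trans (loc_m_le nsp h0 K0 KL0 EM CM sLp t i)).
  have -> : (4 * (K * h)) ^+ d = (4 * K) ^+ d * h ^+ d by rewrite mulrA exprMn.
  by rewrite mulrA.
- by rewrite mulr_ge0 ?level_m_ge0// exprn_ge0// ltW.
apply: (@leq_trans (Num.bound ((16 * K ^+ 2) ^+ d))); last by rewrite leq_addl.
have -> : #|[set t | i \in pdof Pb t]%SET| = #|[set t : 'I_(ncell Th) | `[< closure (cell t) (pnode i) >]]%SET|.
  by apply: eq_card => t; rewrite !inE.
rewrite -(ler_nat R); apply: (le_trans (card_cells_at h0 K0 EM CM (pnode i))).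
by apply/ltW/archi_boundP; rewrite exprn_ge0// mulr_ge0// sqr_ge0.
Qed.

Lemma level_C_ge : [/\ 0 < level_C, level_N%:R <= level_C, level_N%:R * level_a <= level_C,
  level_S * (level_N%:R * level_m) <= level_C & level_S <= level_C].
Proof.
have S0 := level_S_gt0; have n0 : 0 <= level_N%:R :> R by [].
have a0 : 0 <= level_N%:R * level_a by rewrite mulr_ge0 ?level_a_ge0.
have m0 : 0 <= level_S * (level_N%:R * level_m) by apply: mulr_ge0; [exact: ltW|apply: mulr_ge0; [by []|exact: level_m_ge0]].
rewrite /level_C; move: (level_N%:R * level_a) (level_S * (level_N%:R * level_m)) level_S (level_N%:R : R) S0 n0 a0 m0.
by move=> a b s n *; split; lra.
Qed.

(** The columns of [zmx Z] are orthonormal, so the form inequalities for the nodal matrices, tested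
    on vectors Z x, become the inequalities for Z^T B and Z^T D Z with the same constants. *)
Lemma level_smoothing (kA kS : nat) (c : R) (Z : zero_mean_coords Pb) (D : schur_diag) (m : nat) :
  (forall d n r (h : R) (A : 'M[R]_n) (B : 'M[R]_(r, n)) (D : 'M[R]_r),
  0 < h -> A^T = A -> psd A -> (forall i, 0 < A i i) ->
  lef A (level_C *: diagm A) -> (forall i, A i i <= level_C * h ^+ (d - 2)) ->
  D^T = D -> pd D -> lef D ((level_C * h ^+ d) *: 1%:M) ->
  lef (B *m invmx (diagm A) *m B^T) (level_C *: D) -> B != 0 ->
  forall m, (1 <= m)%N ->
  X_opnorm d h (saddle A B *m uzawa_iter A B D kA kS ^+ m) <= c * eta0 R m.-1) -> (1 <= m)%N ->
  smoothing_norm mu rho gamma h Vb Z D kA kS m <= c * eta0 R m.-1.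
Proof.
move=> hc m1; have [C0 CN Ca Cm CS] := level_C_ge.
have ZZ := zmx_orthonormal Z.
have qfZ1 x : qf 1%:M (zmx Z *m x) (zmx Z *m x) = qf 1%:M x x by rewrite -qf_gram ZZ.
have h1 n : 0 <= h ^+ n by rewrite exprn_ge0// ltW.
apply: hc => //.
- by rewrite AE; exact: (assembly_sym H).
- by rewrite AE; exact: (assembly_psd H).
- by rewrite AE; exact: (assembly_pos H).
- rewrite AE => x; apply: (le_trans (assembly_lef H x)); rewrite !qfZ ler_wpM2r// qf_diagm.
  by apply: sumr_ge0 => i _; rewrite mulr_ge0 ?sqr_ge0// ltW// (assembly_pos H).
- move=> i; rewrite AE; apply: (le_trans (level_a_bound i)).
  by rewrite ler_wpM2r.
- by rewrite !trmx_mul trmxK mulmxA level_mat_D tr_diag_mx.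
- move=> x x0; rewrite qf_congr level_mat_D; apply: pd_diag_mx => [i|].
    by rewrite mxE (schur_entry_gt0 H).
  apply: contra x0 => /eqP e; have := congr1 (mulmx (zmx Z)^T) e.
  by rewrite mulmxA ZZ mul1mx mulmx0 => ->.
- move=> x; rewrite qf_congr qfZ -qfZ1 level_mat_D qf_diag qf1E mulr_sumr; apply: ler_sum => i _.
  rewrite mxE -[leLHS]mulrA; apply: ler_wpM2r; first by rewrite -expr2 sqr_ge0.
  apply: (le_trans (schur_entry_le H D i)); apply: (@le_trans _ _ (level_S * (level_N%:R * level_m * h ^+ d))).
    by rewrite ler_wpM2l ?(ltW level_S_gt0)// level_m_bound.
  by rewrite mulrA ler_wpM2r.
- move=> x; set iA := invmx _.
  have -> : (zmx Z)^T *m mat_b Vb Pb *m iA *m ((zmx Z)^T *m mat_b Vb Pb)^T =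
      (zmx Z)^T *m (mat_b Vb Pb *m iA *m (mat_b Vb Pb)^T) *m zmx Z.
    by rewrite trmx_mul trmxK !mulmxA.
  rewrite qf_congr /iA AE BE; apply: (le_trans (schur_entry_bound H D _)).
  rewrite qfZ qf_congr level_mat_D qf_diag; apply: ler_pM => //.
  - exact: ltW level_S_gt0.
  - by apply: sumr_ge0 => i _; rewrite mulr_ge0 ?sqr_ge0// ltW// (schur_entry_gt0 H).
  - by apply: ler_sum => i _; rewrite [X in _ <= X * _ * _]mxE -mulrA -expr2.
- exact: (zero_mean_b_neq0 nsv nsp p0 h0 K0 KL0 EM CM oO Vb sLv sLp Z T0).
Qed.

End Level.

(** All constants are fixed before the level: K by shape regularity and the comparability of sizes,
    KL by the shape functions, H0 by the boundedness of Omega. *)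
Lemma uniform_smoothing (R : realType) (d p kA kS : nat)
    (Omega : set 'rV[R]_d) (mu rho gamma : R) (Th : nat -> mesh R d) (h : nat -> R)
    (sv : 'I_p.+2 -> R) (sp : 'I_p.+1 -> R)
    (Vb : forall l, velocity_basis sv Omega (Th l))
    (Pb : forall l, pressure_basis sp Omega (Th l))
    (Z : forall l, zero_mean_coords (Pb l)) (D : schur_diag) :
  d = 2%N \/ d = 3%N -> (0 < p)%N -> bounded_lipschitz_domain Omega ->
  0 < mu -> 0 <= gamma * rho -> mesh_sequence Omega Th h -> nodes1D sv -> nodes1D sp ->
  exists2 c : R, 0 < c &
     forall l m : nat, (1 <= m)%N ->
       smoothing_norm mu rho gamma (h l) (Vb l) (Z l) D kA kS m <= c * eta0 R m.-1.
Proof.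
move=> hd p0 [[x0 Ox0] oO _ bO _] mu0 gr0 [hpos conf _ [sigma s0 sr] [kap k0 cs]] nsv nsp.
have d1 : (1 < d)%N by case: hd => ->.
have adm l t : admissible_map (@cell_map _ _ (Th l) t) by case: (conf l) => -[+ _ _ _ _] _; exact.
have CM l : conforming_mesh Omega (Th l) by case: (conf l).
have dpos l (t : 'I_(ncell (Th l))) : 0 < diam (cell t).
  by have [h1 _] := cs l t; rewrite -(pmulr_rgt0 _ k0); exact: lt_le_trans (hpos l) h1.
have k00 := map_const_gt0 d.-1 s0.
pose K := map_const d.-1 sigma * kap.
have K0 : 0 < K by rewrite mulr_gt0.
have EM l t : element_map (@cell_map _ _ (Th l) t) (h l) K.
  have [h1 h2] := cs l t; apply: (element_map_le (dpos l t) (hpos l) k00 h1 h2).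
  exact: (admissible_element_map hd (adm l t) s0 (dpos l t) (sr l t)).
have cells l : exists t : 'I_(ncell (Th l)), True.
  have : closure Omega x0 by exact: subset_closure.
  by case: (CM l) => _ _ -> _ _ [t _ _]; exists t.
have [r r0 hr] := pinfty_ex_gt0 bO.
(* h is at most kap times the diameter of an element, which lies in the ball of radius r; the factor
   d compares the Euclidean norm with the maximum norm. *)
pose H0 := kap * (d%:R * (r + r)) + 1.
have H00 : 0 < H0 by rewrite ltr_wpDl// mulr_ge0 ?(ltW k0)// mulr_ge0// addr_ge0 ?(ltW r0).
have hH l : h l <= H0.
  have [t _] := cells l; have [h1 _] := cs l t; apply: (le_trans h1).
  rewrite /H0 -[leLHS]addr0; apply: lerD => //; rewrite ler_wpM2l ?(ltW k0)//.
  have cc : cell t (cell_map t (center R d)) by exists (center R d) => //; exact: cube_center.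
  apply: ge_sup => [|_ [[y z] /= [cy cz] <-]].
    by exists (enorm (cell_map t (center R d) - cell_map t (center R d)));
      exists (cell_map t (center R d), cell_map t (center R d)).
  apply: (le_trans (enorm_le_norm _)); rewrite ler_wpM2l//.
  by apply: (le_trans (ler_normB _ _)); apply: lerD; apply: hr; apply: (cell_sub (CM l) (t := t)).
have [DLv [Kv [Kv0 sLv]]] := lagd_smooth_uniform sv d.
have [DLp [Kp [Kp0 sLp]]] := lagd_smooth_uniform sp d.
pose KL := Kv + Kp.
have KL0 : 0 < KL by rewrite addr_gt0.
have sLv' a : smooth_cube (lagd sv a) (DLv a) KL by apply: smooth_cube_le (sLv a); rewrite lerDl ltW.
have sLp' a : smooth_cube (lagd sp a) (DLp a) KL by apply: smooth_cube_le (sLp a); rewrite lerDr ltW.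
have C0 : 0 < level_C d p K KL H0 mu rho gamma.
  by have [] := level_C_ge d p KL H0 K0 mu0 gr0.
have [c c0 hc] := saddle_smoothing kA kS C0.
exists c => // l m m1.
by apply: (level_smoothing nsv nsp p0 d1 K0 KL0 H00 sLv' sLp' mu0 gr0 (hpos l) (hH l) (EM l) (CM l) oO (cells l)) => //; exact: hc.
Qed.

Theorem mainTheorem1 (R : realType) (d k kA kS : nat)
    (hd : d = 2%N \/ d = 3%N) (hk : (2 <= k)%N)
    (Omega : set 'rV[R]_d) (hOmega : bounded_lipschitz_domain Omega)
    (mu rho gamma : R) (hmu : 0 < mu) (hrho : 0 < rho) (hgamma : 0 <= gamma)
    (Th : nat -> mesh R d) (h : nat -> R) (hTh : mesh_sequence Omega Th h)
    (sv : 'I_k.+1 -> R) (hsv : nodes1D sv)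
    (sp : 'I_(k.-1).+1 -> R) (hsp : nodes1D sp)
    (Vb : forall l, velocity_basis sv Omega (Th l))
    (Pb : forall l, pressure_basis sp Omega (Th l))
    (Z : forall l, zero_mean_coords (Pb l))
    (D : schur_diag) :
  (exists2 c : R, 0 < c &
     forall l m : nat, (1 <= m)%N ->
       smoothing_norm mu rho gamma (h l) (Vb l) (Z l) D kA kS m
         <= c * eta0 R m.-1) /\
  (exists2 eta : nat -> R,
     (forall l m : nat, (1 <= m)%N ->
       smoothing_norm mu rho gamma (h l) (Vb l) (Z l) D kA kS m <= eta m) &
     eta =O_\oo (fun m : nat => (Num.sqrt (m%:R : R))^-1)).
Proof.
have [c c0 hc] : exists2 c : R, 0 < c & forall l m : nat, (1 <= m)%N ->
    smoothing_norm mu rho gamma (h l) (Vb l) (Z l) D kA kS m <= c * eta0 R m.-1.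
  (* Writing k = p + 1 turns the pressure degree [k.-1] into p in all dependent types. *)
  case: k hk sv hsv sp hsp Vb Pb Z => [|p] // hk sv hsv sp hsp Vb Pb Z.
  by apply: uniform_smoothing => //; rewrite mulr_ge0// ltW.
split; first by exists c.
exists (fun m => c * eta0 R m.-1); first exact: hc.
apply: (@eqO_of_bound _ c) => // -[//|m] _ /=.
rewrite ger0_norm ?mulr_ge0 ?eta0_ge0 ?(ltW c0)// ler_wpM2l ?(ltW c0)//.
by rewrite ger0_norm ?invr_ge0 ?sqrtr_ge0// eta0_le_invsqrt.
Qed.
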